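(* Let $\{a,x\}\subset\mathbb N_0$, $a\le x$, $q\in[0,\infty)$. If $q\ge\mu(\tilde r(\varphi)-1)$, i.e. if $\phi_q\le\varphi$, then $$\mathsf P_x[e^{-qT_a^-};T_a^-<\infty]=\frac{\Phi_q(x)}{\Phi_q(a)}.$$ In particular, if $\phi\le\varphi$, then $$\mathsf P_x(T_a^-<\infty)=\frac{\Phi_0(x)}{\Phi_0(a)},$$ and $\mathsf P_x(T_0^-<\infty)=1$ for some (equivalently, all) $x\in\mathbb N$ iff $$\varphi=1\ \text{ and }\ \left(\mu=0\ \text{ or else }\ \phi=1\ \text{ or else }\ \int_0^1\frac{\exp\left\{-\int_\phi^v\frac{\mu(1-\tilde r(w))}{\lambda(\tilde p(w)-w)}\,\mathrm dw\right\}}{\lambda(\tilde p(v)-v)}\,\mathrm dv=\infty\right).$$ If (E) holds and $q\in(0,\infty)$, then for $q>\mu(\tilde r(\varphi)-1)$, i.e. for $\phi_q<\varphi$, $$\mathsf P_x[e^{-q\zeta};\zeta<T_a^-]=\Psi_q(x)-\Psi_q(a)\frac{\Phi_q(x)}{\Phi_q(a)}.$$ Finally, if $\phi\le\varphi$ and (E) holds, then $$\mathsf P_x(\zeta<T_a^-)+\mathsf P_x(T_a^-<\infty)=1.$$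
   Context: Setting. $\mathbb N=\{1,2,\dots\}$, $\mathbb N_0=\mathbb N\cup\{0\}$. Fix $\lambda\in(0,\infty)$, $\mu\in[0,\infty)$, a probability distribution $p=(p_k)_{k\in\mathbb N_0}$ with $p_0>0$ and $p_1=0$, and a probability distribution $r=(r_k)_{k\in\{-1\}\cup\mathbb N}$ (put $r_0:=0$). Assume that $\mu r_k>0$ for some $k\in\mathbb N$ or $p_0<1$. Under probabilities $(\mathsf P_x)_{x\in\mathbb N_0}$, $X=(X_t)_{t\in[0,\infty)}$ is a minimal càdlàg continuous-time Markov chain with state space $\mathbb N_0$, started from $x$ under $\mathsf P_x$, with explosion time (lifetime) $\zeta$, $X$ being set equal to $\infty$ on $[\zeta,\infty)$, and with conservative generator matrix $(Q_{ij})$: $Q_{00}=0$ (state $0$ is absorbing) and, for $n\in\mathbb N$, $-Q_{nn}=\lambda n+\mu$, $Q_{n(n+m)}=p_{m+1}\lambda n+r_m\mu$ for $m\in\mathbb N\cup\{-1\}$. For $a\in\mathbb N_0$, $T_a^-:=\inf\{t\in[0,\zeta):X_t\le a\}$, $\inf\emptyset:=\infty$. We write $\mathsf P_x[F;A]=\mathsf E_{\mathsf P_x}[F\mathbf 1_A]$. Condition (E): $\mathsf P_x(\zeta<\infty)>0$ for some (equivalently, all) $x\in\mathbb N$. Generating functions and roots. For $z\in(0,1]$, $\tilde p(z):=\sum_{k=0}^\infty p_kz^k$ and $\tilde r(z):=\sum_{k=-1}^\infty r_kz^k$. $\varphi$ is the smallest root of $\tilde p(z)=z$ in $z\in(0,1]$.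 If $\mu r_{-1}>0$, then for $q\in(0,\infty)$, $\phi_q$ is the unique root of $q=\mu(\tilde r(z)-1)$ in $z\in(0,1)$, and $\phi$ is the smallest root of $\tilde r(z)=1$ in $z\in(0,1]$; if $\mu r_{-1}=0$, then $\phi_q:=\phi:=0$. Put $\phi_0:=\phi$. The functions $\Phi_q,\Psi_q$ for $q\in(0,\infty)$. Put $\rho(v):=\lambda|\tilde p(v)-v|$ and $\gamma_q(v):=\frac{q+\mu(1-\tilde r(v))}{\rho(v)}$ for $v\in(0,1)\setminus\{\varphi\}$. If $\phi_q<\varphi$, then $\Phi_q(x):=q\int_0^\varphi\frac{\exp\{-\int_{\phi_q}^v\gamma_q(w)\mathrm dw\}}{\rho(v)}v^x\mathrm dv$ and, if moreover (E) holds, $\Psi_q(x):=1-q\int_\varphi^1\frac{\exp\{-\int_v^1\gamma_q(w)\mathrm dw\}}{\rho(v)}v^x\mathrm dv$, for $x\in\mathbb N_0$. If $\phi_q=\varphi$, then $\Phi_q(x):=\varphi^x$, $x\in\mathbb N_0$. The function $\Phi_0$, defined when $\phi\le\varphi$. For $x\in\mathbb N_0$, $$\Phi_0(x):=\mu\int_0^\varphi\frac{\exp\left\{-\int_\phi^v\frac{\mu(1-\tilde r(w))}{\lambda(\tilde p(w)-w)}\mathrm dw\right\}}{\lambda(\tilde p(v)-v)}v^x\,\mathrm dv$$ if either $\mu(1-\tilde r(\varphi))>0$ [i.e. $\mu>0$ and $\phi<\varphi<1$], or $\mu>0$, $\phi<1=\varphi$ and $\int_0^1\frac{\exp\{-\int_\phi^v\frac{\mu(1-\tilde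 r(w))}{\lambda(\tilde p(w)-w)}\mathrm dw\}}{\lambda(\tilde p(v)-v)}\mathrm dv<\infty$; and $\Phi_0(x):=\varphi^x$ otherwise [i.e. if $\mu=0$, or else $\phi=\varphi$, or else $\varphi=1$ and the last integral is $\infty$]. *)

(* Defs.v *)
From HB Require Import structures.
From mathcomp Require Import all_boot all_order all_algebra.
From mathcomp Require Import all_classical all_reals all_analysis.

Set Implicit Arguments.
Unset Strict Implicit.
Unset Printing Implicit Defensive.

Import Order.TTheory GRing.Theory Num.Theory.
Import numFieldNormedType.Exports.

Local Open Scope classical_set_scope.
Local Open Scope ring_scope.

(* A path is a function [w : R -> option nat], [None] being the cemetery state
   in which the path is put from the explosion time on; only its values at
   times [t >= 0] matter. *)

(* Jump times and jump chain (J_n, Y_n).  If J_n.+1 = +oo (absorption), the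
   jump chain stays where it is. *)
Fixpoint jumps (R : realType) (w : R -> option nat) (n : nat)
    : \bar R * option nat :=
  if n is m.+1 then
    let: (J, Y) := jumps w m in
    let J' := ereal_inf
      [set t%:E | t in [set t : R | (J <= t%:E)%E /\ w t <> Y]] in
    (J', if J' is t%:E then w t else Y)
  else (0%E, w 0).

Definition jump_time (R : realType) (w : R -> option nat) (n : nat) : \bar R :=
  (jumps w n).1.

Definition jump_chain (R : realType) (w : R -> option nat) (n : nat)
    : option nat :=
  (jumps w n).2.

Definition holding_time (R : realType) (w : R -> option nat) (n : nat)
    : \bar R :=
  if jump_time w n is s%:E then (jump_time w n.+1 - s%:E)%E else +oo%E.

Definition explosion_time (R : realType) (w : R -> option nat) : \bar R :=
  ereal_sup (range (jump_time w)).

Definition passage_time_below (R : realType) (a : nat) (w : R -> option nat)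
    : \bar R :=
  ereal_inf [set t%:E | t in [set t : R |
    [/\ 0 <= t, (t%:E < explosion_time w)%E
      & exists2 n, w t = Some n & (n <= a)%N]]].

Definition minimal_cadlag_path (R : realType) (w : R -> option nat) : Prop :=
  [/\ forall t, 0 <= t -> (w t = None <-> (explosion_time w <= t%:E)%E),
      forall t, 0 <= t -> (t%:E < explosion_time w)%E ->
        \forall u \near t^'+, w u = w t
    & forall t, 0 < t -> (t%:E < explosion_time w)%E ->
        exists k, \forall u \near t^'-, w u = Some k].

Definition jump_matrix (R : realType) (Q : nat -> nat -> R) (i j : nat) : R :=
  if Q i i == 0 then (i == j)%:R
  else if i == j then 0 else Q i j / (- Q i i).

(* Under [P x] the jump chain is a Markov chain started from x with transition
   matrix [jump_matrix Q] and, given the jump chain, the holding times are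
   independent, exponential with rate [- Q i i] in state i (and a.s. infinite
   if that rate is 0). *)
Definition minimal_markov_chain (R : realType) (d : measure_display)
    (Omega : measurableType d) (Q : nat -> nat -> R)
    (P : nat -> probability Omega R) (X : R -> Omega -> option nat) : Prop :=
  [/\ forall t s, 0 <= t -> measurable [set omega | X t omega = s],
      forall omega, minimal_cadlag_path (X ^~ omega)
    & forall (x n : nat) (i : nat -> nat) (t : nat -> R),
        (forall k, 0 <= t k) ->
        P x [set omega |
               (forall k, (k <= n)%N ->
                  jump_chain (X ^~ omega) k = Some (i k)) /\
               (forall k, (k < n)%N ->
                  ((t k)%:E < holding_time (X ^~ omega) k)%E)]
        = ((i 0%N == x)%:R *
           \prod_(k < n) (jump_matrix Q (i k) (i k.+1) *
                          expR (Q (i k) (i k) * t k)))%:E].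

Definition is_distribution (R : realType) (p : nat -> R) : Prop :=
  (forall k, 0 <= p k) /\ series p @ \oo --> (1 : R).

(* A distribution on {-1, 1, 2, ...} is a family indexed by [int], of which
   only the values at indices >= -1 are ever used. *)
Definition is_immigration_distribution (R : realType) (r : int -> R) : Prop :=
  is_distribution (fun k : nat => r (k%:Z - 1)) /\ r 0 = 0.

(* For i > 0 and j = i + m, m >= -1, m <> 0, the rate is
   p_(m+1) lam i + r_m mu. *)
Definition generator (R : realType) (lam mu : R) (p : nat -> R) (r : int -> R)
    (i j : nat) : R :=
  if i == 0%N then 0
  else if j == i then - (lam * i%:R + mu)
  else if (i <= j.+1)%N then
    p (j.+1 - i)%N * lam * i%:R + r (j%:Z - i%:Z) * mu
  else 0.

Definition can_explode (R : realType) (d : measure_display)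
    (Omega : measurableType d) (P : nat -> probability Omega R)
    (X : R -> Omega -> option nat) : Prop :=
  exists2 x : nat, (0 < x)%N &
    (0 < P x [set omega | explosion_time (X ^~ omega) < +oo])%E.

Definition ptilde (R : realType) (p : nat -> R) (z : R) : R :=
  limn (series (fun k : nat => p k * z ^+ k)).

(* The sum over k >= -1 of r_k z^k, reindexed over nat. *)
Definition rtilde (R : realType) (r : int -> R) (z : R) : R :=
  limn (series (fun k : nat => r (k%:Z - 1) * z ^ (k%:Z - 1))).

Definition least (R : realType) (A : set R) : R :=
  xget 0 [set z | A z /\ forall y, A y -> z <= y].

Definition varphi (R : realType) (p : nat -> R) : R :=
  least [set z | 0 < z <= 1 /\ ptilde p z = z].

Definition phi (R : realType) (mu : R) (r : int -> R) (q : R) : R :=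
  if 0 < mu * r (-1) then
    if q == 0 then least [set z | 0 < z <= 1 /\ rtilde r z = 1]
    else xget 0 [set z | 0 < z < 1 /\ q = mu * (rtilde r z - 1)]
  else 0.

(* Extended-real valued, so that exp (- integral) is 0 when the integral
   diverges to +oo. *)
Definition oriented_integral (R : realType) (a b : R) (f : R -> R) : \bar R :=
  (if (a <= b)%R then \int[lebesgue_measure]_(w in `]a, b[) (f w)%:E
   else - \int[lebesgue_measure]_(w in `]b, a[) (f w)%:E)%E.

Definition rho (R : realType) (lam : R) (p : nat -> R) (v : R) : R :=
  lam * `|ptilde p v - v|.

Definition gamma_ (R : realType) (lam mu : R) (p : nat -> R) (r : int -> R)
    (q v : R) : R :=
  (q + mu * (1 - rtilde r v)) / rho lam p v.

Definition Phi_pos (R : realType) (lam mu : R) (p : nat -> R) (r : int -> R)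
    (q : R) (x : nat) : R :=
  if phi mu r q < varphi p then
    q * fine (\int[lebesgue_measure]_(v in `]0%R, varphi p[)
      (expeR (- oriented_integral (phi mu r q) v (gamma_ lam mu p r q))
       * (v ^+ x / rho lam p v)%:E))%E
  else varphi p ^+ x.

Definition Psi (R : realType) (lam mu : R) (p : nat -> R) (r : int -> R)
    (q : R) (x : nat) : R :=
  1 - q * fine (\int[lebesgue_measure]_(v in `](varphi p), 1%R[)
    (expeR (- oriented_integral v 1 (gamma_ lam mu p r q))
     * (v ^+ x / rho lam p v)%:E))%E.

Definition gamma0 (R : realType) (lam mu : R) (p : nat -> R) (r : int -> R)
    (v : R) : R :=
  mu * (1 - rtilde r v) / (lam * (ptilde p v - v)).

Definition kernel0 (R : realType) (lam mu : R) (p : nat -> R) (r : int -> R)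
    (v : R) : \bar R :=
  (expeR (- oriented_integral (phi mu r 0%R) v (gamma0 lam mu p r))
   * ((lam * (ptilde p v - v))^-1)%:E)%E.

Definition test_integral (R : realType) (lam mu : R) (p : nat -> R)
    (r : int -> R) : \bar R :=
  (\int[lebesgue_measure]_(v in `]0%R, 1%R[) kernel0 lam mu p r v)%E.

Definition Phi_zero (R : realType) (lam mu : R) (p : nat -> R) (r : int -> R)
    (x : nat) : R :=
  if (0 < mu * (1 - rtilde r (varphi p)))
     || [&& 0 < mu, phi mu r 0 < 1, varphi p == 1
          & (test_integral lam mu p r < +oo)%E]
  then mu * fine (\int[lebesgue_measure]_(v in `]0%R, varphi p[)
         (kernel0 lam mu p r v * (v ^+ x)%:E))%E
  else varphi p ^+ x.

Definition Phi (R : realType) (lam mu : R) (p : nat -> R) (r : int -> R)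
    (q : R) (x : nat) : R :=
  if q == 0 then Phi_zero lam mu p r x else Phi_pos lam mu p r q x.

(* Main.v *)
Require Import Defs.
From HB Require Import structures.
From mathcomp Require Import all_boot all_order all_algebra.
From mathcomp Require Import all_classical all_reals all_analysis.
From mathcomp Require Import measurable_realfun ring lra.

Set Implicit Arguments.
Unset Strict Implicit.
Unset Printing Implicit Defensive.

Import Order.TTheory GRing.Theory Num.Theory.
Import numFieldNormedType.Exports.

Local Open Scope classical_set_scope.
Local Open Scope ring_scope.

(** The formulas come from resolvent equations. Let Q be the generator. A
    nonnegative function f with (q - Q) f = 0 above [a] that vanishes at infinity
    satisfies E_x[exp (- q T_a)] = f x / f a: the left side is the smallest
    nonnegative solution with value 1 at [a] ([hit_minimal]), and a maximum
    principle ([maximum_principle]) shows that solutions vanishing at infinity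
    are unique. The maximum principle holds because from every state i > 0 the
    chain steps down to i - 1 at a positive rate.

    On powers the generator is explicit: with D v = lam (ptilde v - v) and
    N v = q + mu (1 - rtilde v),
      (Q - q) v^x = x v^(x-1) D v - N v v^x.
    Hence the mixture of powers f x = int K v * v^x dv is harmonic up to
    boundary terms when K = exp (- G) / D with G' = N / D, for then the integrand
    is the derivative of exp (- G v) v^x ([power_moment_harmonic],
    [exp_power_derive]). The exponent G is the oriented integral of gamma_q in
    the definitions of Phi and Psi.

    Over (0, varphi) the boundary terms vanish: at 0 because G is bounded below
    there, at varphi because 1 / D has a pole there, so that exp (- G) tends to 0
    if N varphi > 0. This gives Phi ([hit_exp_kernel]). If N varphi = 0 and
    varphi < 1, then varphi^x is harmonic ([hit_power]). For q = 0 and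
    varphi = 1 it depends on whether K is integrable at 1: if it is, then again
    exp (- G) tends to 0 ([exp_kernel_vanish_integrable]), and otherwise the
    moments of truncations of K are subharmonic with ratios tending to 1, and
    passage is certain ([hit_certain]).

    Over (varphi, 1) the exponential is 0 at varphi and 1 at 1, and the moments I
    satisfy (q - Q) I = 1. Then 1 - q I, which is Psi, solves the homogeneous
    equation and tends to 1 at infinity; subtracting the right multiple of Phi
    yields E_x[exp (- q zeta); zeta < T_a] ([escape_identity]). This requires
    int^1 dv / |D v| < oo, which is a consequence of explosion: otherwise there
    are approximate subsolutions of (q - Q) m = q that vanish at infinity and are
    close to 1 at any given state, and the escape transform is 0
    ([escape_slow_drift]). Finally, letting q decrease to 0 in the escape
    transform gives a superharmonic function tending to 1 at infinity, so that
    escape and passage together have probability 1 ([hit_or_escape]).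

    The link with the process is [stay_laplace]: E[exp (- q J_n) f(Y_n)] over
    the paths staying in a given set is the n-th iterate of the jump matrix
    weighted by the Laplace transforms of the holding times. Passage and escape
    transforms are a sum and a limit of such iterates ([passage_laplace],
    [escape_laplace]). *)

(** * Probability generating functions *)

Section Pgf.
Variables (R : realType) (f : nat -> R).
Hypothesis f_distr : is_distribution f.

Let f_ge0 k : 0 <= f k. Proof. exact: f_distr.1. Qed.

Lemma distr_sum_le1 n : \sum_(0 <= k < n) f k <= 1.
Proof.
have [f0 f1] := f_distr.
have ndf : nondecreasing_seq (series f).
  by apply: nondecreasing_series => k _ _; exact: f0.
have cf : cvgn (series f) by apply: cvgP; exact: f1.
by have := nondecreasing_cvgn_le ndf cf n; rewrite (cvg_lim (@Rhausdorff R) f1).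
Qed.

Lemma pgf_cvg z : 0 <= z <= 1 -> cvgn (series (fun k => f k * z ^+ k)).
Proof.
move=> /andP[z0 z1]; apply: (series_le_cvg (v_ := f)) => //.
- by move=> n; rewrite mulr_ge0// exprn_ge0.
- by move=> n; rewrite ler_piMr// exprn_ile1.
- by apply: cvgP; exact: f_distr.2.
Qed.

Lemma pgf_nneseries z : 0 <= z <= 1 ->
  (\sum_(k <oo) (f k * z ^+ k)%:E)%E = (ptilde f z)%:E.
Proof.
move=> z01; rewrite /ptilde -EFin_lim; last exact: pgf_cvg.
by congr (limn _); apply/funext => n /=; rewrite sumEFin.
Qed.

(** The terms after the first [n] carry at most the remaining mass, uniformly
    in [z]: this makes a generating function continuous up to 1. *)
Lemma pgf_bounds n z : 0 <= z <= 1 ->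
  \sum_(0 <= k < n) f k * z ^+ k <= ptilde f z <=
  \sum_(0 <= k < n) f k * z ^+ k + (1 - \sum_(0 <= k < n) f k).
Proof.
move=> z01; have /andP[z0 z1] := z01; apply/andP; split.
  apply: (nondecreasing_cvgn_le (u_ := series _)); last exact: pgf_cvg.
  by apply: nondecreasing_series => k _ _; rewrite mulr_ge0 ?exprn_ge0.
apply: limr_le; first exact: pgf_cvg.
near=> m; rewrite /series /=.
have nm : (n <= m)%N by near: m; exists n.
rewrite (big_cat_nat _ nm)//= lerD2l.
rewrite lerBrDl (le_trans _ (distr_sum_le1 m))//.
rewrite [leRHS](big_cat_nat _ nm)//= lerD2l.
by apply: ler_sum => k _; rewrite ler_piMr// exprn_ile1.
Unshelve. all: by end_near. Qed.

Lemma pgf1 : ptilde f 1 = 1.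
Proof.
rewrite /ptilde; under eq_fun do rewrite expr1n mulr1.
by apply/cvg_lim; [exact: Rhausdorff|exact: f_distr.2].
Qed.

Lemma pgf0 : ptilde f 0 = f 0%N.
Proof.
apply/cvg_lim => //; apply: cvg_near_cst; exists 1%N => // n /= n0.
rewrite /series /= -(prednK n0) big_nat_recl// expr0 mulr1 big1 ?addr0// => i _.
by rewrite expr0n mulr0.
Qed.

Lemma ler_pgf z y : 0 <= z -> z <= y -> y <= 1 -> ptilde f z <= ptilde f y.
Proof.
move=> z0 zy y1; apply: ler_lim.
- by apply: pgf_cvg; rewrite z0 (le_trans zy).
- by apply: pgf_cvg; rewrite y1 (le_trans z0).
- near=> n; apply: ler_sum => k _; rewrite ler_wpM2l//.
  by rewrite lerXn2r// nnegrE (le_trans z0).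
Unshelve. all: by end_near. Qed.

Lemma pgf_le1 z : 0 <= z <= 1 -> ptilde f z <= 1.
Proof. by move=> /andP[z0 z1]; rewrite -pgf1 ler_pgf. Qed.

Lemma pgf_ge z : 0 <= z <= 1 -> f 0%N <= ptilde f z.
Proof. by move=> /andP[z0 z1]; rewrite -pgf0 ler_pgf. Qed.

Lemma pgf_unif_cont z e : 0 <= z <= 1 -> 0 < e ->
  exists2 d, 0 < d & forall y, 0 <= y <= 1 -> `|z - y| < d ->
    `|ptilde f z - ptilde f y| < e.
Proof.
move=> z01 e0.
have [n Hn] : exists n, 1 - \sum_(0 <= k < n) f k < e / 2.
  have /cvgrPdist_lt /(_ (e / 2)) := f_distr.2.
  case=> [|n _ Hn]; first by rewrite divr_gt0.
  exists n; have := Hn n (leqnn n); rewrite /series /= ger0_norm//.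
  by rewrite subr_ge0 distr_sum_le1.
pose S (w : R) := \sum_(0 <= k < n) f k * w ^+ k.
have cS : continuous S.
  rewrite /S; elim: n {Hn S} => [|n IH] w.
    by under eq_fun do rewrite big_geq//; exact: cst_continuous.
  under eq_fun do rewrite big_nat_recr//=.
  apply: cvgD; first exact: IH.
  by apply: cvgM; [exact: cvg_cst|exact: exprn_continuous].
have /cvgrPdist_lt /(_ (e / 2)) := cS z.
case=> [|d /= d0 Hd]; first by rewrite divr_gt0.
exists d => // y y01 zy.
have := Hd y zy; have := pgf_bounds n z01; have := pgf_bounds n y01.
rewrite -/(S y) -/(S z) !ltr_norml.
move: Hn; set t := \sum_(0 <= k < n) f k.
by move=> *; lra.
Qed.

Lemma pgf_continuous z : 0 < z < 1 -> {for z, continuous (ptilde f)}.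
Proof.
move=> /andP[z0 z1]; apply/cvgrPdist_lt => e e0.
have z01 : 0 <= z <= 1 by rewrite !ltW.
have [d d0 Hd] := pgf_unif_cont z01 e0.
near=> y; apply: Hd; last by near: y; exists d.
rewrite !ltW//; near: y; [exact: lt_nbhsl|exact: lt_nbhsr].
Unshelve. all: by end_near. Qed.

Lemma expr_chord (a t : R) k : 0 <= a <= 1 -> 0 <= t <= 1 ->
  (a + t * (1 - a)) ^+ k <= a ^+ k + t * (1 - a ^+ k).
Proof.
move=> /andP[a0 a1] /andP[t0 t1].
have b0 : 0 <= a + t * (1 - a) by nra.
elim: k => [|k IH]; first by rewrite !expr0; lra.
rewrite !exprS.
have ak1 : a ^+ k <= 1 by rewrite exprn_ile1.
have := ler_wpM2l b0 IH.
have : 0 <= t * (1 - t) * ((1 - a) * (1 - a ^+ k)).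
  by rewrite !mulr_ge0 ?subr_ge0.
by lra.
Qed.

Lemma expr_chord_strict (a t : R) k : 0 < a < 1 -> 0 < t < 1 ->
  (a + t * (1 - a)) ^+ k.+2 < a ^+ k.+2 + t * (1 - a ^+ k.+2).
Proof.
move=> /andP[a0 a1] /andP[t0 t1].
have b0 : 0 <= a + t * (1 - a) by nra.
have IH : (a + t * (1 - a)) ^+ k.+1 <= a ^+ k.+1 + t * (1 - a ^+ k.+1).
  by apply: expr_chord; rewrite !ltW.
rewrite ![_ ^+ k.+2]exprS.
have ak1 : a ^+ k.+1 < 1 by rewrite exprn_ilt1// ltW.
have := ler_wpM2l b0 IH.
have : 0 < t * (1 - t) * ((1 - a) * (1 - a ^+ k.+1)).
  by rewrite !mulr_gt0 ?subr_gt0.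
by lra.
Qed.

(** Convexity between [a] and 1; the term of index [m] keeps the gap of its own
    power, which gives strict inequalities as soon as [f m > 0] for some
    [m >= 2]. *)
Lemma pgf_convex_gap m a t : 0 <= a <= 1 -> 0 <= t <= 1 ->
  ptilde f (a + t * (1 - a))
    + f m * (a ^+ m + t * (1 - a ^+ m) - (a + t * (1 - a)) ^+ m)
  <= ptilde f a + t * (1 - ptilde f a).
Proof.
move=> a01 t01; have /andP[a0 a1] := a01; have /andP[t0 t1] := t01.
have b01 : 0 <= a + t * (1 - a) <= 1 by apply/andP; split; nra.
rewrite -lerBrDr; apply: limr_le; first exact: pgf_cvg.
near=> n; rewrite /series /= lerBrDr.
have mn : (m < n)%N by near: n; exists m.+1.
apply: (@le_trans _ _ (\sum_(0 <= k < n) f k * (a ^+ k + t * (1 - a ^+ k)))).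
  rewrite -lerBrDl -sumrB (bigD1_seq m) ?mem_index_iota ?iota_uniq//= mulrBr lerDl.
  by apply: sumr_ge0 => k _; rewrite -mulrBr mulr_ge0// subr_ge0 expr_chord.
rewrite (_ : \sum_(0 <= k < n) _ =
    (1 - t) * \sum_(0 <= k < n) f k * a ^+ k + t * \sum_(0 <= k < n) f k); last first.
  by rewrite !mulr_sumr -big_split /=; apply: eq_bigr => k _; ring.
have := distr_sum_le1 n; have /andP[] := pgf_bounds n a01.
set x := \sum_(0 <= k < n) f k * a ^+ k; set y := \sum_(0 <= k < n) f k.
set P := ptilde f a => H1 H2 H3.
have := ler_wpM2l (_ : 0 <= 1 - t) H1; rewrite subr_ge0 => /(_ t1).
have := ler_wpM2l t0 H3.
by lra.
Unshelve. all: by end_near. Qed.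

Lemma distr_branching : f 1%N = 0 -> f 0%N < 1 -> exists m, 0 < f m.+2.
Proof.
move=> f1 f0; apply: contrapT => /forallNP H.
have fm m : f m.+2 = 0.
  by apply/eqP; rewrite eq_le f_ge0 andbT leNgt; apply/negP; exact: H.
have : series f @ \oo --> f 0%N.
  apply: cvg_near_cst; exists 2%N => // n /= n2.
  rewrite /series /= -(subnKC n2) addSn add1n big_nat_recl// big_nat_recl// f1 big1 ?addr0//.
move=> /(cvg_unique (@Rhausdorff R) f_distr.2) f01.
by rewrite -f01 ltxx in f0.
Qed.

(** The convex function [ptilde f v - th * v] is positive at 0 and nonpositive
    at 1: it has a first zero in (0, 1] and is negative between it and 1. With
    [th = 1] this zero is varphi; for the shifted immigration law and
    [th = 1 + q / mu] it is phi_q. *)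
Lemma pgf_root th : 0 < f 0%N -> f 1%N = 0 -> 1 <= th ->
  exists z, [/\ 0 < z <= 1, forall v, 0 <= v < z -> th * v < ptilde f v,
    ptilde f z = th * z, forall v, z < v < 1 -> ptilde f v < th * v
    & 1 < th -> z < 1].
Proof.
move=> f0 f1 th1.
pose S := [set v : R | 0 <= v <= 1 /\ ptilde f v <= th * v].
have S1 : S 1 by split; [rewrite ler01 lexx|rewrite pgf1 mulr1].
have lbS : has_lbound S by exists 0 => v [/andP[]].
have hS : has_inf S by split => //; exists 1.
pose z := inf S.
have z0 : 0 <= z by apply: lb_le_inf => //; [exists 1|move=> v [/andP[]]].
have z1 : z <= 1 by apply: ge_inf.
have z01 : 0 <= z <= 1 by rewrite z0.
have lt_z v : 0 <= v < z -> th * v < ptilde f v.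
  move=> /andP[v0 vz]; rewrite ltNge; apply/negP => le_v.
  have : S v by split => //; rewrite v0 (le_trans (ltW vz)).
  by move=> /(ge_inf lbS); rewrite leNgt vz.
have th0 : 0 < th by rewrite (lt_le_trans _ th1).
have root_le : ptilde f z <= th * z.
  rewrite leNgt; apply/negP => lt.
  pose e := ptilde f z - th * z; have e0 : 0 < e by rewrite subr_gt0.
  have [d d0 Hd] := pgf_unif_cont z01 (divr_gt0 e0 (ltr0n _ 2)).
  pose d' := Num.min d (e / (2 * th)).
  have d'0 : 0 < d' by rewrite lt_min d0/= divr_gt0// mulr_gt0.
  have [v [Sv1 Sv2] vz] := inf_adherent d'0 hS.
  have zv : z <= v by apply: ge_inf.
  have : `|z - v| < d.
    by rewrite ler0_norm ?subr_le0// opprB ltrBlDl (lt_le_trans vz)// lerD2l ge_min lexx.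
  move=> /(Hd v Sv1); rewrite ltr_norml => /andP[_].
  have : th * v < th * z + e / 2.
    have -> : e / 2 = th * (e / (2 * th)) by field; rewrite gt_eqF.
    rewrite -mulrDr ltr_pM2l// (lt_le_trans vz)// lerD2l ge_min lexx ?orbT//.
  by rewrite /e; move: Sv2; lra.
have zpos : 0 < z.
  rewrite lt_neqAle z0 andbT; apply/eqP => zE.
  by move: root_le; rewrite -zE pgf0 mulr0 leNgt f0.
have root_z : ptilde f z = th * z.
  apply/eqP; rewrite eq_le root_le/= leNgt; apply/negP => lt.
  pose e := th * z - ptilde f z; have e0 : 0 < e by rewrite subr_gt0.
  have [d d0 Hd] := pgf_unif_cont z01 (divr_gt0 e0 (ltr0n _ 2)).
  pose d' := Num.min (d / 2) (Num.min z (e / (2 * th))).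
  have d'0 : 0 < d' by rewrite !lt_min divr_gt0// zpos/= divr_gt0// mulr_gt0.
  have d'z : d' <= z by rewrite /d' !ge_min lexx !orbT.
  have d'd : d' < d.
    by apply: (@le_lt_trans _ _ (d / 2)); [rewrite /d' ge_min lexx|lra].
  have d'e : d' <= e / (2 * th) by rewrite /d' !ge_min lexx !orbT.
  have v0 : 0 <= z - d' by rewrite subr_ge0.
  have := lt_z (z - d'); rewrite v0 ltrBlDr ltrDl d'0 => /(_ isT).
  have := Hd (z - d'); rewrite v0 (_ : z - d' <= 1); last by lra.
  rewrite (_ : z - (z - d') = d'); last by ring.
  rewrite (gtr0_norm d'0) => /(_ isT d'd); rewrite ltr_norml => /andP[+ _].
  have : th * d' <= e / 2.
    have -> : e / 2 = th * (e / (2 * th)) by field; rewrite gt_eqF.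
    by rewrite ler_pM2l.
  by rewrite /e mulrBr; lra.
exists z; split=> //.
- by rewrite zpos.
- move=> v /andP[zv v1].
  have z1' : z < 1 by exact: lt_trans v1.
  have z1z : 0 < 1 - z by rewrite subr_gt0.
  pose t := (v - z) / (1 - z).
  have t0 : 0 < t by rewrite divr_gt0// subr_gt0.
  have t1 : t < 1 by rewrite ltr_pdivrMr// mul1r ltrD2r.
  have vE : v = z + t * (1 - z) by rewrite /t divfK ?gt_eqF// subrKC.
  have t01 : 0 <= t <= 1 by rewrite !ltW.
  have [th_gt1|th_le1] := ltP 1 th.
    have := pgf_convex_gap 0 z01 t01; rewrite -vE !expr0.
    have : 0 < t * (th - 1) by rewrite mulr_gt0// subr_gt0.
    by rewrite root_z vE; lra.
  have thE : th = 1 by apply/eqP; rewrite eq_le th1 th_le1.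
  have f01 : f 0%N < 1.
    rewrite ltNge; apply/negP => f01.
    by have := pgf_ge z01; rewrite root_z thE mul1r leNgt (lt_le_trans z1').
  have [m fm] := distr_branching f1 f01.
  have := pgf_convex_gap m.+2 z01 t01; rewrite -vE.
  have : 0 < f m.+2 * (z ^+ m.+2 + t * (1 - z ^+ m.+2) - (z + t * (1 - z)) ^+ m.+2).
    by rewrite mulr_gt0// subr_gt0 expr_chord_strict ?zpos ?t0.
  by rewrite root_z thE !mul1r -vE; lra.
- move=> th_gt1; rewrite lt_neqAle z1 andbT; apply/eqP => zE.
  by move: root_z; rewrite zE pgf1 mulr1 => E; rewrite -E ltxx in th_gt1.
Qed.
End Pgf.

(** * The roots varphi and phi_q *)

Section Roots.
Variables (R : realType) (lam mu : R) (p : nat -> R) (r : int -> R).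
Hypotheses (lam_gt0 : 0 < lam) (mu_ge0 : 0 <= mu).
Hypotheses (p_distr : is_distribution p) (p0_gt0 : 0 < p 0%N) (p1_eq0 : p 1%N = 0).
Hypothesis r_distr : is_immigration_distribution r.

Lemma least_unique (A : set R) z : A z -> (forall y, A y -> z <= y) -> least A = z.
Proof.
move=> Az zmin; apply: xget_unique => // y [Ay ymin].
by apply/eqP; rewrite eq_le zmin// ymin.
Qed.

Lemma varphiP : [/\ 0 < varphi p <= 1,
  forall v, 0 <= v < varphi p -> v < ptilde p v,
  ptilde p (varphi p) = varphi p
  & forall v, varphi p < v < 1 -> ptilde p v < v].
Proof.
have [z [z01 z1 zE z2 _]] := pgf_root p_distr p0_gt0 p1_eq0 (lexx 1).
suff -> : varphi p = z.
  split=> //; last by move=> v /z2; rewrite mul1r.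
    by move=> v /z1; rewrite mul1r.
  by rewrite zE mul1r.
apply: least_unique => /=; first by rewrite zE mul1r.
move=> y [/andP[y0 y1] yE]; rewrite leNgt; apply/negP => yz.
by have := z1 y; rewrite ltW// yz mul1r yE ltxx => /(_ isT).
Qed.

(** Shifting the immigration law by one turns both mechanisms into laws on nat
    for the jump from i to i - 1 + k. *)
Definition shifted_immigration (k : nat) : R := r (k%:Z - 1).
Local Notation rs := shifted_immigration.

Lemma shifted_distr : is_distribution rs. Proof. exact: r_distr.1. Qed.

Lemma shifted1 : rs 1%N = 0.
Proof. by rewrite /rs subrr r_distr.2. Qed.

Lemma shifted0 : rs 0%N = r (-1). Proof. by rewrite /rs sub0r. Qed.

Lemma rtildeE v : 0 < v <= 1 -> rtilde r v = ptilde rs v / v.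
Proof.
move=> /andP[v0 v1].
have v01 : 0 <= v <= 1 by rewrite ltW.
rewrite /rtilde; apply/cvg_lim => //.
rewrite (_ : series _ = (fun n => series (fun k => rs k * v ^+ k) n * v^-1)).
  by apply: cvgM; [exact: (pgf_cvg shifted_distr)|exact: cvg_cst].
apply/funext => n /=; rewrite /series /= mulr_suml.
apply: eq_bigr => k _; rewrite expfzDr ?gt_eqF// -exprnP exprN1.
by rewrite mulrA.
Qed.

(** The part of the resolvent equation that does not involve branching: for the
    generator Q one has
    (q - Q) v^x = killing_balance q v * v^x - x v^(x-1) lam (ptilde v - v).
    Its sign changes at phi_q. *)
Definition killing_balance (q v : R) : R := q + mu * (1 - rtilde r v).
Local Notation N := killing_balance.

Lemma killing_balance1 q : N q 1 = q.
Proof.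
by rewrite /N rtildeE ?ltr01 ?lexx// pgf1 ?divr1 ?subrr ?mulr0 ?addr0//; exact: shifted_distr.
Qed.

Lemma killing_balanceM q v : 0 < v <= 1 ->
  N q v * v = (q + mu) * v - mu * ptilde rs v.
Proof.
move=> v01; rewrite /N rtildeE//; case/andP: v01 => v0 _.
by field; rewrite gt_eqF.
Qed.

Lemma killing_balance_le q v : 0 < v <= 1 -> N q v <= q + mu.
Proof.
move=> /andP[v0 v1]; rewrite /N lerD2l ler_piMr// lerBlDr lerDl rtildeE ?v0//.
rewrite divr_ge0 ?(ltW v0)//; apply: le_trans (pgf_ge shifted_distr _).
  exact: shifted_distr.1.
by rewrite ltW.
Qed.

(** If [mu * r (-1) > 0] then, up to the factor [- mu / v], the balance is the
    convex function of [pgf_root] for the shifted immigration law with slope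
    1 + q / mu, whence the unique sign change. Otherwise the shifted law is
    carried by {2, 3, ...}, its generating function is at most v^2 and the
    balance has no zero in (0, 1). *)
Lemma killing_balance_phi q : 0 <= q ->
  [/\ 0 <= phi mu r q <= 1,
   forall v, 0 < v < phi mu r q -> N q v < 0,
   (0 < phi mu r q -> N q (phi mu r q) = 0),
   (0 < q \/ 0 < mu -> forall v, phi mu r q < v < 1 -> 0 < N q v)
   & 0 < q -> phi mu r q < 1].
Proof.
move=> q0; rewrite /phi; case: ifPn => [mur|]; last first.
  rewrite -leNgt => mur0.
  split=> //; [by rewrite lexx ler01|by move=> v /andP[/lt_trans/[apply]]; rewrite ltxx| | ].
    by rewrite ltxx.
  move=> qmu v /andP[v0 v1].
  have v01 : 0 < v <= 1 by rewrite v0 ltW.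
  have [r0|r0] := eqVneq (r (-1)) 0.
    have rs_le : ptilde rs v <= v ^+ 2.
      apply: limr_le; first by apply: (pgf_cvg shifted_distr); rewrite !ltW.
      near=> n; rewrite /series /=.
      apply: (@le_trans _ _ (\sum_(0 <= k < n) rs k * v ^+ 2)).
        apply: ler_sum => -[|[|k]] _.
        - by rewrite shifted0 r0 !mul0r.
        - by rewrite shifted1 !mul0r.
        - rewrite ler_wpM2l//; first exact: shifted_distr.1.
          by rewrite -(addn2 k) exprD ler_piMl ?exprn_ge0 ?exprn_ile1// ltW.
      by rewrite -mulr_suml ler_piMl ?(distr_sum_le1 shifted_distr)// exprn_ge0// ltW.
    rewrite -(pmulr_lgt0 _ v0) killing_balanceM//.
    have : mu * ptilde rs v <= mu * v ^+ 2 by rewrite ler_wpM2l.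
    have : 0 < q * v \/ 0 < mu * (v * (1 - v)).
      case: qmu => h; [left|right]; rewrite ?mulr_gt0 ?subr_gt0//.
    have : 0 <= q * v by rewrite mulr_ge0// ltW.
    have : 0 <= mu * (v * (1 - v)) by rewrite !mulr_ge0 ?subr_ge0// ltW.
    by rewrite expr2 => h1 h2 [] h3 h4; nra.
  have rp : 0 < r (-1).
    by rewrite lt_neqAle eq_sym r0 -shifted0; exact: shifted_distr.1.
  have mu0 : mu = 0.
    by apply/eqP; rewrite eq_le mu_ge0 andbT -(pmulr_lle0 _ rp).
  by case: qmu => h; [rewrite /N mu0 mul0r addr0|rewrite mu0 ltxx in h].
have rm : 0 < r (-1).
  have : 0 <= r (-1) by rewrite -shifted0; exact: shifted_distr.1.
  by rewrite le_eqVlt => /predU1P[E|//]; rewrite -E mulr0 ltxx in mur.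
have mu0 : 0 < mu by move: mur; rewrite pmulr_lgt0.
have th1 : 1 <= 1 + q / mu by rewrite lerDl divr_ge0.
have rs0_gt0 : 0 < rs 0%N by rewrite shifted0.
have [z [z01 z1 zE z2 zlt1]] := pgf_root shifted_distr rs0_gt0 shifted1 th1.
have NE v : 0 < v <= 1 -> N q v * v = mu * ((1 + q / mu) * v - ptilde rs v).
  by move=> v01; rewrite killing_balanceM//; field; rewrite gt_eqF.
have Nlt v : 0 < v < z -> N q v < 0.
  move=> /andP[v0 vz].
  have v1 : v <= 1 by case/andP: z01 => _; apply: le_trans; exact: ltW.
  rewrite -(pmulr_llt0 _ v0) NE ?v0// pmulr_rlt0// subr_lt0.
  by apply: z1; rewrite ltW.
have Nz : N q z = 0.
  have z0 : 0 < z by case/andP: z01.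
  by apply: (mulIf (lt0r_neq0 z0)); rewrite NE// zE subrr mulr0 mul0r.
have Ngt v : z < v < 1 -> 0 < N q v.
  move=> /andP[zv v1].
  have v0 : 0 < v by case/andP: z01 => z0 _; exact: lt_trans zv.
  rewrite -(pmulr_lgt0 _ v0) NE ?v0 ?ltW// pmulr_rgt0// subr_gt0.
  by apply: z2; rewrite zv.
have rE v : N q v = 0 <-> q = mu * (rtilde r v - 1).
  by rewrite /N; split; lra.
suff -> : (if q == 0 then least [set z | 0 < z <= 1 /\ rtilde r z = 1]
    else xget 0 [set z | 0 < z < 1 /\ q = mu * (rtilde r z - 1)]) = z.
  split=> //.
  - by case/andP: z01 => /ltW -> ->.
  - by move=> qp; apply: zlt1; rewrite ltrDl divr_gt0.
case: ifPn => [/eqP q_eq0|q_neq0].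
  apply: least_unique => /=.
    split=> //; move/rE: Nz; rewrite q_eq0 => /esym/eqP.
    by rewrite mulf_eq0 gt_eqF//= subr_eq0 => /eqP.
  move=> y [/andP[y0 y1] yE]; rewrite leNgt; apply/negP => yz.
  by have := Nlt y; rewrite y0 yz /N yE subrr mulr0 addr0 q_eq0 ltxx => /(_ isT).
have qp : 0 < q by rewrite lt_neqAle eq_sym q_neq0.
have zl : z < 1 by apply: zlt1; rewrite ltrDl divr_gt0.
apply: xget_unique => /=.
  by split; [case/andP: z01 => -> _|exact/rE].
move=> y [/andP[y0 y1] /rE yE].
have [yz|yz|//] := ltgtP y z.
  by have := Nlt y; rewrite y0 yz yE ltxx => /(_ isT).
by have := Ngt y; rewrite yz y1 yE ltxx => /(_ isT).
Unshelve. all: by end_near. Qed.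

Lemma killing_balance_cont q v : 0 < v < 1 -> {for v, continuous (N q)}.
Proof.
move=> /andP[v0 v1].
pose g w := q + mu * (1 - ptilde rs w / w).
have gE w : 0 < w < 1 -> g w = N q w.
  by move=> /andP[w0 w1]; rewrite /N rtildeE// w0 ltW.
have cg : g x @[x --> v] --> g v.
  apply: cvgD; first exact: cvg_cst.
  apply: cvgM; first exact: cvg_cst.
  apply: cvgB; first exact: cvg_cst.
  apply: cvgM; first by apply: (pgf_continuous shifted_distr); rewrite v0.
  by apply: cvgV; rewrite ?gt_eqF.
rewrite /prop_for /continuous_at -gE ?v0//.
apply: cvg_trans cg; apply: near_eq_cvg; near=> w; apply: gE; apply/andP; split.
  by near: w; exact: lt_nbhsr.
by near: w; exact: lt_nbhsl.
Unshelve. all: by end_near. Qed.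

Lemma killing_balance_near1 (q e : R) : 0 < e ->
  exists2 s, 0 < s < 1 & forall v, s <= v < 1 -> `|N q v - q| <= e.
Proof.
move=> e0.
have e'0 : 0 < e / (4 * (mu + 1)).
  by rewrite divr_gt0// mulr_gt0// ltr_pwDr.
have h01 : 0 <= (1 : R) <= 1 by rewrite ler01 /=.
have [d d0 Hd] := pgf_unif_cont shifted_distr h01 e'0.
pose c := Num.min (1 / 2) (Num.min (d / 2) (e / (4 * (mu + 1)))).
have c0 : 0 < c by rewrite !lt_min e'0 !divr_gt0.
have c1 : c <= 1 / 2 by rewrite /c ge_min lexx.
have cd : c <= d / 2 by rewrite /c !ge_min lexx !orbT.
have ce : c <= e / (4 * (mu + 1)) by rewrite /c !ge_min lexx !orbT.
exists (1 - c); first by apply/andP; split; lra.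
move=> v /andP[cv v1].
have v0 : 0 < v by lra.
have v01 : 0 < v <= 1 by rewrite v0 ltW.
have := Hd v; rewrite (ltW v0) (ltW v1) => /(_ isT).
have rs_le : ptilde rs v <= 1.
  by apply: (pgf_le1 shifted_distr); rewrite !ltW.
have v1' : 0 <= 1 - v by rewrite subr_ge0 ltW.
rewrite (pgf1 shifted_distr) (ger0_norm v1').
rewrite (ger0_norm (_ : 0 <= 1 - ptilde rs v)) ?subr_ge0//.
have -> : 1 - v < d by lra.
move=> /(_ isT) rsv.
rewrite /N rtildeE// addrAC subrr add0r.
have -> : mu * (1 - ptilde rs v / v) = mu / v * (v - ptilde rs v).
  by field; rewrite gt_eqF.
have muv0 : 0 <= mu / v by rewrite divr_ge0// ltW.
rewrite normrM (ger0_norm muv0).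
have h : `|v - ptilde rs v| <= e / (2 * (mu + 1)).
  have -> : e / (2 * (mu + 1)) = e / (4 * (mu + 1)) + e / (4 * (mu + 1)).
    by field; rewrite gt_eqF// ltr_pwDr.
  by rewrite ler_norml; apply/andP; split; lra.
have hv : mu / v <= 2 * mu.
  rewrite ler_pdivrMr// mulrC mulrA ler_peMl//; lra.
apply: (@le_trans _ _ (2 * mu * (e / (2 * (mu + 1))))).
  by apply: ler_pM.
have -> : 2 * mu * (e / (2 * (mu + 1))) = e * (mu / (mu + 1)).
  by field; rewrite gt_eqF// ltr_pwDr.
rewrite ler_piMr ?(ltW e0)// ler_pdivrMr ?mul1r ?lerDl//.
by rewrite ltr_pwDr.
Qed.

End Roots.
(** * Calculus on open intervals *)

Section Improper.
Variable R : realType.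
Implicit Types (f g F G A B D : R -> R) (l u a b c v : R).
Local Notation leb := (@lebesgue_measure R).

Definition antiderivative F f l u := forall x : R, x \in `]l, u[ -> is_derive x 1 F (f x).

Lemma itv_cc_sub_oo l u a b : l < a -> b < u -> {subset `[a, b] <= `]l, u[}.
Proof.
move=> la bu x; rewrite !in_itv/= => /andP[ax xb].
by rewrite (lt_le_trans la ax) (le_lt_trans xb bu).
Qed.

Lemma continuous_oo_within f l u a b : l < a -> b < u ->
  {in `]l, u[, continuous f} -> {within `[a, b], continuous f}.
Proof.
move=> la bu cf; apply: continuous_in_subspaceT => x /set_mem xab.
exact/cf/(itv_cc_sub_oo la bu).
Qed.

Lemma continuous_oo_measurable f l u : {in `]l, u[, continuous f} ->
  measurable_fun `]l, u[ f.
Proof.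
move=> cf; apply: open_continuous_measurable_fun; first exact: interval_open.
by move=> x /set_mem; exact: cf.
Qed.

Lemma continuous_oo_measurable_cc f l u a b : l < a -> b < u ->
  {in `]l, u[, continuous f} -> measurable_fun `[a, b] (fun x => (f x)%:E).
Proof.
move=> la bu cf; apply/measurable_EFinP.
apply: measurable_funS (continuous_oo_measurable cf) => //.
exact: itv_cc_sub_oo.
Qed.

Lemma continuous_oo_integrable f l u a b : l < a -> b < u ->
  {in `]l, u[, continuous f} -> leb.-integrable `[a, b] (EFin \o f).
Proof.
move=> la bu cf; apply: continuous_compact_integrable; first exact: segment_compact.
exact: continuous_oo_within cf.
Qed.

Lemma antiderivative_continuous F f l u : antiderivative F f l u ->
  {in `]l, u[, continuous F}.
Proof.
by move=> dF x /dF [dx _]; apply: differentiable_continuous; exact/derivable1_diffP.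
Qed.

Lemma antiderivative_integral F f l u a b : l < a -> a <= b -> b < u ->
  {in `]l, u[, continuous f} -> antiderivative F f l u ->
  (\int[leb]_(x in `[a, b]) (f x)%:E = (F b - F a)%:E)%E.
Proof.
move=> la; rewrite le_eqVlt => /predU1P[<-|ab] bu cf dF.
  by rewrite set_itv1 integral_set1 subrr.
have cF := antiderivative_continuous dF.
rewrite (@continuous_FTC2 _ f F)//; first exact: continuous_oo_within cf.
  split.
  - move=> x; rewrite in_itv/= => /andP[ax xb].
    by have [] : is_derive x 1 F (f x) by apply: dF; rewrite in_itv/= (lt_trans la ax)
        (lt_trans xb bu).
  - apply: cvg_at_right_filter; apply: cF; rewrite in_itv/= la; exact: lt_trans bu.
  - apply: cvg_at_left_filter; apply: cF; rewrite in_itv/= bu andbT; exact: lt_trans ab.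
move=> x; rewrite in_itv/= => /andP[ax xb].
have := dF x; rewrite in_itv/= (lt_trans la ax) (lt_trans xb bu) => /(_ isT).
by rewrite derive1E => h; exact: derive_val.
Qed.

Lemma antiderivative_nondecreasing F f l u :
  antiderivative F f l u -> {in `]l, u[, forall x, 0 <= f x} ->
  {in `]l, u[ &, {homo F : x y / x <= y}}.
Proof.
move=> dF f0 x y; rewrite !in_itv/= => /andP[lx xu] /andP[ly yu].
rewrite le_eqVlt => /predU1P[->//|xy].
have dF' z : z \in `]x, y[ -> is_derive z 1 F (f z).
  rewrite in_itv/= => /andP[xz zy]; apply: dF.
  by rewrite in_itv/= (lt_trans lx xz) (lt_trans zy yu).
have [|c cxy E] := MVT xy dF'.
  exact: (continuous_oo_within lx yu (antiderivative_continuous dF)).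
rewrite -subr_ge0 E mulr_ge0 ?subr_ge0 ?(ltW xy)//.
move: cxy; rewrite in_itv/= => /andP[xc cy].
by apply: f0; rewrite in_itv/= (lt_trans lx xc) (lt_trans cy yu).
Qed.

(** Open intervals are exhausted by the segments [exhaust_l, exhaust_u]; the
    index starts at 3 to keep the left end before the right one. *)
Definition exhaust_l l u (n : nat) : R := l + (u - l) / n.+3%:R.
Definition exhaust_u l u (n : nat) : R := u - (u - l) / n.+3%:R.

Lemma exhaustP l u n : l < u ->
  [/\ l < exhaust_l l u n, exhaust_l l u n <= exhaust_u l u n & exhaust_u l u n < u].
Proof.
move=> lu; have ul : 0 < u - l by rewrite subr_gt0.
split; rewrite /exhaust_l /exhaust_u.
- by rewrite ltrDl divr_gt0.
- have h : (u - l) / n.+3%:R <= (u - l) / 3.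
    by rewrite ler_pM2l// lef_pV2 ?posrE// ler_nat.
  by move: h; set t := (u - l) / n.+3%:R => h; lra.
- by rewrite ltrBlDr ltrDl divr_gt0.
Qed.

Lemma exhaust_cvg0 l u : (u - l) / n.+3%:R @[n --> \oo] --> (0 : R).
Proof.
rewrite -[X in _ --> X](mulr0 (u - l)); apply: cvgM; first exact: cvg_cst.
have := @cvg_harmonic R; rewrite -(cvg_shiftn 2) /=.
by under eq_fun do rewrite addn2.
Qed.

Lemma exhaust_l_cvg l u : exhaust_l l u n @[n --> \oo] --> l.
Proof.
rewrite -[X in _ --> X]addr0; apply: cvgD; first exact: cvg_cst.
exact: exhaust_cvg0.
Qed.

Lemma exhaust_u_cvg l u : exhaust_u l u n @[n --> \oo] --> u.
Proof.
rewrite -[X in _ --> X]subr0; apply: cvgB; first exact: cvg_cst.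
exact: exhaust_cvg0.
Qed.

Lemma exhaust_bigcup l u : l < u ->
  \bigcup_n `[exhaust_l l u n, exhaust_u l u n]%classic = `]l, u[%classic.
Proof.
move=> lu; apply/seteqP; split=> [x [n _] /=|x /=].
  have [ln _ nu] := exhaustP n lu.
  exact: (itv_cc_sub_oo ln nu).
rewrite in_itv/= => /andP[lx xu].
have : \forall n \near \oo, (u - l) / n.+3%:R < Num.min (x - l) (u - x).
  have m0 : 0 < Num.min (x - l) (u - x) by rewrite lt_min !subr_gt0 lx.
  have /cvgrPdist_lt /(_ _ m0) := @exhaust_cvg0 l u.
  apply: filterS => n; rewrite sub0r normrN; apply: le_lt_trans; exact: ler_norm.
case=> n _ /(_ n (leqnn n)) /=; rewrite lt_min => /andP[].
set t := (u - l) / n.+3%:R => h1 h2.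
exists n => //=; rewrite in_itv/= /exhaust_l /exhaust_u -/t.
by apply/andP; split; lra.
Qed.

Lemma improper_integral_cvg f l u : l < u -> {in `]l, u[, continuous f} ->
  {in `]l, u[, forall x, 0 <= f x} ->
  (\int[leb]_(x in `[exhaust_l l u n, exhaust_u l u n]) (f x)%:E)%E @[n --> \oo]
  --> (\int[leb]_(x in `]l, u[) (f x)%:E)%E.
Proof.
move=> lu cf f0; rewrite -(exhaust_bigcup lu).
have ul : 0 < u - l by rewrite subr_gt0.
apply: ge0_nondecreasing_set_cvg_integral => //.
- move=> m n mn; apply/subsetPset => x /=; rewrite !in_itv/= /exhaust_l /exhaust_u.
  have h : (u - l) / n.+3%:R <= (u - l) / m.+3%:R.
    by rewrite ler_pM2l// lef_pV2 ?posrE// ler_nat.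
  move: h; set t := (u - l) / n.+3%:R; set s := (u - l) / m.+3%:R => h.
  by move=> /andP[h1 h2]; apply/andP; split; lra.
- move=> n; have [ln _ nu] := exhaustP n lu.
  exact: (continuous_oo_measurable_cc ln nu cf).
- move=> n x; have [ln _ nu] := exhaustP n lu.
  by move=> /(itv_cc_sub_oo ln nu) /f0; rewrite lee_fin.
Qed.

(** Integrating B' = A - D over ]l, u[ in the form
    int A + B(l) = int D + B(u) with extended values needs no integrability of
    [A] and [D]; finiteness of one side can then be read off the other. *)
Lemma improper_FTC A D B l u (b0 b1 : R) : l < u ->
  {in `]l, u[, continuous A} -> {in `]l, u[, continuous D} ->
  {in `]l, u[, forall x, 0 <= A x} -> {in `]l, u[, forall x, 0 <= D x} ->
  antiderivative B (fun x => A x - D x) l u ->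
  B x @[x --> l^'+] --> b0 -> B x @[x --> u^'-] --> b1 ->
  (\int[leb]_(x in `]l, u[) (A x)%:E + b0%:E =
   \int[leb]_(x in `]l, u[) (D x)%:E + b1%:E)%E.
Proof.
move=> lu cA cD A0 D0 dB Bl Bu.
have cAn := improper_integral_cvg lu cA A0.
have cDn := improper_integral_cvg lu cD D0.
have Bln : (B (exhaust_l l u n))%:E @[n --> \oo] --> b0%:E.
  apply: cvg_EFin; first by near=> n.
  apply: (iffLR (cvg_at_rightP B l b0) Bl); split; last exact: exhaust_l_cvg.
  by move=> n; have [] := exhaustP n lu.
have Bun : (B (exhaust_u l u n))%:E @[n --> \oo] --> b1%:E.
  apply: cvg_EFin; first by near=> n.
  apply: (iffLR (cvg_at_leftP B u b1) Bu); split; last exact: exhaust_u_cvg.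
  by move=> n; have [] := exhaustP n lu.
have adef (x : \bar R) (y : R) : (x +? y%:E)%E by exact: fin_num_adde_defl.
have h1 : (\int[leb]_(x in `[exhaust_l l u n, exhaust_u l u n]) (A x)%:E + (B (exhaust_l l
    u n))%:E)%E
    @[n --> \oo] --> (\int[leb]_(x in `]l, u[) (A x)%:E + b0%:E)%E.
  by apply: cvgeD cAn Bln; exact: adef.
have h2 : (\int[leb]_(x in `[exhaust_l l u n, exhaust_u l u n]) (D x)%:E + (B (exhaust_u l
    u n))%:E)%E
    @[n --> \oo] --> (\int[leb]_(x in `]l, u[) (D x)%:E + b1%:E)%E.
  by apply: cvgeD cDn Bun; exact: adef.
rewrite -(cvg_lim (@ereal_hausdorff R) h1) -(cvg_lim (@ereal_hausdorff R) h2).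
congr (limn _).
apply/funext => n; have [ln lun nu] := exhaustP n lu.
have iA := continuous_oo_integrable ln nu cA.
have iD := continuous_oo_integrable ln nu cD.
have cAD : {in `]l, u[, continuous (fun x => A x - D x)}.
  by move=> x xlu; apply: cvgB; [exact: cA|exact: cD].
have := antiderivative_integral ln lun nu cAD dB.
under eq_integral do rewrite EFinB.
rewrite integralB_EFin//.
have fA : (\int[leb]_(x in `[exhaust_l l u n, exhaust_u l u n]) (A x)%:E)%E \is a fin_num.
  exact: integrable_fin_num iA.
have fD : (\int[leb]_(x in `[exhaust_l l u n, exhaust_u l u n]) (D x)%:E)%E \is a fin_num.
  exact: integrable_fin_num iD.
move: fA fD; move: (\int[leb]_(x in _) (A x)%:E)%E => [a| |] // _.
move: (\int[leb]_(x in _) (D x)%:E)%E => [c| |] // _.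
by rewrite -EFinB => -[E]; rewrite -!EFinD; congr (_%:E); move: E; lra.
Unshelve. all: by end_near. Qed.

End Improper.

Section Antiderivatives.
Variable R : realType.
Implicit Types (f g F G A B D K : R -> R) (l u a b c e k v : R).
Local Notation leb := (@lebesgue_measure R).

Lemma is_derive_power (n : nat) (x : R) : is_derive x 1 (fun v : R => v ^+ n) (n%:R * x ^+ n.-1).
Proof.
have := @is_deriveX R R id n x 1 1 (is_derive_id x (1 : R)).
by rewrite /GRing.scale/= mulr1 exprfctE.
Qed.

Lemma antiderivative_sub F f l u l' u' : l <= l' -> u' <= u ->
  antiderivative F f l u -> antiderivative F f l' u'.
Proof.
move=> ll uu dF x; rewrite in_itv/= => /andP[lx xu].
by apply: dF; rewrite in_itv/= (le_lt_trans ll lx) (lt_le_trans xu uu).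
Qed.

Lemma continuous_oo_sub f l u l' u' : l <= l' -> u' <= u ->
  {in `]l, u[, continuous f} -> {in `]l', u'[, continuous f}.
Proof.
move=> ll uu cf x; rewrite in_itv/= => /andP[lx xu].
by apply: cf; rewrite in_itv/= (le_lt_trans ll lx) (lt_le_trans xu uu).
Qed.

Lemma antiderivative_le F f G g l u : antiderivative F f l u ->
  antiderivative G g l u -> {in `]l, u[, forall x, f x <= g x} ->
  {in `]l, u[ &, forall x y, x <= y -> F y - F x <= G y - G x}.
Proof.
move=> dF dG fg x y xlu ylu xy.
have dGF : antiderivative (G - F) (fun x => g x - f x) l u.
  by move=> z zlu; apply: is_deriveB; [exact: dG|exact: dF].
have gf0 : {in `]l, u[, forall x, 0 <= g x - f x}.
  by move=> z zlu; rewrite subr_ge0; exact: fg.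
have : G x - F x <= G y - F y := antiderivative_nondecreasing dGF gf0 xlu ylu xy.
by lra.
Qed.

Lemma oriented_antiderivative F f l u c v : c \in `]l, u[ -> v \in `]l, u[ ->
  {in `]l, u[, continuous f} -> antiderivative F f l u ->
  oriented_integral c v f = (F v - F c)%:E.
Proof.
rewrite !in_itv/= => /andP[lc cu] /andP[lv vu] cf dF.
have ooE a b : l < a -> b < u -> a <= b ->
    (\int[leb]_(x in `]a, b[) (f x)%:E)%E = (F b - F a)%:E.
  move=> la bu ab; rewrite -(antiderivative_integral la ab bu cf dF).
  rewrite [RHS]integral_itv_bndoo//; apply/measurable_EFinP.
  apply: continuous_oo_measurable; apply: continuous_oo_sub cf; exact: ltW.
rewrite /oriented_integral; case: ifPn => [cv|]; first exact: ooE.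
by rewrite -ltNge => /ltW vc; rewrite ooE// -EFinN opprB.
Qed.

Lemma antiderivative_exists f l u : l < u -> {in `]l, u[, continuous f} ->
  exists F, antiderivative F f l u.
Proof.
move=> lu cf; pose c := (l + u) / 2.
have lc : l < c by rewrite /c; lra.
have cu : c < u by rewrite /c; lra.
exists (fun v => fine (oriented_integral c v f)) => v.
rewrite in_itv/= => /andP[lv vu].
pose a := (l + Num.min c v) / 2; pose b := (Num.max c v + u) / 2.
have [la ac av] : [/\ l < a, a < c & a < v].
  have h1 : l < Num.min c v by rewrite lt_min lc lv.
  have h2 : Num.min c v <= c by rewrite ge_min lexx.
  have h3 : Num.min c v <= v by rewrite ge_min lexx orbT.
  by rewrite /a; split; lra.
have [bu cb vb] : [/\ b < u, c < b & v < b].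
  have h1 : Num.max c v < u by rewrite gt_max cu vu.
  have h2 : c <= Num.max c v by rewrite le_max lexx.
  have h3 : v <= Num.max c v by rewrite le_max lexx orbT.
  by rewrite /b; split; lra.
have cf' : {in `]a, b[, continuous f} by apply: continuous_oo_sub cf; exact: ltW.
pose G y := (\int[leb]_(t in `[a, y]) f t)%R.
have dG : antiderivative G f a b.
  move=> y; rewrite in_itv/= => /andP[ay yb].
  have [] := @continuous_FTC1_closed _ f a y b yb _ ay _.
  - exact: continuous_oo_integrable cf.
  - by apply: cf'; rewrite in_itv/= ay.
  - by rewrite -/G derive1E => dGy <-; exact: DeriveDef.
have vab : v \in `]a, b[ by rewrite in_itv/= av.
have cab : c \in `]a, b[ by rewrite in_itv/= ac.
apply: (@near_eq_is_derive _ _ _ (fun y => G y - G c)); last first.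
  rewrite -[f v]subr0; apply: is_deriveB; first exact: dG.
near=> y; rewrite (oriented_antiderivative cab _ cf' dG)// in_itv/=.
apply/andP; split; near: y; [exact: lt_nbhsr|exact: lt_nbhsl].
Unshelve. all: by end_near. Qed.

Lemma oriented_antiderivative_l F f l u e v : l < v < u ->
  {in `]l, u[, continuous f} -> {in `]l, u[, forall x, 0 <= f x} ->
  antiderivative F f l u -> F x @[x --> l^'+] --> e ->
  oriented_integral l v f = (F v - e)%:E.
Proof.
move=> /andP[lv vu] cf f0 dF Fl.
have Fv : F x @[x --> v^'-] --> F v.
  apply: cvg_at_left_filter.
  by apply: (antiderivative_continuous dF); rewrite in_itv/= lv.
have cf' := continuous_oo_sub (lexx l) (ltW vu) cf.
have dF' := antiderivative_sub (lexx l) (ltW vu) dF.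
have c0 : {in `]l, v[, continuous (fun=> 0 : R)} by move=> x _; exact: cvg_cst.
have f0' : {in `]l, v[, forall x, 0 <= f x}.
  by move=> x; rewrite in_itv/= => /andP[lx xv]; apply: f0; rewrite in_itv/= lx (lt_trans xv).
have dF0 : antiderivative F (fun x => f x - 0) l v.
  by move=> x xl; rewrite subr0; exact: dF'.
have z0 : {in `]l, v[, forall x : R, 0 <= (0 : R)} by [].
rewrite /oriented_integral ltW//.
have := improper_FTC lv cf' c0 f0' z0 dF0 Fl Fv.
rewrite integral0 add0e.
by move=> /(congr1 (fun z => z - e%:E)%E); rewrite addeK// -EFinB.
Qed.

Lemma oriented_antiderivative_r F f l u e v : l < v < u ->
  {in `]l, u[, continuous f} -> {in `]l, u[, forall x, 0 <= f x} ->
  antiderivative F f l u -> F x @[x --> u^'-] --> e ->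
  oriented_integral v u f = (e - F v)%:E.
Proof.
move=> /andP[lv vu] cf f0 dF Fl.
have Fv : F x @[x --> v^'+] --> F v.
  apply: cvg_at_right_filter.
  by apply: (antiderivative_continuous dF); rewrite in_itv/= lv.
have cf' := continuous_oo_sub (ltW lv) (lexx u) cf.
have dF' := antiderivative_sub (ltW lv) (lexx u) dF.
have c0 : {in `]v, u[, continuous (fun=> 0 : R)} by move=> x _; exact: cvg_cst.
have f0' : {in `]v, u[, forall x, 0 <= f x}.
  by move=> x; rewrite in_itv/= => /andP[lx xv]; apply: f0; rewrite in_itv/= xv (lt_trans lv).
have dF0 : antiderivative F (fun x => f x - 0) v u.
  by move=> x xl; rewrite subr0; exact: dF'.
have z0 : {in `]v, u[, forall x : R, 0 <= (0 : R)} by [].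
rewrite /oriented_integral ltW//.
have := improper_FTC vu cf' c0 f0' z0 dF0 Fv Fl.
rewrite integral0 add0e.
by move=> /(congr1 (fun z => z - (F v)%:E)%E); rewrite addeK// -EFinB.
Qed.

(** A derivative of at least k / (u - x) dominates that of - k ln (u - x). *)
Lemma antiderivative_unbounded_r F f l u k : l < u -> 0 < k ->
  antiderivative F f l u -> {in `]l, u[, forall x, k / (u - x) <= f x} ->
  forall M, exists2 w, w \in `]l, u[ & forall v, w <= v < u -> M <= F v.
Proof.
move=> lu k0 dF kf M.
have dL : antiderivative (fun v => - k * ln (u - v)) (fun v => k / (u - v)) l u.
  move=> x; rewrite in_itv/= => /andP[lx xu].
  have ux : 0 < u - x by rewrite subr_gt0.
  have d1 : is_derive x 1 (fun v : R => u - v) (-1).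
    by rewrite -[-1]add0r; apply: is_deriveB.
  have d2 := @is_derive1_comp R (@ln R) (fun v => u - v) x _ _ (is_derive1_ln ux) d1.
  have := is_deriveZ (- k) d2.
  have -> : - k *: ((u - x)^-1 * -1) = k / (u - x) by rewrite /GRing.scale/=; ring.
  by [].
pose x := (l + u) / 2.
have lx : l < x by rewrite /x; lra.
have xu : x < u by rewrite /x; lra.
have xlu : x \in `]l, u[ by rewrite in_itv/= lx.
have ux : 0 < u - x by rewrite subr_gt0.
pose t := Num.max 0 ((M - F x) / k).
have t0 : 0 <= t by rewrite le_max lexx.
pose w := u - (u - x) * expR (- t).
have e1 : expR (- t) <= 1 by rewrite -expR0 ler_expR oppr_le0.
have e0 := expR_gt0 (- t).
have wu : w < u by rewrite /w ltrBlDr ltrDl mulr_gt0.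
have xw : x <= w.
  rewrite /w; have : (u - x) * expR (- t) <= (u - x) * 1 by rewrite ler_pM2l.
  by lra.
have wlu : w \in `]l, u[ by rewrite in_itv/= wu (lt_le_trans lx).
exists w => // v /andP[wv vu].
have vlu : v \in `]l, u[ by rewrite in_itv/= vu (lt_le_trans _ wv) ?(lt_le_trans lx).
have := antiderivative_le dL dF kf xlu vlu (le_trans xw wv).
have : ln (u - v) <= ln (u - x) - t.
  rewrite -(expRK t) -ln_div ?posrE ?expR_gt0// ler_ln ?posrE ?divr_gt0 ?subr_gt0 ?expR_gt0//.
  by rewrite -expRN; move: wv; rewrite /w; lra.
have : M <= F x + k * t.
  have : (M - F x) / k <= t by rewrite le_max lexx orbT.
  by rewrite ler_pdivrMr// mulrC; lra.
have k0' := ltW k0.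
by move=> h1 h2 h3; have := ler_wpM2l k0' h2; lra.
Qed.

Lemma antiderivative_unbounded_l F f l u k : l < u -> 0 < k ->
  antiderivative F f l u -> {in `]l, u[, forall x, k / (x - l) <= f x} ->
  forall M, exists2 w, w \in `]l, u[ & forall v, l < v <= w -> F v <= M.
Proof.
move=> lu k0 dF kf M.
have dG : antiderivative (fun x => - F (l + u - x)) (fun x => f (l + u - x)) l u.
  move=> x; rewrite in_itv/= => /andP[lx xu].
  have d1 : is_derive x 1 (fun v : R => l + u - v) (-1).
    by rewrite -[-1]add0r; apply: is_deriveB.
  have xlu : l + u - x \in `]l, u[ by rewrite in_itv/=; apply/andP; split; lra.
  have := is_deriveN (@is_derive1_comp R F (fun v => l + u - v) x _ _ (dF _ xlu) d1).
  by rewrite mulrN1 opprK.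
have [x xlu|w] := @antiderivative_unbounded_r _ _ l u k lu k0 dG _ (- M).
  have /kf : l + u - x \in `]l, u[.
    by move: xlu; rewrite !in_itv/= => /andP[? ?]; apply/andP; split; lra.
  by congr (_ / _ <= _); ring.
rewrite in_itv/= => /andP[lw wu] H.
exists (l + u - w); first by rewrite in_itv/=; apply/andP; split; lra.
move=> v /andP[lv vw]; have := H (l + u - v).
rewrite lerN2 (_ : l + u - (l + u - v) = v); last by ring.
by apply; apply/andP; split; lra.
Qed.

Lemma integral_pinfty_unbounded F f l u : l < u ->
  {in `]l, u[, continuous f} -> {in `]l, u[, forall x, 0 <= f x} ->
  antiderivative F f l u ->
  (forall M, exists2 w, w \in `]l, u[ & M <= F w) ->
  (\int[leb]_(x in `]l, u[) (f x)%:E = +oo)%E.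
Proof.
move=> lu cf f0 dF H.
apply/eqyP => M M0.
pose x := (l + u) / 2.
have lx : l < x by rewrite /x; lra.
have xu : x < u by rewrite /x; lra.
have [w wlu Fw] := H (Num.max (F x + M) (F x + 1)).
have wlu' := wlu; move: wlu'; rewrite in_itv/= => /andP[lw wu].
have xw : x <= w.
  rewrite leNgt; apply/negP => /ltW wx.
  have : F w <= F x.
    by apply: (antiderivative_nondecreasing dF f0) => //; rewrite in_itv/= lx.
  by move: Fw; rewrite ge_max => /andP[_ h]; lra.
apply: (@le_trans _ _ (\int[leb]_(x in `[x, w]) (f x)%:E)%E).
  rewrite (antiderivative_integral lx xw wu cf dF) lee_fin.
  by move: Fw; rewrite ge_max => /andP[h _]; lra.
apply: ge0_subset_integral => //.
- by apply/measurable_EFinP; exact: continuous_oo_measurable.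
- exact: itv_cc_sub_oo.
Qed.

Lemma integral_pinfty_pole f l u k : l < u -> 0 < k ->
  {in `]l, u[, continuous f} -> {in `]l, u[, forall x, k / (u - x) <= f x} ->
  (\int[leb]_(x in `]l, u[) (f x)%:E = +oo)%E.
Proof.
move=> lu k0 cf kf; have [F dF] := antiderivative_exists lu cf.
apply: (integral_pinfty_unbounded lu cf _ dF) => [x xlu|M].
  apply: le_trans (kf x xlu); rewrite divr_ge0 ?(ltW k0)// subr_ge0 ltW//.
  by move: xlu; rewrite in_itv/= => /andP[].
have [w wlu Fw] := antiderivative_unbounded_r lu k0 dF kf M.
exists w => //; apply: Fw; rewrite lexx/=.
by move: wlu; rewrite in_itv/= => /andP[].
Qed.

Lemma integral_powers_cvg0 K l u : 0 <= l -> u <= 1 -> {in `]l, u[, continuous K} ->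
  {in `]l, u[, forall x, 0 <= K x} ->
  (\int[leb]_(x in `]l, u[) (K x)%:E < +oo)%E ->
  (\int[leb]_(x in `]l, u[) (K x * x ^+ n)%:E)%E @[n --> \oo] --> 0%E.
Proof.
move=> l0 u1 cK K0 Kfin.
have mK := continuous_oo_measurable cK.
have mlu : measurable (`]l, u[ : set R) by [].
have mKn n : measurable_fun `]l, u[ (fun x => (K x * x ^+ n)%:E).
  by apply/measurable_EFinP; apply: measurable_funM.
have mf : measurable_fun `]l, u[ (fun=> 0%E : \bar R) by exact: measurable_cst.
have ff : {ae leb, forall x, `]l, u[%classic x ->
    (K x * x ^+ n)%:E @[n --> \oo] --> (0 : \bar R)%E}.
  apply: aeW => x; rewrite /= in_itv/= => /andP[lx xu].
  apply: cvg_EFin; first by near=> n.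
  rewrite -(mulr0 (K x)); apply: cvgM; first exact: cvg_cst.
  apply: cvg_expr; rewrite ger0_norm; first exact: lt_le_trans u1.
  by apply: ltW; exact: le_lt_trans lx.
have iK : leb.-integrable `]l, u[ (EFin \o K).
  apply/integrableP; split; first exact/measurable_EFinP.
  apply: le_lt_trans Kfin; rewrite le_eqVlt; apply/orP; left; apply/eqP.
  apply: eq_integral => x /set_mem /= xlu; have Kx := K0 _ xlu.
  by rewrite ger0_norm.
have fg : {ae leb, forall x n, `]l, u[%classic x -> (`|(K x * x ^+ n)%:E| <= (EFin \o K) x)%E}.
  apply: aeW => x n /= xlu; have Kx := K0 _ xlu.
  move: xlu; rewrite in_itv/= => /andP[lx xu].
  have x0 : 0 <= x by apply: ltW; exact: le_lt_trans lx.
  rewrite lee_fin ger0_norm ?mulr_ge0 ?exprn_ge0// ler_piMr// exprn_ile1//.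
  by apply: ltW; exact: lt_le_trans u1.
have [_ _] := @dominated_convergence _ _ R leb _ mlu _ _ _ mKn mf ff iK fg.
by rewrite integral0.
Unshelve. all: by end_near. Qed.

End Antiderivatives.

Section IntegralBounds.
Variable R : realType.
Implicit Types (f g : R -> R) (l m u a b C : R).
Local Notation leb := (@lebesgue_measure R).

Let mf f l u : {in `]l, u[, continuous f} -> measurable_fun `]l, u[ (fun v => (f v)%:E).
Proof. by move=> cf; apply/measurable_EFinP; exact: continuous_oo_measurable. Qed.

Lemma integral_oo_split f l m u : l < m -> m < u ->
  {in `]l, u[, continuous f} -> {in `]l, u[, forall v, 0 <= f v} ->
  (\int[leb]_(v in `]l, u[) (f v)%:E =
   \int[leb]_(v in `]l, m[) (f v)%:E + \int[leb]_(v in `]m, u[) (f v)%:E)%E.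
Proof.
move=> lm mu cf f0.
rewrite [in LHS](@itv_bndbnd_setU _ _ _ (BRight m))//; last by rewrite bnd_simp ltW.
rewrite ge0_integral_setU//=; first last.
- rewrite disj_set2E; apply/eqP/seteqP; split => // v [] /=.
  by rewrite !in_itv/= => /andP[_ vm] /andP[mv _]; move: (le_lt_trans vm mv); rewrite ltxx.
- move=> v vlu; rewrite lee_fin f0//; move: vlu; rewrite !in_itv/=.
  move=> [/andP[-> vm]|/andP[mv ->]]; first by rewrite (le_lt_trans vm).
  by rewrite (lt_trans lm).
- by rewrite -itv_bndbnd_setU ?bnd_simp ?ltW//; exact: mf.
congr (_ + _)%E; apply/esym/integral_itv_bndo_bndc.
by apply: mf; apply: continuous_oo_sub cf; rewrite // ltW.
Qed.

Lemma integral_cc_lty f l a b u : l < a -> a <= b -> b < u ->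
  {in `]l, u[, continuous f} -> {in `]l, u[, forall v, 0 <= f v} ->
  (\int[leb]_(v in `]a, b[) (f v)%:E < +oo)%E.
Proof.
move=> la ab bu cf f0.
have /integrableP[_] := continuous_oo_integrable la bu cf.
apply: le_lt_trans.
apply: (@le_trans _ _ (\int[leb]_(v in `[a, b]) (f v)%:E)%E).
  apply: ge0_subset_integral => //.
  - exact: (continuous_oo_measurable_cc la bu cf).
  - by move=> v /(itv_cc_sub_oo la bu) /f0; rewrite lee_fin.
  - exact: subset_itv_oo_cc.
rewrite le_eqVlt; apply/orP; left; apply/eqP; apply: eq_integral => v /set_mem vab.
by rewrite /= ger0_norm// f0//; apply: (itv_cc_sub_oo la bu).
Qed.

Lemma integral_le_cst f l u C : l <= u -> {in `]l, u[, continuous f} ->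
  {in `]l, u[, forall v, 0 <= f v <= C} ->
  (\int[leb]_(v in `]l, u[) (f v)%:E <= (C * (u - l))%:E)%E.
Proof.
move=> lu cf fC.
apply: (@le_trans _ _ (\int[leb]_(v in `]l, u[) (cst C%:E v))%E).
  apply: ge0_le_integral => //.
  - by move=> v /= /fC /andP[f0 _]; rewrite lee_fin.
  - exact: mf.
  - by move=> v /= /fC /andP[_ h]; rewrite lee_fin.
rewrite integral_cst//= lebesgue_measure_itv/= lte_fin.
case: ifP => lu'; first by rewrite -EFinB -EFinM.
by rewrite mule0 lee_fin (_ : u - l = 0) ?mulr0//; apply/eqP; move: lu lu'; rewrite
    le_eqVlt => /orP[/eqP ->|->//]; rewrite subrr.
Qed.

Lemma integral_oo_le f g l u : {in `]l, u[, continuous f} -> {in `]l, u[, continuous g} ->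
  {in `]l, u[, forall v, 0 <= f v <= g v} ->
  (\int[leb]_(v in `]l, u[) (f v)%:E <= \int[leb]_(v in `]l, u[) (g v)%:E)%E.
Proof.
move=> cf cg fg; apply: ge0_le_integral => //.
- by move=> v /= /fg /andP[f0 _]; rewrite lee_fin.
- exact: mf.
- exact: mf.
- by move=> v /= /fg /andP[_ h]; rewrite lee_fin.
Qed.

Lemma integral_oo_subset f l u l' u' : l <= l' -> u' <= u ->
  {in `]l, u[, continuous f} -> {in `]l, u[, forall v, 0 <= f v} ->
  (\int[leb]_(v in `]l', u'[) (f v)%:E <= \int[leb]_(v in `]l, u[) (f v)%:E)%E.
Proof.
move=> ll uu cf f0; apply: ge0_subset_integral => //.
- exact: mf.
- move=> v /=; rewrite !in_itv/= => /andP[lv vu].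
  by rewrite (le_lt_trans ll lv) (lt_le_trans vu uu).
Qed.

Lemma integral_oo_gt0 f l u : l < u -> {in `]l, u[, continuous f} ->
  {in `]l, u[, forall v, 0 < f v} -> (0 < \int[leb]_(v in `]l, u[) (f v)%:E)%E.
Proof.
move=> lu cf f0.
have [F dF] := antiderivative_exists lu cf.
pose a := l + (u - l) / 3; pose b := u - (u - l) / 3.
have la : l < a by rewrite /a; lra.
have bu : b < u by rewrite /b; lra.
have ab : a < b by rewrite /a /b; lra.
apply: (@lt_le_trans _ _ (\int[leb]_(v in `[a, b]) (f v)%:E)%E).
  rewrite (antiderivative_integral la (ltW ab) bu cf dF) lte_fin.
  have sub : {subset `]a, b[ <= `]l, u[}.
    move=> z; rewrite !in_itv/= => /andP[az zb].
    by rewrite (lt_trans la az) (lt_trans zb bu).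
  have dF' z : z \in `]a, b[ -> is_derive z 1 F (f z) by move=> /sub; exact: dF.
  have [|z zab ->] := MVT ab dF'.
    exact: (continuous_oo_within la bu (antiderivative_continuous dF)).
  by rewrite mulr_gt0 ?subr_gt0// f0// sub.
apply: ge0_subset_integral => //.
- exact: mf.
- by move=> v /= /f0 /ltW; rewrite lee_fin.
- exact: itv_cc_sub_oo.
Qed.

End IntegralBounds.

(** * The jump operator and the maximum principle *)

Section JumpOperator.
Variables (R : realType) (lam mu : R) (p : nat -> R) (r : int -> R).
Hypotheses (lam_gt0 : 0 < lam) (mu_ge0 : 0 <= mu).
Hypotheses (p_distr : is_distribution p) (p0_gt0 : 0 < p 0%N).
Hypothesis r_distr : is_immigration_distribution r.
Local Notation rs := (shifted_immigration r).

Definition exit_rate (i : nat) : R := lam * i%:R + mu.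
Definition jump_rate (i k : nat) : R := lam * i%:R * p k + mu * rs k.
Local Notation c := exit_rate.
Local Notation rate := jump_rate.

Local Open Scope ereal_scope.

(** From i the chain jumps to i - 1 + k at rate [jump_rate i k], so the generator
    is [jump_sum f i - exit_rate i * f i]. *)
Definition jump_sum (f : nat -> \bar R) (i : nat) : \bar R :=
  \sum_(k <oo) (rate i k)%:E * f (i.-1 + k)%N.
Local Notation J := jump_sum.

Lemma exit_rate_gt0 i : (0 < i)%N -> (0 < c i)%R.
Proof. by move=> i0; rewrite ltr_pwDl// mulr_gt0// ltr0n. Qed.

Lemma exit_rate_ge0 i : (0 <= c i)%R.
Proof. by rewrite addr_ge0// mulr_ge0// ltW. Qed.

Lemma jump_rate_ge0 i k : (0 <= rate i k)%R.
Proof.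
have rs0 : (0 <= rs k)%R by exact: (shifted_distr r_distr).1.
by rewrite addr_ge0 ?mulr_ge0 ?(p_distr.1) ?(ltW lam_gt0).
Qed.

Lemma jump_rate0_gt0 i : (0 < i)%N -> (0 < rate i 0)%R.
Proof.
move=> i0; have rs0 : (0 <= rs 0)%R by exact: (shifted_distr r_distr).1.
by rewrite ltr_pwDl ?mulr_gt0 ?ltr0n// mulr_ge0.
Qed.

Lemma jump_term_ge0 f i k : (forall j, 0 <= f j) -> 0 <= (rate i k)%:E * f (i.-1 + k)%N.
Proof. by move=> f0; rewrite mule_ge0// lee_fin jump_rate_ge0. Qed.

Lemma jump_sum_ge0 f i : (forall j, 0 <= f j) -> 0 <= J f i.
Proof. by move=> f0; apply: nneseries_ge0 => k _ _; exact: jump_term_ge0. Qed.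

Lemma jump_sum_le f g i : (forall j, 0 <= f j) ->
  (forall j, (i.-1 <= j)%N -> f j <= g j) -> J f i <= J g i.
Proof.
move=> f0 fg; apply: lee_nneseries; first by move=> k _ _; exact: jump_term_ge0.
by move=> k _; rewrite lee_wpmul2l ?lee_fin ?jump_rate_ge0// fg// leq_addr.
Qed.

Lemma jump_sumD f g i : (forall j, 0 <= f j) -> (forall j, 0 <= g j) ->
  J (fun j => f j + g j) i = J f i + J g i.
Proof.
move=> f0 g0; rewrite /J -nneseriesD; try by move=> k _ _; exact: jump_term_ge0.
by apply: eq_eseriesr => k _; rewrite ge0_muleDr.
Qed.

Lemma jump_sumZ (x : R) f i : (forall j, 0 <= f j) ->
  J (fun j => x%:E * f j) i = x%:E * J f i.
Proof.
move=> f0; rewrite /J -nneseriesZl; last by move=> k _; exact: jump_term_ge0.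
by apply: eq_eseriesr => k _; rewrite muleCA.
Qed.

Lemma jump_sum_power v i : (0 <= v <= 1)%R -> (0 < i)%N ->
  J (fun n => (v ^+ n)%:E) i =
  (lam * i%:R * v ^+ i.-1 * ptilde p v + mu * v ^+ i.-1 * ptilde rs v)%:E.
Proof.
move=> v01 i0; have v0 : (0 <= v)%R by case/andP: v01.
have vi : (0 <= v ^+ i.-1)%R by rewrite exprn_ge0.
have rs0 k : (0 <= rs k)%R by exact: (shifted_distr r_distr).1.
have p0 k : (0 <= p k)%R by exact: p_distr.1.
rewrite EFinD !EFinM -[(ptilde p v)%:E](pgf_nneseries p_distr)//.
rewrite -[(ptilde rs v)%:E](pgf_nneseries (shifted_distr r_distr))//.
rewrite -!EFinM -!nneseriesZl; first last.
- by move=> k _; rewrite lee_fin mulr_ge0 ?exprn_ge0 ?p0.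
- by move=> k _; rewrite lee_fin mulr_ge0 ?exprn_ge0 ?p0.
rewrite -nneseriesD; first last.
- by move=> k _ _; rewrite -EFinM lee_fin !mulr_ge0 ?exprn_ge0 ?p0 ?(ltW lam_gt0).
- by move=> k _ _; rewrite -EFinM lee_fin !mulr_ge0 ?exprn_ge0 ?p0 ?(ltW lam_gt0).
apply: eq_eseriesr => k _; rewrite -!EFinM -EFinD; congr (_%:E).
by rewrite /rate exprD; ring.
Qed.

Lemma jump_sum_cst (x : R) i : (0 <= x)%R -> (0 < i)%N ->
  J (fun=> x%:E) i = (c i * x)%:E.
Proof.
move=> x0 i0.
transitivity (J (fun n => x%:E * (1 ^+ n)%:E) i).
  by apply: eq_eseriesr => k _; rewrite expr1n mule1.
rewrite jump_sumZ; last by move=> k; rewrite lee_fin exprn_ge0.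
rewrite jump_sum_power ?ler01 ?lexx// !expr1n (pgf1 p_distr) (pgf1 (shifted_distr r_distr)).
by rewrite !mulr1 -EFinM mulrC.
Qed.

Lemma jump_sum_fin_num f (M : R) i : (0 < i)%N ->
  (forall j, 0 <= f j <= M%:E) -> J f i \is a fin_num.
Proof.
move=> i0 fM; have f0 j : 0 <= f j by case/andP: (fM j).
rewrite ge0_fin_numE ?jump_sum_ge0//.
have M0 : (0 <= M)%R by rewrite -lee_fin; case/andP: (fM 0%N) => /le_trans h /h.
apply: (@le_lt_trans _ _ (J (fun=> M%:E) i)).
  by apply: (jump_sum_le f0) => j _; have /andP[_ ->] := fM j.
by rewrite jump_sum_cst// ltry.
Qed.

(** Fatou's lemma for the jump operator. *)
Lemma jump_sum_cvg_le (f_ : nat -> nat -> \bar R) f (C : nat -> \bar R) (D : \bar R) i :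
  (forall n j, 0 <= f_ n j) -> (forall j, f_ n j @[n --> \oo] --> f j) ->
  (forall j, f j \is a fin_num) ->
  (forall n, J (f_ n) i <= C n) -> C @ \oo --> D -> J f i <= D.
Proof.
move=> f_0 f_f ffin JC CD.
have f0 j : 0 <= f j.
  rewrite -(cvg_lim (@ereal_hausdorff R) (f_f j)); apply: lime_ge; first exact: cvgP (f_f j).
  by near=> n.
apply: lime_le.
  by apply: is_cvg_nneseries => k _ _; exact: jump_term_ge0.
apply: nearW => N.
have cN : \sum_(0 <= k < N) (rate i k)%:E * f_ n (i.-1 + k)%N @[n --> \oo] -->
          \sum_(0 <= k < N) (rate i k)%:E * f (i.-1 + k)%N.
  elim: N => [|N IH].
    by under eq_fun do rewrite big_geq//; rewrite big_geq//; exact: cvg_cst.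
  under eq_fun do rewrite big_nat_recr//=; rewrite big_nat_recr//=.
  apply: cvgeD => //; last by apply: cvgeZl => //; exact: f_f.
  by apply: fin_num_adde_defl; rewrite fin_numM.
rewrite -(cvg_lim (@ereal_hausdorff R) cN) -(cvg_lim (@ereal_hausdorff R) CD).
apply: lee_lim; [exact: cvgP cN|exact: cvgP CD|].
near=> n; apply: le_trans (JC n).
by apply: nneseries_lim_ge => k _ _; exact: jump_term_ge0.
Unshelve. all: by end_near. Qed.

(** limsup (u - v) <= 0: the boundary condition at infinity in the maximum
    principle. *)
Definition eventually_le (u v : nat -> R) := forall e, (0 < e)%R ->
  exists N, forall n, (N <= n)%N -> (u n <= v n + e)%R.

Lemma cvg0_eventually_le (u : nat -> R) : u n @[n --> \oo] --> (0 : R)%R ->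
  eventually_le u (fun=> 0%R).
Proof.
move=> /cvgrPdist_lt H e e0; have [N _ HN] := H e e0; exists N => n /HN.
by rewrite sub0r normrN add0r => /ltW; exact: le_trans (ler_norm _).
Qed.

(** The downward jump, which has positive rate, sees the slack of [u <= v + M]
    at the state below. *)
Lemma jump_sum_strict (u v : nat -> R) (M : R) i : (0 < i)%N ->
  (forall n, 0 <= u n)%R -> (forall n, 0 <= v n)%R -> (0 <= M)%R ->
  (forall n, (i.-1 <= n)%N -> u n <= v n + M)%R ->
  J (EFin \o u) i + (rate i 0 * (v i.-1 + M - u i.-1))%:E <=
  J (EFin \o v) i + (c i * M)%:E.
Proof.
move=> i0 u0 v0 M0 uvM.
rewrite -jump_sum_cst// -jump_sumD//.
have t0 (g : nat -> R) k : (forall n, 0 <= g n)%R -> 0 <= (rate i k)%:E * (g (i.-1 + k)%N)%:E.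
  by move=> g0; rewrite -EFinM lee_fin mulr_ge0// jump_rate_ge0.
rewrite /J nneseries_recl//; last by move=> k _; exact: t0.
rewrite [leRHS]nneseries_recl//; last first.
  by move=> k _; rewrite -EFinD -EFinM lee_fin mulr_ge0 ?jump_rate_ge0 ?addr_ge0.
rewrite addn0 addeAC; apply: leeD.
  by rewrite /= -EFinM -2!EFinD -EFinM lee_fin; lra.
apply: lee_nneseries; first by move=> k _ _; exact: t0.
move=> k _; rewrite -EFinD -!EFinM lee_fin ler_wpM2l ?jump_rate_ge0// uvM//.
exact: leq_addr.
Qed.

(** At the smallest point where [u - v] attains a positive maximum, the state
    below it has a strictly smaller value and is reached at a positive rate,
    which contradicts the two inequalities. *)
Lemma maximum_principle a q (u v : nat -> R) (f : nat -> R) : (0 <= q)%R ->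
  (forall n, 0 <= u n)%R -> (forall n, 0 <= v n)%R ->
  (forall i, (a < i)%N -> ((q + c i) * u i)%:E <= J (EFin \o u) i + (f i)%:E) ->
  (forall i, (a < i)%N -> J (EFin \o v) i + (f i)%:E <= ((q + c i) * v i)%:E) ->
  (u a <= v a)%R -> eventually_le u v ->
  forall i, (a <= i)%N -> (u i <= v i)%R.
Proof.
move=> q0 u0 v0 subu superv ua uv_oo i0 ai0; rewrite leNgt; apply/negP => vu0.
pose w n := (u n - v n)%R.
have w0 : (0 < w i0)%R by rewrite subr_gt0.
(* beyond [N] the difference is at most its value at [i0]: a maximum exists *)
have [N HN] := uv_oo _ w0.
have i0N : (i0 < (maxn N i0).+1)%N by rewrite ltnS leq_maxr.
have [i1 /= ai1 Hmax] := @arg_maxP _ _ _ (Ordinal i0N)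
  (fun i : 'I__ => (a <= i)%N) (fun i : 'I__ => w i) ai0.
pose M := w i1.
have wM n : (a <= n)%N -> (w n <= M)%R.
  move=> an; have [nN|Nn] := ltnP n (maxn N i0).+1.
    exact: (Hmax (Ordinal nN)).
  apply: (@le_trans _ _ (w i0)); last exact: (Hmax (Ordinal i0N)).
  rewrite lerBlDl; apply: HN.
  by rewrite (leq_trans _ (ltnW Nn))// leq_maxl.
have M0 : (0 < M)%R by exact: lt_le_trans (wM _ ai0).
have exM : exists n, (a <= n)%N && (w n == M) by exists i1; rewrite ai1/= eqxx.
case: (ex_minnP exM) => i /andP[ai /eqP wi] imin.
have {}ai : (a < i)%N.
  rewrite ltn_neqAle ai andbT; apply/eqP => aE.
  by move: M0; rewrite -wi -aE subr_gt0 ltNge ua.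
have i_gt0 : (0 < i)%N by exact: leq_ltn_trans ai.
have aj : (a <= i.-1)%N by rewrite -ltnS prednK.
have wj : (w i.-1 < M)%R.
  rewrite lt_neqAle wM// andbT; apply/eqP => wj.
  have := imin i.-1; rewrite aj wj eqxx => /(_ isT).
  by rewrite leqNgt prednK ?leqnn.
have uvM : (forall n, (i.-1 <= n)%N -> u n <= v n + M)%R.
  by move=> n jn; rewrite -lerBlDl; apply: wM; exact: leq_trans jn.
have := jump_sum_strict i_gt0 u0 v0 (ltW M0) uvM.
move: (subu _ ai) (superv _ ai).
have Ju0 : 0 <= J (EFin \o u) i by apply: jump_sum_ge0 => j; rewrite lee_fin.
have Jv0 : 0 <= J (EFin \o v) i by apply: jump_sum_ge0 => j; rewrite lee_fin.
move: (J _ _) (J _ _) Ju0 Jv0 => [x| |] [y| |]//= _ _.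
rewrite -!EFinD !lee_fin.
have uE : u i = (v i + M)%R by rewrite -wi /w; ring.
rewrite uE.
have rd : (0 < rate i 0 * (v i.-1 + M - u i.-1))%R.
  rewrite mulr_gt0 ?jump_rate0_gt0//.
  by move: wj; rewrite /w; lra.
have qM : (0 <= q * M)%R by rewrite mulr_ge0// ltW.
by move: rd; set z := (_ * (_ - _))%R => rd h1 h2 h3; lra.
Qed.

End JumpOperator.

(** * Passage and escape as iterated killed jumps *)

Section Killed.
Variables (R : realType) (lam mu : R) (p : nat -> R) (r : int -> R).
Hypotheses (lam_gt0 : 0 < lam) (mu_ge0 : 0 <= mu).
Hypotheses (p_distr : is_distribution p) (p0_gt0 : 0 < p 0%N).
Hypothesis r_distr : is_immigration_distribution r.
Local Notation c := (exit_rate lam mu).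
Local Notation J := (jump_sum lam mu p r).
Local Notation J_le := (jump_sum_le lam_gt0 mu_ge0 p_distr r_distr).
Local Notation J_ge0 := (jump_sum_ge0 lam_gt0 mu_ge0 p_distr r_distr).
Local Notation JD := (jump_sumD lam_gt0 mu_ge0 p_distr r_distr).
Local Notation JZ := (jump_sumZ lam_gt0 mu_ge0 p_distr r_distr).
Local Notation J_cst := (jump_sum_cst lam_gt0 mu_ge0 p_distr r_distr).
Local Notation c_gt0 := (exit_rate_gt0 lam_gt0 mu_ge0).

Local Open Scope ereal_scope.

(** One jump of the chain killed at rate [q] and stopped on entering [0, a]; the
    mass already at or below [a] is discarded. *)
Definition killed_step (a : nat) (q : R) (f : nat -> \bar R) (i : nat) : \bar R :=
  if (a < i)%N then ((q + c i)^-1)%:E * J f i else 0.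

Definition at_most (a j : nat) : \bar R := ((j <= a)%N%:R)%:E.
Definition above (a j : nat) : \bar R := ((a < j)%N%:R)%:E.

(** E[exp (- q T_a)] decomposed by the number of jumps. *)
Definition hit (a : nat) (q : R) (i : nat) : \bar R :=
  \sum_(n <oo) iter n (killed_step a q) (at_most a) i.

Definition survive (a : nat) (q : R) (n : nat) : nat -> \bar R :=
  iter n (killed_step a q) (above a).

(** E[exp (- q zeta); zeta < T_a] for q > 0; for q = 0 it would also count the
    paths that stay above [a] forever. *)
Definition escape (a : nat) (q : R) (i : nat) : \bar R :=
  limn (fun n => survive a q n i).

Variables (a : nat) (q : R).
Hypothesis q_ge0 : (0 <= q)%R.
Local Notation K := (killed_step a q).

Lemma killed_rate_gt0 i : (a < i)%N -> (0 < q + c i)%R.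
Proof. by move=> ai; rewrite ltr_wpDl// c_gt0// (leq_ltn_trans _ ai). Qed.

Let qcV_ge0 i : (a < i)%N -> 0 <= ((q + c i)^-1)%:E.
Proof. by move=> ai; rewrite lee_fin invr_ge0 ltW// killed_rate_gt0. Qed.

Lemma killed_stepM f i : (a < i)%N -> (q + c i)%:E * K f i = J f i.
Proof.
by move=> ai; rewrite /K ai muleA -EFinM divff ?mul1e// gt_eqF// killed_rate_gt0.
Qed.

Lemma killed_step_ge0 f i : (forall j, 0 <= f j) -> 0 <= K f i.
Proof.
by move=> f0; rewrite /K; case: ifPn => // ai; rewrite mule_ge0 ?qcV_ge0 ?J_ge0.
Qed.

Lemma killed_step_le f g i : (forall j, 0 <= f j) ->
  (forall j, (a <= j)%N -> f j <= g j) -> K f i <= K g i.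
Proof.
move=> f0 fg; rewrite /K; case: ifPn => // ai.
rewrite lee_wpmul2l ?qcV_ge0// J_le// => j ij; apply: fg.
by apply: leq_trans ij; rewrite -ltnS prednK// (leq_ltn_trans _ ai).
Qed.

Lemma killed_iter_ge0 f n i : (forall j, 0 <= f j) -> 0 <= iter n K f i.
Proof.
by move=> f0; elim: n i => [|n IH] i //=; apply: killed_step_ge0.
Qed.

Lemma at_most_ge0 j : 0 <= at_most a j. Proof. by rewrite lee_fin. Qed.
Lemma above_ge0 j : 0 <= above a j. Proof. by rewrite lee_fin. Qed.

Let hit_term n i := iter n K (at_most a) i.

Let hit_term_ge0 n i : 0 <= hit_term n i.
Proof. by apply: killed_iter_ge0; exact: at_most_ge0. Qed.

Lemma hit_partial n i :
  \sum_(0 <= m < n.+1) hit_term m i =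
  at_most a i + K (fun j => \sum_(0 <= m < n) hit_term m j) i.
Proof.
rewrite big_nat_recl//; congr (_ + _).
rewrite /K; case: ifPn => ai; last first.
  by rewrite big1// => m _; rewrite /hit_term /= /K (negbTE ai).
elim: n => [|n IH].
  rewrite big_geq// (_ : (fun _ => _) = (fun=> 0%:E)).
    by rewrite J_cst ?mulr0 ?mule0// (leq_ltn_trans _ ai).
  by apply/funext => j; rewrite big_geq.
rewrite big_nat_recr//= {}IH.
under [in RHS]eq_fun do rewrite big_nat_recr//=.
rewrite JD//; last by move=> j; apply: sume_ge0.
rewrite ge0_muleDr ?J_ge0//; last by move=> j; apply: sume_ge0.
by congr (_ + _); rewrite /hit_term /= {1}/K ai.
Qed.

Lemma hit_ge0 i : 0 <= hit a q i.
Proof. by apply: nneseries_ge0 => n _ _; exact: hit_term_ge0. Qed.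

Lemma hit_start i : (i <= a)%N -> hit a q i = 1.
Proof.
move=> ia; rewrite /hit nneseries_recl//; last by move=> n _; exact: hit_term_ge0.
rewrite eseries0 ?adde0; first by rewrite /= /at_most ia.
by move=> [//|n] _ _; rewrite /= /K ltnNge ia.
Qed.

Lemma hit_harmonic i : (a < i)%N -> (q + c i)%:E * hit a q i = J (hit a q) i.
Proof.
move=> ai.
have -> : hit a q i = \sum_(n <oo) K (hit_term n) i.
  rewrite /hit nneseries_recl//; last by move=> n _; exact: hit_term_ge0.
  rewrite /= /at_most leqNgt ai /= add0e.
  rewrite -(@nneseries_addn _ (fun n => hit_term n i) 1%N)//.
  by apply: eq_eseriesr => n _; rewrite addn1.
rewrite -nneseriesZl; last by move=> n _; exact: killed_step_ge0.
under eq_eseriesr do rewrite killed_stepM//.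
rewrite /J nneseries_interchange; last first.
  by move=> n k; apply: jump_term_ge0.
apply: eq_eseriesr => k _; rewrite /hit.
set x := jump_rate _ _ _ _ _ _.
by rewrite (@nneseriesZl _ (fun n => hit_term n (i.-1 + k)%N)).
Qed.

(** By induction on the number of jumps, any nonnegative supersolution that is
    at least 1 at [a] dominates the partial sums of [hit]. *)
Lemma hit_minimal (Phi : nat -> R) : (forall j, 0 <= Phi j)%R -> (1 <= Phi a)%R ->
  (forall i, (a < i)%N -> J (EFin \o Phi) i <= ((q + c i) * Phi i)%:E) ->
  forall i, (a <= i)%N -> hit a q i <= (Phi i)%:E.
Proof.
move=> Phi0 Phia superPhi i ai.
apply: lime_le; first by apply: is_cvg_nneseries => n _ _; exact: hit_term_ge0.
apply: nearW => n; elim: n i ai => [|n IH] i ai.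
  by rewrite big_geq// lee_fin.
rewrite hit_partial; move: ai; rewrite leq_eqVlt => /predU1P[<-|ai].
  by rewrite /at_most leqnn /K ltnn adde0 lee_fin.
rewrite /at_most leqNgt ai add0e.
apply: (@le_trans _ _ (K (EFin \o Phi) i)).
  by apply: killed_step_le => // j; apply: sume_ge0.
rewrite /K ai muleC lee_pdivrMr ?killed_rate_gt0//.
by apply: le_trans (superPhi _ ai) _; rewrite EFinM muleC.
Qed.

Lemma hit_le1 i : hit a q i <= 1.
Proof.
have [ia|/ltnW ai] := leqP i a; first by rewrite hit_start.
apply: (hit_minimal (Phi := fun=> 1%R)) => // j aj.
rewrite (@J_cst 1%R) ?(leq_ltn_trans _ aj)// lee_fin !mulr1 lerDr.
by [].
Qed.

Definition hit_fine i : R := fine (hit a q i).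

Lemma hit_fineK i : (hit_fine i)%:E = hit a q i.
Proof.
by rewrite fineK// ge0_fin_numE ?hit_ge0// (le_lt_trans (hit_le1 i))// ltry.
Qed.

Lemma hit_fine_ge0 i : (0 <= hit_fine i)%R.
Proof. by rewrite -lee_fin hit_fineK hit_ge0. Qed.

Lemma hit_fineE : EFin \o hit_fine = hit a q.
Proof. by apply/funext => i /=; rewrite hit_fineK. Qed.

Lemma hit_fine_harmonic i : (a < i)%N ->
  ((q + c i) * hit_fine i)%:E = J (EFin \o hit_fine) i.
Proof. by move=> ai; rewrite EFinM hit_fineK hit_harmonic// hit_fineE. Qed.

Lemma hit_fine_start : hit_fine a = 1%R.
Proof. by rewrite /hit_fine hit_start. Qed.

Lemma hit_upper (Phi : nat -> R) : (forall j, 0 <= Phi j)%R -> (0 < Phi a)%R ->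
  (forall i, (a < i)%N -> J (EFin \o Phi) i <= ((q + c i) * Phi i)%:E) ->
  forall i, (a <= i)%N -> (hit_fine i <= Phi i / Phi a)%R.
Proof.
move=> Phi0 Phia superPhi i ai; rewrite -lee_fin hit_fineK.
apply: (hit_minimal (Phi := fun j => Phi j / Phi a)%R) => //.
- by move=> j; rewrite divr_ge0// ltW.
- by rewrite divff// gt_eqF.
- move=> j aj; rewrite (_ : EFin \o _ = (fun j => ((Phi a)^-1)%:E * (EFin \o Phi) j)); last first.
    by apply/funext => k /=; rewrite mulrC EFinM.
  rewrite JZ; last by move=> k; rewrite lee_fin.
  rewrite mulrA EFinM [leRHS]muleC lee_wpmul2l ?superPhi// lee_fin invr_ge0.
  exact: ltW.
Qed.

(** The maximum principle for [F] and [F a * hit]; as [F] vanishes at infinity,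
    no mass escaping there can contribute to it. *)
Lemma hit_lower (F : nat -> R) : (forall j, 0 <= F j)%R ->
  (forall i, (a < i)%N -> ((q + c i) * F i)%:E <= J (EFin \o F) i) ->
  eventually_le F (fun=> 0%R) ->
  forall i, (a <= i)%N -> (F i <= F a * hit_fine i)%R.
Proof.
move=> F0 subF F_oo.
apply: (maximum_principle lam_gt0 mu_ge0 p_distr p0_gt0 r_distr (f := fun=> 0%R) q_ge0) => //.
- by move=> n; rewrite mulr_ge0// hit_fine_ge0.
- by move=> i ai; rewrite adde0 subF.
- move=> i ai; rewrite adde0 (_ : EFin \o _ = (fun j => (F a)%:E * (EFin \o hit_fine) j)) //.
  rewrite JZ; last by move=> j; rewrite lee_fin hit_fine_ge0.
  by rewrite -hit_fine_harmonic// -EFinM lee_fin; lra.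
- by rewrite hit_fine_start mulr1.
- move=> e e0; have [N HN] := F_oo _ e0; exists N => n /HN; rewrite add0r => h.
  by rewrite (le_trans h)// lerDr mulr_ge0// hit_fine_ge0.
Qed.

Lemma survive_ge0 n i : 0 <= survive a q n i.
Proof. by apply: killed_iter_ge0; exact: above_ge0. Qed.

Lemma survive_start n i : (i <= a)%N -> survive a q n i = 0.
Proof.
by move=> ia; case: n => [|n] /=; rewrite ?/above /survive /= /K ?/above ltnNge ia.
Qed.

Lemma survive_decr n i : survive a q n.+1 i <= survive a q n i.
Proof.
elim: n i => [|n IH] i; last first.
  by apply: (@killed_step_le (survive a q n.+1)) => [j|j _]; [exact: (survive_ge0 n.+1)|exact: IH].
rewrite /survive /= /above /K; case: ifPn => // ai.
rewrite muleC lee_pdivrMr ?killed_rate_gt0// mul1e.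
apply: (@le_trans _ _ (J (fun=> 1%:E) i)).
  by apply: J_le => j; rewrite lee_fin// lern1 leq_b1.
by rewrite J_cst// ?(leq_ltn_trans _ ai)// mulr1 lee_fin lerDr.
Qed.

Lemma survive_noninc i : nonincreasing_seq (fun n => survive a q n i).
Proof. by apply/nonincreasing_seqP => n; exact: survive_decr. Qed.

Lemma survive_cvg i : survive a q n i @[n --> \oo] --> escape a q i.
Proof.
by apply: ereal_nonincreasing_is_cvgn; exact: survive_noninc.
Qed.

Lemma escape_ge0 i : 0 <= escape a q i.
Proof.
apply: lime_ge; first exact: survive_cvg.
by apply: nearW => n; exact: survive_ge0.
Qed.

Lemma escape_le n i : escape a q i <= survive a q n i.
Proof.
apply: lime_le; first exact: survive_cvg.
by exists n => // m /= nm; exact: survive_noninc.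
Qed.

Lemma survive_le1 n i : survive a q n i <= 1.
Proof.
apply: (@le_trans _ _ (survive a q 0 i)); first exact: survive_noninc.
by rewrite /survive /= lee_fin lern1 leq_b1.
Qed.

Lemma survive_fin n i : survive a q n i \is a fin_num.
Proof.
by rewrite ge0_fin_numE ?survive_ge0// (le_lt_trans (survive_le1 n i))// ltry.
Qed.

Definition escape_fine i : R := fine (escape a q i).

Lemma escape_fineK i : (escape_fine i)%:E = escape a q i.
Proof.
rewrite fineK// ge0_fin_numE ?escape_ge0//.
by rewrite (le_lt_trans (escape_le 0 i))// (le_lt_trans (survive_le1 0 i))// ltry.
Qed.

Lemma escape_fineE : EFin \o escape_fine = escape a q.
Proof. by apply/funext => i /=; rewrite escape_fineK. Qed.

Lemma escape_fine_ge0 i : (0 <= escape_fine i)%R.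
Proof. by rewrite -lee_fin escape_fineK escape_ge0. Qed.

Lemma escape_fine_le1 i : (escape_fine i <= 1)%R.
Proof. by rewrite -lee_fin escape_fineK (le_trans (escape_le 0 i))// survive_le1. Qed.

Lemma escape_fine_start i : (i <= a)%N -> escape_fine i = 0%R.
Proof.
move=> ia; apply/eqP; rewrite eq_le escape_fine_ge0 andbT -lee_fin escape_fineK.
by rewrite (le_trans (escape_le 0 i))// survive_start.
Qed.

Lemma escape_superharmonic i : (a < i)%N ->
  J (EFin \o escape_fine) i <= ((q + c i) * escape_fine i)%:E.
Proof.
move=> ai; rewrite escape_fineE EFinM escape_fineK.
have h : (q + c i)%:E * survive a q n.+1 i @[n --> \oo] --> (q + c i)%:E * escape a q i.
  apply: cvgeZl => //; rewrite (cvg_shiftS (fun n => survive a q n i)).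
  exact: survive_cvg.
rewrite -(cvg_lim (@ereal_hausdorff R) h); apply: lime_ge; first exact: cvgP h.
apply: nearW => n; rewrite killed_stepM//; apply: J_le.
  by move=> j; exact: escape_ge0.
by move=> j _; exact: escape_le.
Qed.

(** [escape] is a decreasing limit, for which Fatou's lemma is applied to
    [1 - survive]. *)
Lemma escape_subharmonic i : (a < i)%N ->
  ((q + c i) * escape_fine i)%:E <= J (EFin \o escape_fine) i.
Proof.
move=> ai; have i0 : (0 < i)%N by exact: leq_ltn_trans ai.
have J1 f : (forall j, 0 <= f j <= 1) -> J (fun j => 1 - f j) i + J f i = (c i)%:E.
  move=> f01; have f0 j : 0 <= f j by case/andP: (f01 j).
  have f1 j : f j <= 1 by case/andP: (f01 j).
  have ffin j : f j \is a fin_num by rewrite ge0_fin_numE// (le_lt_trans (f1 j))// ltry.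
  rewrite -JD//; last by move=> j; rewrite sube_ge0 ?ffin ?orbT ?f1.
  rewrite -[RHS](_ : J (fun=> 1%:E) i = _); last by rewrite J_cst ?mulr1.
  by congr J; apply/funext => j; rewrite subeK.
have s01 n j : 0 <= survive a q n j <= 1 by rewrite survive_ge0 survive_le1.
have e01 j : 0 <= (EFin \o escape_fine) j <= 1.
  by rewrite /= !lee_fin escape_fine_ge0 escape_fine_le1.
have Jfin f : (forall j, 0 <= f j <= 1) -> J f i \is a fin_num.
  exact: jump_sum_fin_num.
have JE : J (fun j => 1 - (EFin \o escape_fine) j) i <=
    (c i)%:E - ((q + c i) * escape_fine i)%:E.
  apply: (@jump_sum_cvg_le _ _ _ _ _ lam_gt0 mu_ge0 p_distr r_distr
    (fun n j => 1 - survive a q n j) _ (fun n => (c i)%:E - (q + c i)%:E * survive a q n.+1 i)).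
  - by move=> n j; rewrite sube_ge0 ?survive_fin ?orbT ?survive_le1.
  - move=> j; apply: cvgeB => //; first exact: cvg_cst.
    by rewrite /= escape_fineK; exact: survive_cvg.
  - by move=> j.
  - move=> n; rewrite killed_stepM//.
    by rewrite leeBrDr ?J1 ?Jfin.
  - apply: cvgeB => //; first exact: cvg_cst.
    rewrite EFinM escape_fineK; apply: cvgeZl => //.
    rewrite (cvg_shiftS (fun n => survive a q n i)); exact: survive_cvg.
have := J1 _ e01; have := Jfin _ e01; move: JE.
have : J (fun j => 1 - (EFin \o escape_fine) j) i \is a fin_num.
  by apply: Jfin => j /=; rewrite -EFinB !lee_fin subr_ge0 escape_fine_le1 lerBlDr lerDl
      escape_fine_ge0.
move: (J _ _) (J _ _) => [x| |] // [y| |] //= _.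
by rewrite -EFinB -EFinD !lee_fin => h _ [h']; lra.
Qed.

End Killed.

(** * Identifying the passage and escape transforms *)

Section KilledConsequences.
Variables (R : realType) (lam mu : R) (p : nat -> R) (r : int -> R).
Hypotheses (lam_gt0 : 0 < lam) (mu_ge0 : 0 <= mu).
Hypotheses (p_distr : is_distribution p) (p0_gt0 : 0 < p 0%N).
Hypothesis r_distr : is_immigration_distribution r.
Local Notation c := (exit_rate lam mu).
Local Notation J := (jump_sum lam mu p r).
Local Notation J_le := (jump_sum_le lam_gt0 mu_ge0 p_distr r_distr).
Local Notation J_ge0 := (jump_sum_ge0 lam_gt0 mu_ge0 p_distr r_distr).
Local Notation JD := (jump_sumD lam_gt0 mu_ge0 p_distr r_distr).
Local Notation JZ := (jump_sumZ lam_gt0 mu_ge0 p_distr r_distr).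
Local Notation J_cst := (jump_sum_cst lam_gt0 mu_ge0 p_distr r_distr).
Local Notation hit := (hit_fine lam mu p r).
Local Notation escape := (escape_fine lam mu p r).

Local Open Scope ereal_scope.

Let J_cst1 i : (0 < i)%N -> J (EFin \o (fun=> 1%R)) i = (c i)%:E.
Proof. by move=> i0; rewrite [LHS](J_cst ler01 i0) mulr1. Qed.

Lemma jump_sum_addr (u v : nat -> R) i :
  (forall n, 0 <= u n)%R -> (forall n, 0 <= v n)%R ->
  J (EFin \o (fun n => u n + v n)%R) i = J (EFin \o u) i + J (EFin \o v) i.
Proof. by move=> u0 v0; rewrite -JD//; move=> j; rewrite lee_fin. Qed.

Lemma jump_sum_mulr (x : R) (u : nat -> R) i : (forall n, 0 <= u n)%R ->
  J (EFin \o (fun n => x * u n)%R) i = x%:E * J (EFin \o u) i.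
Proof. by move=> u0; rewrite -JZ//; move=> j; rewrite lee_fin. Qed.

(** Minimality gives one inequality and the maximum principle the other. *)
Lemma hit_harmonicE a q (Phi : nat -> R) : (0 <= q)%R ->
  (forall j, 0 <= Phi j)%R -> (0 < Phi a)%R ->
  (forall i, (a < i)%N -> J (EFin \o Phi) i = ((q + c i) * Phi i)%:E) ->
  eventually_le Phi (fun=> 0%R) ->
  forall i, (a <= i)%N -> hit a q i = (Phi i / Phi a)%R.
Proof.
move=> q0 Phi0 Phia harm Phi_oo i ai; apply/eqP; rewrite eq_le; apply/andP; split.
  apply: (hit_upper lam_gt0 mu_ge0 p_distr r_distr) => // j aj; rewrite harm//.
rewrite ler_pdivrMr// mulrC.
by apply: (hit_lower lam_gt0 mu_ge0 p_distr p0_gt0 r_distr) => // j aj; rewrite harm.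
Qed.

(** For [I] with (q - Q) I = 1 on the positive states, both sides are solutions
    of (q - Q) v = q above [a] with the same value at [a]. The left side is at
    most the right one by the maximum principle; for the converse [escape] is
    the limit of [survive], and the inequality propagates from one number of
    jumps to the next. *)
Lemma escape_identity a q (I : nat -> R) : (0 < q)%R ->
  (forall j, 0 <= I j)%R -> eventually_le I (fun=> 0%R) ->
  (forall i, (0 < i)%N -> J (EFin \o I) i + 1 = ((q + c i) * I i)%:E) ->
  eventually_le (hit a q) (fun=> 0%R) ->
  forall i, (a <= i)%N ->
  (escape a q i + q * I i + hit a q i = 1 + q * I a * hit a q i)%R.
Proof.
move=> q_gt0 I0 I_oo harm hit_oo.
have q0 := ltW q_gt0.
have h0 n : (0 <= hit a q n)%R by exact: hit_fine_ge0.
have e0 n : (0 <= escape a q n)%R by exact: escape_fine_ge0.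
have e1 n : (escape a q n <= 1)%R by exact: escape_fine_le1.
have qI0 n : (0 <= q * I n)%R by rewrite mulr_ge0.
have qIh0 n : (0 <= q * I a * hit a q n)%R by rewrite !mulr_ge0.
have Jh i : (a < i)%N -> J (EFin \o hit a q) i = ((q + c i) * hit a q i)%:E.
  by move=> ai; rewrite hit_fine_harmonic.
have JI i : (0 < i)%N -> J (EFin \o (fun n => q * I n)%R) i + q%:E = ((q + c i) * (q * I i))%:E.
  move=> i0; rewrite jump_sum_mulr//.
  have JI0 : 0 <= J (EFin \o I) i by apply: J_ge0 => j; rewrite lee_fin.
  have := harm _ i0; move: JI0; move: (J _ _) => [x| |]//= _.
  rewrite -EFinD => -[E]; rewrite -EFinM -EFinD; congr (_%:E).
  by rewrite mulrCA -E; ring.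
have upper i : (a <= i)%N ->
    (escape a q i + q * I i + hit a q i <= 1 + q * I a * hit a q i)%R.
  apply: (maximum_principle lam_gt0 mu_ge0 p_distr p0_gt0 r_distr (a := a) (f := fun=> q)
      (u := (fun i => escape a q i + q * I i + hit a q i)%R)
    (v := (fun i => 1 + q * I a * hit a q i)%R) q0).
  - by move=> n; rewrite !addr_ge0.
  - by move=> n; rewrite addr_ge0.
  - move=> j aj; have j0 : (0 < j)%N by exact: leq_ltn_trans aj.
    rewrite jump_sum_addr//; last by move=> n; rewrite addr_ge0.
    rewrite jump_sum_addr// Jh// addeAC -[X in _ <= X + _]addeA JI// 2!mulrDr !EFinD.
    rewrite leeD2r// leeD2r//.
    exact: (escape_subharmonic lam_gt0 mu_ge0 p_distr r_distr).
  - move=> j aj; have j0 : (0 < j)%N by exact: leq_ltn_trans aj.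
    rewrite (jump_sum_addr (u := fun=> 1%R))//.
    rewrite jump_sum_mulr// Jh// J_cst1// -EFinM -!EFinD lee_fin.
    by rewrite le_eqVlt; apply/orP; left; apply/eqP; ring.
  - by rewrite escape_fine_start// hit_fine_start//; lra.
  - move=> e e_gt0; have e2 : (0 < e / (2 * q))%R by rewrite divr_gt0// mulr_gt0.
    have e3 : (0 < e / 2)%R by rewrite divr_gt0.
    have [N1 H1] := I_oo _ e2; have [N2 H2] := hit_oo _ e3.
    exists (maxn N1 N2) => n; rewrite geq_max => /andP[/H1 h1 /H2 h2].
    have h3 : (q * I n <= e / 2)%R.
      have -> : (e / 2 = q * (e / (2 * q)))%R by field; rewrite gt_eqF.
      by rewrite ler_pM2l//; lra.
    by have := e1 n; have := qIh0 n; lra.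
have bounded i : (a <= i)%N -> (q * I a * hit a q i <= q * I i + hit a q i)%R.
  apply: (maximum_principle lam_gt0 mu_ge0 p_distr p0_gt0 r_distr (a := a) (f := fun=> 0%R)
      (u := (fun i => q * I a * hit a q i)%R)
    (v := (fun i => q * I i + hit a q i)%R) q0) => //.
  - by move=> n; rewrite addr_ge0.
  - move=> j aj; rewrite adde0 jump_sum_mulr// Jh// -EFinM lee_fin.
    by rewrite le_eqVlt; apply/orP; left; apply/eqP; ring.
  - move=> j aj; have j0 : (0 < j)%N by exact: leq_ltn_trans aj.
    rewrite adde0 jump_sum_addr// Jh//.
    apply: (@le_trans _ _ (((q + c j) * (q * I j))%:E + ((q + c j) * hit a q j)%:E)).
      by rewrite leeD2r// -JI// leeDl// lee_fin.
    by rewrite -EFinD lee_fin mulrDr.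
  - by rewrite hit_fine_start//; lra.
  - have [qIa|qIa] := leP (q * I a)%R 0%R.
      move=> e e_gt0; exists 0%N => n _.
      have : (q * I a * hit a q n <= 0)%R by rewrite mulr_le0_ge0.
      by have := qI0 n; have := h0 n; lra.
    move=> e e_gt0; have [N HN] := hit_oo _ (divr_gt0 e_gt0 qIa).
    exists N => n /HN; rewrite add0r ler_pdivlMr// mulrC => h.
    by rewrite (le_trans h)// lerDr addr_ge0.
have lower n i : (a <= i)%N -> (1 + q * I a * hit a q i)%:E <=
    survive lam mu p r a q n i + (q * I i + hit a q i)%:E.
  elim: n i => [|n IH] i ai; have := ai; rewrite leq_eqVlt => /predU1P[<-|ai'].
  - by rewrite hit_fine_start// survive_start// add0e lee_fin; lra.
  - by rewrite /survive /= /above ai' -EFinD lee_fin lerD2l bounded.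
  - by rewrite hit_fine_start// survive_start// add0e lee_fin; lra.
  - have i0 : (0 < i)%N by exact: leq_ltn_trans ai'.
    have qc : (0 < q + c i)%R by exact: killed_rate_gt0 ai'.
    rewrite -(@lee_pmul2l _ (q + c i)%:E)// ?lte_fin//.
    have s0 m j : 0 <= survive lam mu p r a q m j by exact: survive_ge0.
    rewrite ge0_muleDr//; last by rewrite lee_fin addr_ge0.
    rewrite [survive _ _ _ _ _ _ _](_ : _ = killed_step lam mu p r a q (survive lam mu p r
        a q n))//.
    rewrite killed_stepM//.
    rewrite -!EFinM [((q + c i) * (q * I i + hit a q i))%R]mulrDr EFinD -JI// mulrDr.
    have -> : ((q + c i) * 1 + (q + c i) * (q * I a * hit a q i))%:E =
       J (fun n => (1 + q * I a * hit a q n)%:E) i + q%:E.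
      rewrite [X in _ = X + _](jump_sum_addr (u := fun=> 1%R))//.
      rewrite jump_sum_mulr// Jh// J_cst1// -EFinM -!EFinD; congr (_%:E).
      by ring.
    rewrite -Jh// addeAC addeA leeD2r//.
    rewrite -!JD//; last by move=> j; rewrite /= -EFinD lee_fin addr_ge0.
    apply: J_le; first by move=> j; rewrite lee_fin addr_ge0.
    move=> j ij; rewrite /= -?addeA -EFinD; apply: IH.
    by apply: leq_trans ij; rewrite -ltnS prednK.
move=> i ai; apply/eqP; rewrite eq_le upper//=.
have cS : survive lam mu p r a q n i + (q * I i + hit a q i)%:E @[n --> \oo]
    --> (escape a q i + (q * I i + hit a q i))%:E.
  rewrite [X in _ --> X]EFinD; apply: cvgeD; [exact: fin_num_adde_defl| |exact: cvg_cst].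
  by rewrite escape_fineK//; exact: survive_cvg.
rewrite -addrA -lee_fin -(cvg_lim (@ereal_hausdorff R) cS).
apply: lime_ge; first exact: cvgP cS.
by apply: nearW => n; exact: lower.
Qed.

(** Probes: if functions close to 1 at [i] that vanish at infinity are nearly
    subsolutions of (q - Q) m = q, then adding [escape] to them and comparing
    with the constant 1 leaves no room for [escape]. *)
Lemma escape_vanish a (q : R) i : (0 < q)%R -> (a <= i)%N ->
  (forall e, (0 < e)%R -> exists m : nat -> R,
     [/\ forall n, (0 <= m n <= 1)%R, eventually_le m (fun=> 0%R),
         forall n, (a < n)%N -> ((q + c n) * m n)%:E <= J (EFin \o m) n + (q + e)%:E
       & (1 - e <= m i)%R]) ->
  escape a q i = 0%R.
Proof.
move=> q_gt0 ai H; have q0 := ltW q_gt0.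
have e0 n : (0 <= escape a q n)%R by exact: escape_fine_ge0.
apply/eqP; rewrite eq_le e0 andbT; apply/ler_addgt0Pl => d d0.
rewrite addr0.
have q1 : (0 < 1 + q^-1)%R by rewrite addr_gt0// invr_gt0.
pose e := (d / (1 + q^-1))%R; have e_gt0 : (0 < e)%R by rewrite divr_gt0.
have [m [m01 m_oo subm mi]] := H _ e_gt0.
have m0 n : (0 <= m n)%R by case/andP: (m01 n).
have eq0 : (0 <= e / q)%R by rewrite divr_ge0// ltW.
have : (escape a q i + m i <= 1 + e / q)%R.
  apply: (maximum_principle lam_gt0 mu_ge0 p_distr p0_gt0 r_distr (a := a) (f := fun=> (q + e)%R)
    (u := (fun i => escape a q i + m i)%R) (v := (fun=> 1 + e / q)%R) q0) => //.
  - by move=> n; rewrite addr_ge0.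
  - by move=> n; rewrite addr_ge0.
  - move=> n an; rewrite jump_sum_addr// mulrDr EFinD -addeA.
    apply: leeD; last exact: subm.
    exact: (escape_subharmonic lam_gt0 mu_ge0 p_distr r_distr q0 an).
  - move=> n an; have n0 : (0 < n)%N by exact: leq_ltn_trans an.
    have e0' : (0 <= 1 + e / q)%R by rewrite addr_ge0.
    rewrite [X in X + _](J_cst e0' n0) -EFinD lee_fin.
    rewrite le_eqVlt; apply/orP; left; apply/eqP.
    by field; rewrite gt_eqF.
  - rewrite escape_fine_start// add0r.
    by have /andP[_ h] := m01 a; lra.
  - move=> e' /m_oo [N HN]; exists N => n /HN.
    have : (escape a q n <= 1)%R by exact: escape_fine_le1.
    lra.
have : (d = e + e / q)%R.
  by rewrite /e; field; rewrite !gt_eqF//; rewrite addrC -(@pmulr_rgt0 _ q^-1) ?invr_gt0//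
      mulrDr mulVf ?gt_eqF// mulr1 addrC.
lra.
Qed.

Lemma escape_antitone a (q q' : R) i : (0 <= q)%R -> (q <= q')%R ->
  (escape a q' i <= escape a q i)%R.
Proof.
move=> q0 qq; have q'0 := le_trans q0 qq.
rewrite -lee_fin !escape_fineK//.
apply: lee_lim; [exact: survive_cvg|exact: survive_cvg|].
apply: nearW => n; elim: n i => [|n IH] i //.
rewrite /survive /= -/(survive lam mu p r a q' n) -/(survive lam mu p r a q n).
have s0 qq' (h : (0 <= qq')%R) j : 0 <= survive lam mu p r a qq' n j by exact: survive_ge0.
apply: (@le_trans _ _ (killed_step lam mu p r a q' (survive lam mu p r a q n) i)).
  by apply: killed_step_le => // j; exact: s0.
rewrite /killed_step; case: ifPn => // ai.
rewrite lee_wpmul2r ?J_ge0//; first by move=> j; exact: s0.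
have h1 : (0 < q + c i)%R by exact: killed_rate_gt0 ai.
have h2 : (0 < q' + c i)%R by exact: killed_rate_gt0 ai.
by rewrite lee_fin lef_pV2 ?posrE// lerD2r.
Qed.

(** As q' decreases to 0, [escape a q'] increases to a supersolution [B] of
    Q B = 0, which tends to 1 at infinity since [escape a q <= B]; so [B + hit]
    dominates 1. *)
Lemma hit_or_escape a (q : R) i (b : R) : (0 < q)%R -> (a <= i)%N ->
  (forall q' : R, (0 < q')%R -> (escape a q' i <= b)%R) ->
  eventually_le (fun=> 1%R) (escape a q) ->
  (1 <= b + hit a 0 i)%R.
Proof.
move=> q0 ai Hb e_oo.
pose s n : R := (n.+1%:R^-1)%R.
have s0 n : (0 < s n)%R by rewrite invr_gt0.
have ss n m : (n <= m)%N -> (s m <= s n)%R.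
  by move=> nm; rewrite lef_pV2 ?posrE// ler_nat.
have e0 (q' : R) j : (0 < q')%R -> (0 <= escape a q' j)%R.
  by move=> q'0; apply: escape_fine_ge0 => //; exact: ltW.
have e1 (q' : R) j : (0 < q')%R -> (escape a q' j <= 1)%R.
  by move=> q'0; apply: escape_fine_le1 => //; exact: ltW.
pose x j n := escape a (s n) j.
have nd j : nondecreasing_seq (x j).
  by move=> n m nm; apply: escape_antitone; [exact: ltW|exact: ss].
have ub j : has_ubound (range (x j)) by exists 1%R => _ [n _ <-]; exact: e1.
have cx j : cvgn (x j) by exact: nondecreasing_is_cvgn.
pose B j := limn (x j).
have xB j n : (x j n <= B j)%R by exact: nondecreasing_cvgn_le.
have B0 j : (0 <= B j)%R by apply: le_trans (xB j 0%N); exact: e0.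
have Bb : (B i <= b)%R by apply: limr_le; [exact: cx|apply: nearW => n; exact: Hb].
have h0 n : (0 <= hit a 0 n)%R by exact: hit_fine_ge0.
apply: le_trans (_ : B i + hit a 0 i <= _)%R; last by rewrite lerD2r.
apply: (maximum_principle lam_gt0 mu_ge0 p_distr p0_gt0 r_distr (a := a) (f := fun=> 0%R)
    (u := (fun=> 1)%R) (v := (fun j => B j + hit a 0 j)%R) (lexx 0%R)) => //.
- by move=> n; rewrite addr_ge0.
- move=> n an; have n0 : (0 < n)%N by exact: leq_ltn_trans an.
  by rewrite J_cst1// adde0 add0r mulr1.
- move=> n an; rewrite adde0 jump_sum_addr// mulrDr EFinD.
  apply: leeD; last by rewrite hit_fine_harmonic.
  apply: (@jump_sum_cvg_le _ _ _ _ _ lam_gt0 mu_ge0 p_distr r_distr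
    (fun m j => (x j m)%:E) _ (fun m => ((s m + c n) * x n m)%:E)).
  + by move=> m j; rewrite lee_fin; exact: e0.
  + by move=> j; apply: cvg_EFin; [apply: nearW|exact: cx].
  + by move=> j.
  + by move=> m; apply: escape_superharmonic => //; exact: ltW.
  + apply: cvg_EFin; first by apply: nearW.
    apply: cvgM; last exact: cx.
    apply: cvgD; last exact: cvg_cst.
    exact: cvg_harmonic.
- by rewrite hit_fine_start// lerDr.
- move=> e /e_oo [N HN]; exists N => n /HN h.
  have [m sm] : exists m, (s m <= q)%R.
    have /cvgrPdist_lt /(_ _ q0) [m _ /(_ m (leqnn m))] := @cvg_harmonic R.
    rewrite sub0r normrN => hm; exists m; apply: ltW; apply: le_lt_trans hm.
    exact: ler_norm.
  have : (escape a q n <= x n m)%R by apply: escape_antitone => //; exact: ltW.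
  by have := xB n m; have := h0 n; lra.
Qed.

End KilledConsequences.

(** * Paths, jump times and passage times *)

Section Paths.
Variables (R : realType) (w : R -> option nat).
Hypothesis w_path : minimal_cadlag_path w.
Local Notation T := (jump_time w).
Local Notation Y := (jump_chain w).
Local Notation zeta := (explosion_time w).
Local Open Scope ereal_scope.

Lemma jump_timeS n : T n.+1 =
  ereal_inf [set t%:E | t in [set t : R | T n <= t%:E /\ w t <> Y n]].
Proof. by rewrite /jump_time /jump_chain /=; case: (jumps w n). Qed.

Lemma jump_chainS n : Y n.+1 = if T n.+1 is t%:E then w t else Y n.
Proof. by rewrite /jump_time /jump_chain /=; case: (jumps w n). Qed.

Lemma jump_time_leS n : T n <= T n.+1.
Proof. by rewrite jump_timeS; apply: le_ereal_inf_tmp => _ [t [h _] <-]. Qed.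

Lemma jump_time_homo : {homo T : n m / (n <= m)%N >-> n <= m}.
Proof. by apply: homo_leq => //; [exact: le_trans|exact: jump_time_leS]. Qed.

Lemma jump_time_ge0 n : 0 <= T n.
Proof. exact: (@jump_time_homo 0%N n). Qed.

Lemma jump_time_le_explosion n : T n <= zeta.
Proof. by apply: ereal_sup_ubound; exists n. Qed.

Lemma explosion_time_ge0 : 0 <= zeta.
Proof. exact: le_trans (jump_time_le_explosion 0). Qed.

Lemma jump_chain_at n t : T n = t%:E -> Y n = w t.
Proof.
case: n => [|n] Tn; first by case: Tn => <-.
by rewrite jump_chainS Tn.
Qed.

Lemma path_alive t : (0 <= t)%R -> t%:E < zeta -> exists k, w t = Some k.
Proof.
move=> t0 tz; case E : (w t) => [k|]; first by exists k.
have [+ _ _] := w_path => /(_ t t0) [/(_ E) + _].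
by rewrite leNgt tz.
Qed.

Lemma path_dead t : (0 <= t)%R -> zeta <= t%:E -> w t = None.
Proof. by move=> t0 zt; have [h _ _] := w_path; apply/h. Qed.

(** Otherwise the path would already be in the cemetery at the jump, and then
    would never jump again. *)
Lemma jump_time_lt_explosion n t : T n = t%:E -> t%:E < zeta.
Proof.
move=> Tn; have t0 : (0 <= t)%R by rewrite -lee_fin -Tn jump_time_ge0.
rewrite ltNge; apply/negP => zt.
have wn s : (t <= s)%R -> w s = None.
  move=> ts; apply: path_dead; first exact: le_trans ts.
  by apply: le_trans zt _; rewrite lee_fin.
have Yn : Y n = None by rewrite (jump_chain_at Tn) wn.
have Tn1 : T n.+1 = +oo.
  apply/eqP; rewrite -leye_eq jump_timeS.
  apply: le_ereal_inf_tmp => _ [s [+ +] <-]; rewrite Tn Yn lee_fin => ts.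
  by rewrite wn.
by have := jump_time_le_explosion n.+1; rewrite Tn1 => /(le_trans)/(_ zt).
Qed.

Lemma jump_chain_some n : exists k, Y n = Some k.
Proof.
have at_fin m t : T m = t%:E -> exists k, Y m = Some k.
  move=> Tm; rewrite (jump_chain_at Tm); apply: path_alive.
    by rewrite -lee_fin -Tm jump_time_ge0.
  exact: jump_time_lt_explosion Tm.
elim: n => [|n IH]; first exact: (at_fin 0%N 0%R).
case E : (T n.+1) => [t| |]; first exact: at_fin E.
- by rewrite jump_chainS E.
- by rewrite jump_chainS E.
Qed.

Lemma path_right_cst t : (0 <= t)%R -> t%:E < zeta ->
  exists2 d : R, (0 < d)%R & forall s : R, (t <= s < t + d)%R -> w s = w t.
Proof.
move=> t0 tz; have [_ /(_ t t0 tz) H _] := w_path.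
have [d /= d0 Hd] := H; exists d => // s /andP[].
rewrite le_eqVlt => /predU1P[<-//|ts] std.
apply: Hd => //=; rewrite ltr0_norm ?subr_lt0// opprB ltrBlDl//.
Qed.

Lemma jump_time_lt n t : T n = t%:E -> t%:E < T n.+1.
Proof.
move=> Tn; have t0 : (0 <= t)%R by rewrite -lee_fin -Tn jump_time_ge0.
have [d d0 Hd] := path_right_cst t0 (jump_time_lt_explosion Tn).
apply: (@lt_le_trans _ _ (t + d)%R%:E); first by rewrite lte_fin ltrDl.
rewrite jump_timeS; apply: le_ereal_inf_tmp => _ [s [+ +] <-].
rewrite Tn !lee_fin (jump_chain_at Tn) => ts ws.
by rewrite leNgt; apply/negP => std; apply: ws; apply: Hd; rewrite ts.
Qed.

Lemma path_between n s : T n <= s%:E -> s%:E < T n.+1 -> w s = Y n.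
Proof.
move=> Tns sTn; apply: contrapT => ws.
move: sTn; rewrite ltNge => /negP; apply.
by rewrite jump_timeS; apply: ereal_inf_lbound; exists s.
Qed.

Lemma path_epoch s : (0 <= s)%R -> s%:E < zeta ->
  exists2 n, T n <= s%:E & s%:E < T n.+1.
Proof.
move=> s0 sz.
have exn : exists n, s%:E < T n.
  apply: contrapT => /forallNP H.
  move: sz; rewrite ltNge => /negP; apply.
  by apply: ge_ereal_sup => _ [n _ <-]; rewrite leNgt; apply/negP/H.
case: (ex_minnP exn) => -[|n] sTn nmin.
  by move: sTn; rewrite lte_fin ltNge s0.
exists n => //; rewrite leNgt; apply/negP => /nmin.
by rewrite ltnn.
Qed.

(** By right continuity the next jump is detected at rational times; this makes
    jump times measurable. *)
Lemma jump_timeS_lt n (t : R) : T n.+1 < t%:E <->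
  exists s : rat, [/\ (ratr s < t)%R, T n < (ratr s)%:E & w (ratr s) <> Y n].
Proof.
split=> [|[s [st Tns ws]]]; last first.
  apply: (@le_lt_trans _ _ (ratr s)%:E); last by rewrite lte_fin.
  by rewrite jump_timeS; apply: ereal_inf_lbound; exists (ratr s) => //; split => //; exact: ltW.
case E : (T n.+1) => [u| |] //=; last first.
  by have := jump_time_ge0 n.+1; rewrite E.
rewrite lte_fin => ut.
have Tnu : T n < u%:E.
  case En : (T n) => [v| |] //; first by rewrite -E; exact: jump_time_lt.
  - by have := jump_time_leS n; rewrite E En.
  - by have := jump_time_ge0 n; rewrite En.
have u0 : (0 <= u)%R by rewrite -lee_fin -E jump_time_ge0.
have [d d0 Hd] := path_right_cst u0 (jump_time_lt_explosion E).
have wu : w u <> Y n.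
  move=> wu; have : (u + d)%R%:E <= T n.+1.
    rewrite jump_timeS; apply: le_ereal_inf_tmp => _ [s [Tns ws] <-].
    rewrite lee_fin leNgt; apply/negP => sud.
    have us : (u <= s)%R.
      rewrite -lee_fin -E jump_timeS; apply: ereal_inf_lbound; exists s => //.
    by apply: ws; rewrite Hd ?us.
  by rewrite E lee_fin leNgt ltrDl d0.
have um : (u < Num.min t (u + d))%R by rewrite lt_min ut ltrDl.
have [s] := rat_in_itvoo um.
rewrite in_itv/= lt_min => /andP[us /andP[st sud]].
exists s; split => //; first by apply: lt_trans Tnu _; rewrite lte_fin.
by rewrite Hd// (ltW us).
Qed.

(** The state entered at a jump, read off from rational times just after it. *)
Lemma path_after n t y : T n = t%:E ->
  Y n = y <-> exists2 v : rat, T n < (ratr v)%:E &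
     forall s : rat, T n < (ratr s)%:E -> (s < v)%R -> w (ratr s) = y.
Proof.
move=> Tn; have t0 : (0 <= t)%R by rewrite -lee_fin -Tn jump_time_ge0.
have [d d0 Hd] := path_right_cst t0 (jump_time_lt_explosion Tn).
rewrite (jump_chain_at Tn) Tn; split => [wy|[v]].
  have td : (t < t + d)%R by rewrite ltrDl.
  have [v] := rat_in_itvoo td.
  rewrite in_itv/= => /andP[tv vtd]; exists v; first by rewrite lte_fin.
  move=> s; rewrite lte_fin => ts sv; rewrite -wy; apply: Hd.
  by rewrite (ltW ts) (lt_trans _ vtd)// ltr_rat.
rewrite lte_fin => tv H.
have tm : (t < Num.min (t + d) (ratr v))%R by rewrite lt_min tv ltrDl d0.
have [s] := rat_in_itvoo tm.
rewrite in_itv/= lt_min => /andP[ts /andP[std sv]].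
rewrite -(H s) ?lte_fin//; last by rewrite -(ltr_rat R).
by rewrite Hd// (ltW ts).
Qed.

(** By [jump_chain_some] the jump chain never enters the cemetery, where the
    default value would appear. *)
Definition state (n : nat) : nat := odflt 0%N (Y n).

Lemma stateE n : Y n = Some (state n).
Proof. by rewrite /state; have [k ->] := jump_chain_some n. Qed.

Lemma holding_time_gt0 n : 0 < holding_time w n.
Proof.
rewrite /holding_time; case E : (T n) => [t| |] //.
by rewrite sube_gt0 jump_time_lt.
Qed.

Lemma jump_time_holding n : T n.+1 = T n + holding_time w n.
Proof.
rewrite /holding_time; case E : (T n) => [t| |].
- by rewrite addeC subeK.
- by have := jump_time_leS n; rewrite E leye_eq => /eqP ->.
- by have := jump_time_ge0 n; rewrite E.
Qed.

Definition first_below (a n : nat) : Prop :=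
  (forall m, (m < n)%N -> (a < state m)%N) /\ (state n <= a)%N.

Lemma first_below_fin a n : first_below a n -> T n < +oo.
Proof.
case: n => [|n] [Hn Ha]; first by rewrite ltry.
rewrite ltey; apply/eqP => Tn.
have := Hn _ (leqnn _); move: Ha; rewrite {1}/state jump_chainS Tn -/(state n).
by rewrite leqNgt => /negbTE ->.
Qed.

Lemma passage_first_below a n : first_below a n -> passage_time_below a w = T n.
Proof.
move=> fb; have := first_below_fin fb; case E : (T n) => [t| |] // _; last first.
  by have := jump_time_ge0 n; rewrite E.
have t0 : (0 <= t)%R by rewrite -lee_fin -E jump_time_ge0.
case: fb => Hn Ha; apply/eqP; rewrite eq_le; apply/andP; split.
  apply: ereal_inf_lbound; exists t => //; split => //.
    exact: jump_time_lt_explosion E.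
  by exists (state n) => //; rewrite -(jump_chain_at E) stateE.
apply: le_ereal_inf_tmp => _ [s [s0 sz [k ws ka]] <-].
have [m Tms sTm] := path_epoch s0 sz.
rewrite -E; apply: (le_trans _ Tms); apply: jump_time_homo.
rewrite leqNgt; apply/negP => /Hn.
have := path_between Tms sTm; rewrite ws stateE => -[<-].
by rewrite ltnNge ka.
Qed.

Lemma passage_never a : (forall n, (a < state n)%N) -> passage_time_below a w = +oo.
Proof.
move=> H; apply/eqP; rewrite -leye_eq.
apply: le_ereal_inf_tmp => _ [s [s0 sz [k ws ka]] <-].
have [m Tms sTm] := path_epoch s0 sz.
have := path_between Tms sTm; rewrite ws stateE => -[kE].
by have := H m; rewrite -kE ltnNge ka.
Qed.

Lemma passage_finP a : passage_time_below a w < +oo <-> exists n, first_below a n.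
Proof.
split=> [|[n fb]]; last by rewrite (passage_first_below fb) (first_below_fin fb).
move=> Tfin; have exn : exists n, (state n <= a)%N.
  apply: contrapT => /forallNP H; move: Tfin; rewrite passage_never//.
  by move=> n; rewrite ltnNge; apply/negP/H.
case: (ex_minnP exn) => n na nmin; exists n; split => // m mn.
by rewrite ltnNge; apply/negP => /nmin; rewrite leqNgt mn.
Qed.

(** Explosion precedes the passage exactly when the jump chain stays above [a]
    and the path explodes, because passages only occur before explosion. *)
Lemma escape_beforeP a : zeta < passage_time_below a w <->
  (forall n, (a < state n)%N) /\ zeta < +oo.
Proof.
split=> [zT|[H zfin]]; last by rewrite passage_never.
split; last by apply: lt_le_trans zT _; exact: leey.
move=> n; rewrite ltnNge; apply/negP => na.
have exn : exists n, (state n <= a)%N by exists n.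
case: (ex_minnP exn) => m ma mmin.
have fb : first_below a m.
  by split => // k km; rewrite ltnNge; apply/negP => /mmin; rewrite leqNgt km.
by move: zT; rewrite (passage_first_below fb) ltNge jump_time_le_explosion.
Qed.

End Paths.

(** * Measurability of the jump times and of the jump chain *)

Section Measurability.
Variables (R : realType) (d : measure_display) (Omega : measurableType d).
Variable X : R -> Omega -> option nat.
Hypothesis mX : forall t s, 0 <= t -> measurable [set omega | X t omega = s].
Hypothesis X_path : forall omega, minimal_cadlag_path (X ^~ omega).
Local Open Scope ereal_scope.
Local Notation T n omega := (jump_time (X ^~ omega) n).
Local Notation Y n omega := (jump_chain (X ^~ omega) n).
Local Notation S n omega := (state (X ^~ omega) n).

Lemma measurable_jump_step n :
  (forall t : R, measurable [set omega | T n omega < t%:E]) ->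
  (forall k, measurable [set omega | Y n omega = Some k]) ->
  forall t : R, measurable [set omega | T n.+1 omega < t%:E].
Proof.
move=> mT mY t.
have -> : [set omega | T n.+1 omega < t%:E] = \bigcup_(s : rat)
    ([set omega | (0 <= ratr s :> R)%R && (ratr s < t)%R] `&`
     ([set omega | T n omega < (ratr s)%:E] `&`
      \bigcup_k ([set omega | Y n omega = Some k] `&`
                 ~` [set omega | X (ratr s) omega = Some k]))).
  apply/seteqP; split=> omega /=.
    move/(jump_timeS_lt (X_path omega)) => [s [st Ts Xs]].
    exists s => //; split=> /=.
      rewrite st andbT -lee_fin; apply/ltW; apply: le_lt_trans Ts.
      exact: jump_time_ge0.
    split=> //; exists (S n omega) => //; split; first exact: stateE.
    by rewrite /= -stateE.
  move=> [s _ [/andP[s0 st] [Ts [k _ [Yk Xk]]]]].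
  apply/(jump_timeS_lt (X_path omega)); exists s; split => //.
  by rewrite Yk.
apply: bigcupT_measurable_rat => s.
have [st|st] := boolP ((0 <= ratr s :> R)%R && (ratr s < t)%R); last first.
  by rewrite (_ : [set _ | _] = set0) ?set0I//; apply/seteqP; split.
rewrite (_ : [set omega | _] = setT) ?setTI; last by apply/seteqP; split.
case/andP: st => s0 _.
apply: measurableI => //; apply: bigcupT_measurable => k.
by apply: measurableI => //; apply: measurableC; exact: mX.
Qed.

Lemma measurable_jump_fin n :
  (forall t : R, measurable [set omega | T n omega < t%:E]) ->
  measurable [set omega | T n omega < +oo].
Proof.
move=> mT.
rewrite (_ : [set _ | _] = \bigcup_k [set omega | T n omega < k%:R%:E]).
  exact: bigcupT_measurable.
apply/seteqP; split=> omega /=; last by move=> [k _] /= /lt_trans; apply; exact: ltry.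
case E : (T n omega) => [t| |] //.
  move=> _; exists (Num.bound `|t|) => //=.
  by rewrite E lte_fin (le_lt_trans (ler_norm t))// archi_boundP.
by move=> _; exists 0%N => //=; rewrite E ltNyr.
Qed.

Lemma measurable_chain_step n :
  (forall t : R, measurable [set omega | T n.+1 omega < t%:E]) ->
  (forall k, measurable [set omega | Y n omega = Some k]) ->
  forall k, measurable [set omega | Y n.+1 omega = Some k].
Proof.
move=> mT mY k.
have mfin := measurable_jump_fin mT.
have -> : [set omega | Y n.+1 omega = Some k] =
   (~` [set omega | T n.+1 omega < +oo] `&` [set omega | Y n omega = Some k]) `|`
   ([set omega | T n.+1 omega < +oo] `&`
    \bigcup_(v : rat) ([set omega | T n.+1 omega < (ratr v)%:E] `&`
      \bigcap_(s in [set s : rat | (s < v)%R])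
        (~` [set omega | T n.+1 omega < (ratr s)%:E] `|`
         [set omega | (0 <= ratr s :> R)%R /\ X (ratr s) omega = Some k]))).
  apply/seteqP; split=> omega /=.
    case E : (T n.+1 omega) => [t| |] Yk; last first.
    - by have := jump_time_ge0 (X ^~ omega) n.+1; rewrite E.
    - by left; split => //; move: Yk; rewrite jump_chainS E.
    right; split; first by rewrite ltry.
    have [v Tv Hv] := iffLR (path_after (X_path omega) (Some k) E) Yk.
    exists v => //; split => //= s sv.
    have [Ts|/negP Ts] := boolP (T n.+1 omega < (ratr s)%:E); last by left.
    right; split; last exact: Hv.
    by rewrite -lee_fin; apply: ltW; apply: le_lt_trans Ts; exact: jump_time_ge0.
  move=> [[/negP + Yk]|[Tfin [v _ [Tv Hv]]]].
    by rewrite -leNgt leye_eq => /eqP E; rewrite jump_chainS E.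
  case E : (T n.+1 omega) Tfin => [t| |] // _; last first.
    by have := jump_time_ge0 (X ^~ omega) n.+1; rewrite E.
  apply/(path_after (X_path omega) (Some k) E); exists v => // s Ts sv.
  by have [//|[]] := Hv s sv.
apply: measurableU; first by apply: measurableI => //; exact: measurableC.
apply: measurableI => //; apply: bigcupT_measurable_rat => v.
apply: measurableI => //.
rewrite -[X in measurable X]setCK setC_bigcap bigcup_mkcond; apply: measurableC.
apply: bigcupT_measurable_rat => s; case: ifPn => // sv.
apply: measurableC; apply: measurableU; first exact: measurableC.
have [s0|s0] := boolP (0 <= ratr s :> R)%R.
  rewrite (_ : [set _ | _] = [set omega | X (ratr s) omega = Some k]); first exact: mX.
  by apply/seteqP; split => omega //= [].
by rewrite (_ : [set _ | _] = set0)//; apply/seteqP; split => omega //= [].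
Qed.

Lemma measurable_jump n :
  (forall t : R, measurable [set omega | T n omega < t%:E]) /\
  (forall k, measurable [set omega | Y n omega = Some k]).
Proof.
elim: n => [|n [mT mY]]; last first.
  have mT' := measurable_jump_step mT mY.
  by split => //; exact: measurable_chain_step.
split=> [t|k]; last exact: (mX _ (lexx 0%R)).
have [t0|t0] := ltP 0%R t.
  have -> : [set omega | T 0 omega < t%:E] = setT.
    by apply/seteqP; split => omega //= _; rewrite lte_fin.
  exact: measurableT.
have -> : [set omega | T 0 omega < t%:E] = set0; last exact: measurable0.
by apply/seteqP; split => omega //=; rewrite lte_fin ltNge t0.
Qed.

Lemma measurable_jump_time n : measurable_fun setT (fun omega => T n omega).
Proof.
apply: (measurability _ (ErealGenInftyO.measurableE R)).
move=> _ [_ [t ->] <-]; rewrite setTI.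
rewrite (_ : _ @^-1` _ = [set omega | T n omega < t%:E]); last first.
  by apply/seteqP; split => omega /=; rewrite in_itv.
exact: (measurable_jump n).1.
Qed.

Lemma measurable_state n : measurable_fun setT (fun omega => S n omega).
Proof.
move=> _ A _; rewrite setTI.
rewrite (_ : _ @^-1` _ = \bigcup_(k in A) [set omega | Y n omega = Some k]).
  by apply: bigcup_measurable => k _; exact: (measurable_jump n).2.
apply/seteqP; split=> omega /=; first by exists (S n omega) => //=; rewrite stateE.
by move=> [k Ak] /=; rewrite stateE => // -[->].
Qed.

Lemma measurable_state_set n (A : set nat) : measurable [set omega | A (S n omega)].
Proof. by have := @measurable_state n measurableT A I; rewrite setTI. Qed.

Lemma measurable_holding n : measurable_fun setT (fun omega => holding_time (X ^~ omega) n).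
Proof.
rewrite (_ : (fun _ => _) = (fun omega => if T n omega < +oo
    then T n.+1 omega - T n omega else +oo)); last first.
  apply/funext => omega; rewrite /holding_time.
  case E : (T n omega) => [t| |] //=; first by rewrite ltry.
  by have := jump_time_ge0 (X ^~ omega) n; rewrite E.
apply: measurable_fun_ifT.
- by apply: measurable_fun_lte; [exact: measurable_jump_time|exact: measurable_cst].
- by apply: emeasurable_funB; exact: measurable_jump_time.
- exact: measurable_cst.
Qed.

End Measurability.

(** * Laplace transforms of the jump times *)

Section Discount.
Variable R : realType.
Local Open Scope ereal_scope.

(** exp (- q t), with the convention 0 * oo = 0: a chain killed at rate 0 is
    not killed during an infinite holding time. *)
Definition discount (q : R) (t : \bar R) : R :=
  if q == 0%R then 1%R else if t is s%:E then expR (- q * s) else 0%R.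

Lemma discount_ge0 q t : (0 <= discount q t)%R.
Proof. by rewrite /discount; case: ifP => // _; case: t => // s; exact: expR_ge0. Qed.

Lemma discount_le1 (q : R) t : (0 <= q)%R -> 0 <= t -> (discount q t <= 1)%R.
Proof.
move=> q0; rewrite /discount; case: ifP => // _; case: t => //= s.
by rewrite lee_fin => s0; rewrite -expR0 ler_expR mulNr oppr_le0 mulr_ge0.
Qed.

Lemma discountD q s t : 0 <= s -> 0 <= t ->
  discount q (s + t) = (discount q s * discount q t)%R.
Proof.
rewrite /discount; case: ifP => [_ _ _|_]; first by rewrite mulr1.
case: s => [s| |] //; case: t => [t| |] //= _ _; rewrite ?mulr0 ?mul0r//.
by rewrite -expRD mulrDr.
Qed.

Lemma discount0 q : discount q 0 = 1%R.
Proof. by rewrite /discount; case: ifP => // _; rewrite mulr0 expR0. Qed.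

Lemma discount_fin q t : t < +oo -> 0 <= t -> discount q t = expR (- q * fine t).
Proof.
rewrite /discount; case: t => [t| |] //= _ _.
by case: ifPn => // /eqP ->; rewrite oppr0 mul0r expR0.
Qed.

Lemma measurable_discount (q : R) : measurable_fun setT (discount q).
Proof.
have [->|q0] := eqVneq q 0%R.
  by rewrite (_ : discount 0 = cst 1%R)//; apply/funext => t; rewrite /discount eqxx.
rewrite (_ : discount q = (fun t : \bar R =>
    if t \is a fin_num then expR (- q * fine t) else 0%R)); last first.
  by apply/funext => -[t| |]; rewrite /discount (negbTE q0).
apply: measurable_fun_ifT.
- apply: (measurable_fun_bool true); rewrite setTI.
  have := @emeasurable_fin_num _ _ R setT (@id (\bar R)) measurableT (@measurable_id _ _ _).
  by rewrite setTI.
- by apply: measurableT_comp => //; apply: measurable_funM.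
- exact: measurable_cst.
Qed.

(** 1 - exp (- q h) is the probability that an independent exponential clock of
    rate [q] rings before [h]. *)
Lemma discount_layer (q : R) (h : \bar R) : (0 < q)%R -> 0 < h ->
  \int[lebesgue_measure]_t (exponential_pdf q t * ((t%:E < h)%E)%:R)%:E
  = (1 - discount q h)%:E.
Proof.
move=> q0; case: h => [h| |] // h0.
- rewrite /discount gt_eqF//.
  have -> : (fun t => (exponential_pdf q t * ((t%:E < h%:E)%E)%:R)%:E) =
     (fun t => (q * expR (- q * t))%:E) \_ `[0%R, h[ :> (R -> \bar R).
    apply/funext => t; rewrite /exponential_pdf /= !patchE lte_fin.
    have [t0|t0] := leP 0%R t; last first.
      by rewrite !memNset ?mul0r//= in_itv/= leNgt t0.
    rewrite mem_set/=; last by rewrite in_itv/= t0.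
    have [th|th] := ltP t h.
      by rewrite mulr1 mem_set//= in_itv/= t0.
    by rewrite mulr0 memNset//= in_itv/= t0/= ltNge th.
  rewrite -integral_mkcond.
  have cf : {in `](-1)%R, (h + 1)%R[, continuous (fun t => q * expR (- q * t))%R}.
    move=> t _; apply: cvgM; first exact: cvg_cst.
    apply: continuous_comp; last exact: continuous_expR.
    by apply: cvgM; [exact: cvg_cst|exact: cvg_id].
  have dF : antiderivative (fun t => - expR (- q * t))%R (fun t => q * expR (- q * t))%R
      (-1) (h + 1).
    move=> t _.
    have d1 : is_derive t (1 : R)%R (fun s : R => - q * s)%R (- q)%R.
      by have := is_deriveZ (- q)%R (is_derive_id t (1 : R)%R); rewrite /GRing.scale/= mulr1.
    have := is_deriveN (@is_derive1_comp R (@expR R) (fun s => - q * s)%R t _ _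
        (is_derive_expR _) d1).
    by rewrite mulrN opprK mulrC.
  have h1 : (-1 < 0 :> R)%R by rewrite ltrN10.
  have h2 : (h < h + 1)%R by rewrite ltrDl.
  have h00 : (0 <= h)%R by move: h0; rewrite lte_fin => /ltW.
  have := antiderivative_integral h1 h00 h2 cf dF.
  rewrite mulr0 expR0 opprK addrC => <-.
  rewrite -(integral_itv_bndo_bndc)//.
  apply/measurable_EFinP; apply: measurable_funS (continuous_oo_measurable cf) => //.
  move=> t /=; rewrite !in_itv/= => /andP[t0 th].
  by rewrite (lt_le_trans h1)//= (lt_trans th).
- rewrite /discount gt_eqF// subr0 -(integral_exponential_pdf q0).
  by apply: eq_integral => t _; rewrite ltry mulr1.
Qed.

End Discount.

Section OneHoldingTime.
Variables (R : realType) (d : measure_display) (Omega : measurableType d).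
Variable P : probability Omega R.
Local Open Scope ereal_scope.

(** The law of [H] weighted by [g] on [A] is known through its tails only; by
    [discount_layer] and Fubini the Laplace transform is an integral of these
    tails against the law of an exponential clock of rate [q]. *)
Lemma laplace_exponential (A : set Omega) (g : Omega -> R) (H : Omega -> \bar R)
    (q c D : R) :
  measurable A -> measurable_fun setT g -> (forall omega, 0 <= g omega)%R ->
  measurable_fun setT H -> (forall omega, 0 < H omega) ->
  (0 <= q)%R -> (0 <= c)%R -> (0 < q \/ 0 < c)%R -> (0 <= D)%R ->
  (forall t, (0 <= t)%R ->
    \int[P]_(omega in A `&` [set omega | t%:E < H omega]) (g omega)%:E
    = (D * expR (- c * t))%:E) ->
  \int[P]_(omega in A) (g omega * discount q (H omega))%:E = (D * (c / (c + q)))%:E.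
Proof.
move=> mA mg g0 mH H0 q0 c0 qc D0 HD.
have intg : \int[P]_(omega in A) (g omega)%:E = D%:E.
  rewrite -[X in _ = X%:E]mulr1 -expR0 -(mulr0 (- c)%R) -HD//.
  congr (integral _ _ _); apply/seteqP; split => omega /=; last by case.
  by move=> Aw; split.
have [q_eq0|q_neq0] := eqVneq q 0%R.
  rewrite q_eq0 addr0 divff ?mulr1; last first.
    by case: qc => [|/gt_eqF ->//]; rewrite q_eq0 ltxx.
  by rewrite -intg; apply: eq_integral => omega _; rewrite /discount eqxx mulr1.
have qp : (0 < q)%R by rewrite lt_neqAle eq_sym q_neq0.
have mW : measurable_fun setT (fun omega => discount q (H omega)).
  by apply: measurableT_comp => //; exact: measurable_discount.
have W1 omega : (discount q (H omega) <= 1)%R by apply: discount_le1 => //; exact: ltW.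
have mgW : measurable_fun A (fun omega => (g omega * discount q (H omega))%:E).
  by apply/measurable_EFinP; apply: measurable_funS (measurable_funM mg mW).
have mgW' : measurable_fun A (fun omega => (g omega * (1 - discount q (H omega)))%:E).
  apply/measurable_EFinP.
  have m1 : measurable_fun setT (fun omega => g omega * (1 - discount q (H omega)))%R.
    by apply: measurable_funM => //; apply: measurable_funB.
  exact: measurable_funS m1.
have split_int : \int[P]_(omega in A) (g omega * discount q (H omega))%:E +
    \int[P]_(omega in A) (g omega * (1 - discount q (H omega)))%:E = D%:E.
  rewrite -ge0_integralD//; first last.
  - by move=> omega _; rewrite lee_fin mulr_ge0// subr_ge0.
  - by move=> omega _; rewrite lee_fin mulr_ge0// discount_ge0.
  rewrite -intg; apply: eq_integral => omega _.
  by rewrite -EFinD; congr (_%:E); ring.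
pose G (z : Omega * R) : \bar R :=
  (g z.1 * (\1_A z.1 * (exponential_pdf q z.2 * ((z.2%:E < H z.1)%E)%:R)))%:E.
have pdf0 t : (0 <= exponential_pdf q t)%R by apply: exponential_pdf_ge0; exact: ltW.
have G0 z : 0 <= G z.
  by rewrite lee_fin !mulr_ge0.
have mpdf : measurable_fun setT (exponential_pdf q) by exact: measurable_exponential_pdf.
have mind : measurable_fun setT (fun z : Omega * R => ((z.2%:E < H z.1)%E)%:R : R).
  have mlt : measurable_fun setT (fun z : Omega * R => (z.2%:E < H z.1)%E).
    apply: measurable_fun_lte; last by apply: measurableT_comp => //; exact: measurable_fst.
    by apply/measurable_EFinP; exact: measurable_snd.
  rewrite (_ : (fun _ => _) = (fun z : Omega * R => if (z.2%:E < H z.1)%E then 1%R else 0%R)).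
    by apply: measurable_fun_ifT => //; exact: measurable_cst.
  by apply/funext => z; case: ifP.
have mG : measurable_fun setT G.
  apply/measurable_EFinP; apply: measurable_funM.
    by apply: measurableT_comp => //; exact: measurable_fst.
  apply: measurable_funM.
    apply: (@measurableT_comp _ _ _ _ _ _ (\1_A : Omega -> R)); last exact: measurable_fst.
    exact: measurable_indic.
  apply: measurable_funM => //.
  by apply: measurableT_comp => //; exact: measurable_snd.
have cq : (0 < c + q)%R by rewrite ltr_wpDl.
suff E : \int[P]_(omega in A) (g omega * (1 - discount q (H omega)))%:E = (D * (q / (c + q)))%:E.
  have -> : (D * (c / (c + q)) = D - D * (q / (c + q)))%R by field; rewrite gt_eqF.
  by rewrite EFinB -split_int E addeK.
transitivity (\int[P]_omega \int[lebesgue_measure]_t G (omega, t)).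
  rewrite integral_mkcond; apply: eq_integral => omega _.
  rewrite patchE /G /=.
  under [RHS]eq_integral do rewrite EFinM.
  have mk : measurable_fun setT (fun t => (exponential_pdf q t * ((t%:E < H omega)%E)%:R)%R).
    apply: measurable_funM => //.
    have := @measurableT_comp _ _ _ _ _ _ _ _ _ mind (@pair1_measurable _ _ _ _ omega); exact.
  rewrite ge0_integralZl//; last 3 first.
  - by apply/measurable_EFinP; apply: measurable_funM => //; exact: measurable_cst.
  - by move=> t _; rewrite lee_fin !mulr_ge0.
  - by rewrite lee_fin.
  case: ifPn => [wA|wA]; rewrite indicE ?wA ?(negbTE wA).
    by under [X in _ = _ * X]eq_integral do rewrite mul1r; rewrite discount_layer// EFinM.
  by under [X in _ = _ * X]eq_integral do rewrite mul0r; rewrite integral0 mule0.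
rewrite (@fubini_tonelli _ _ _ _ _ P lebesgue_measure G mG G0).
transitivity (\int[lebesgue_measure]_t ((D * (q / (c + q)))%:E * (exponential_pdf (c + q) t)%:E)).
  apply: eq_integral => t _.
  have mAH : measurable (A `&` [set omega | t%:E < H omega]).
    apply: measurableI => //; rewrite -[X in measurable X]setTI.
    by apply: emeasurable_fun_o_infty.
  transitivity ((exponential_pdf q t)%:E *
      \int[P]_(omega in A `&` [set omega | t%:E < H omega]) (g omega)%:E).
    rewrite [X in _ = _ * X]integral_mkcond -ge0_integralZl//; last 2 first.
    - by move=> omega _; rewrite patchE; case: ifP => // _; rewrite lee_fin.
    - by rewrite lee_fin.
      apply: eq_integral => omega _; rewrite /G /= patchE in_setI indicE.
      have [wA|wA] := boolP (omega \in A); last by rewrite !(mul0r, mulr0) mule0.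
      rewrite mul1r /=; case: (ltP t%:E (H omega)) => tH.
        by rewrite mem_set// mulr1 mulrC EFinM.
      rewrite memNset; last by move=> /=; rewrite ltNge tH.
      by rewrite !mulr0 mule0.
    apply: (iffLR (measurable_restrictT (fun omega => (g omega)%:E) mAH)).
    by apply/measurable_EFinP; apply: measurable_funS mg.
  have [t0|t0] := leP 0%R t; last by rewrite !lt0_exponential_pdf// mul0e mule0.
  rewrite HD// /exponential_pdf !patchE mem_set/=; last by rewrite in_itv/= t0.
  rewrite -!EFinM; congr (_%:E).
  have -> : (- (c + q) * t = - c * t + - q * t)%R by ring.
  by rewrite expRD; field; rewrite gt_eqF.
rewrite ge0_integralZl_EFin//; last 3 first.
- by move=> t _; rewrite lee_fin exponential_pdf_ge0// ltW.
- by apply/measurable_EFinP; exact: measurable_exponential_pdf.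
- by rewrite mulr_ge0// divr_ge0// ltW.
by rewrite integral_exponential_pdf// mule1.
Qed.

End OneHoldingTime.

Section MarkovLaw.
Variables (R : realType) (d : measure_display) (Omega : measurableType d).
Variables (Q : nat -> nat -> R) (P : nat -> probability Omega R).
Variable X : R -> Omega -> option nat.
Hypothesis X_chain : minimal_markov_chain Q P X.
Hypothesis Q_diag : forall i, Q i i <= 0.
Hypothesis jump_matrix_ge0 : forall i j, 0 <= jump_matrix Q i j.
Local Open Scope ereal_scope.
Local Notation T n omega := (jump_time (X ^~ omega) n).
Local Notation S n omega := (state (X ^~ omega) n).
Local Notation H n omega := (holding_time (X ^~ omega) n).
Local Notation c i := (- Q i i)%R.

Let mX t s : (0 <= t)%R -> measurable [set omega | X t omega = s].
Proof. by case: X_chain => h _ _; exact: h. Qed.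

Let X_path omega : minimal_cadlag_path (X ^~ omega).
Proof. by case: X_chain. Qed.

Let c_ge0 i : (0 <= c i)%R. Proof. by rewrite oppr_ge0. Qed.

(** The jump matrix weighted by the Laplace transform c / (c + q) of the
    exponential holding time. *)
Definition kernel (q : R) (i j : nat) : R := (jump_matrix Q i j * (c i / (c i + q)))%R.

Lemma kernel_ge0 q i j : (0 <= q)%R -> (0 <= kernel q i j)%R.
Proof. by move=> q0; rewrite mulr_ge0// divr_ge0// addr_ge0. Qed.

Variable q : R.
Hypothesis q_ge0 : (0 <= q)%R.

(** The first [m] holding times are left free: they have been integrated out. *)
Definition path_event (n m : nat) (i : nat -> nat) (t : nat -> R) : set Omega :=
  [set omega | (forall k, (k <= n)%N -> S k omega = i k) /\
    (forall k, (m <= k < n)%N -> (t k)%:E < H k omega)].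

Lemma measurable_path_event n m i t : measurable (path_event n m i t).
Proof.
rewrite (_ : path_event n m i t =
  \bigcap_(k in [set k | (k <= n)%N]) [set omega | S k omega = i k] `&`
  \bigcap_(k in [set k | (m <= k < n)%N]) [set omega | (t k)%:E < H k omega]); last first.
  by apply/seteqP; split => omega /= [h1 h2]; split.
apply: measurableI; apply: bigcap_measurableType => k _.
  exact: (measurable_state_set mX X_path k [set i k]).
rewrite -[X in measurable X]setTI; apply: emeasurable_fun_o_infty => //.
exact: measurable_holding mX X_path k.
Qed.

Let measurable_prod_discount m :
  measurable_fun setT (fun omega => \prod_(k < m) discount q (H k omega))%R.
Proof.
elim: m => [|m IH].
  by under eq_fun do rewrite big_ord0; exact: measurable_cst.
under eq_fun do rewrite big_ord_recr/=.
apply: measurable_funM => //.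
apply: measurableT_comp; first exact: measurable_discount.
exact: measurable_holding mX X_path m.
Qed.

Let prod_discount_ge0 m omega : (0 <= \prod_(k < m) discount q (H k omega))%R.
Proof. by apply: prodr_ge0 => k _; exact: discount_ge0. Qed.

(** Exponential holding times are converted one at a time into Laplace
    factors, leaving the later ones as survival events. *)
Lemma path_event_laplace x n m (i : nat -> nat) (t : nat -> R) :
  (m <= n)%N -> (forall k, 0 <= t k)%R ->
  (forall k, (k < n)%N -> (0 < q \/ 0 < c (i k))%R) ->
  \int[P x]_(omega in path_event n m i t) (\prod_(k < m) discount q (H k omega))%:E
  = ((i 0%N == x)%:R * \prod_(k < n) (jump_matrix Q (i k) (i k.+1) *
       (if (k < m)%N then c (i k) / (c (i k) + q) else expR (Q (i k) (i k) * t k))))%:E.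
Proof.
move=> mn + qc; elim: m mn t => [|m IH] mn t t0.
  under eq_integral do rewrite big_ord0.
  rewrite integral_cst; last exact: measurable_path_event.
  rewrite mul1e; case: X_chain => _ _ <-//; congr (P x _).
  apply/seteqP; split => omega /= [h1 h2]; split=> // k kn.
  - by rewrite stateE// h1.
  - by have := h1 k kn; rewrite stateE// => -[].
under eq_integral do rewrite big_ord_recr/=.
pose F k : R := if (k < m)%N then (c (i k) / (c (i k) + q))%R else expR (Q (i k) (i k) * t k)%R.
pose D : R := ((i 0%N == x)%:R * (\prod_(k < n) jump_matrix Q (i k) (i k.+1) *
  \prod_(k < n | k != Ordinal mn) F k))%R.
have prodE (G : nat -> R) : (forall k, k != m -> G k = F k) ->
    ((i 0%N == x)%:R * \prod_(k < n) (jump_matrix Q (i k) (i k.+1) * G k) = D * G m)%R.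
  move=> GF; rewrite big_split/= [X in (_ * (_ * X))%R](bigD1 (Ordinal mn))//=.
  rewrite [X in (_ * (_ * (_ * X)))%R](eq_bigr (fun k : 'I_n => F k)).
    by rewrite /D; ring.
  by move=> k km; rewrite GF.
have D0 : (0 <= D)%R.
  rewrite !mulr_ge0 ?prodr_ge0// => k _.
  by rewrite /F; case: ifP => _; rewrite ?expR_ge0// divr_ge0// addr_ge0.
rewrite (@laplace_exponential _ _ _ (P x) _ (fun omega => \prod_(k < m) discount q (H k omega))%R
  (fun omega => H m omega) q (c (i m)) D) //.
- have E := prodE (fun k => if (k < m.+1)%N then (c (i k) / (c (i k) + q))%R
      else expR (Q (i k) (i k) * t k))%R.
  rewrite /= ltnSn in E; rewrite E// => k km.
  by rewrite /F ltnS leq_eqVlt (negbTE km).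
- exact: measurable_path_event.
- exact: measurable_holding mX X_path m.
- by move=> omega; exact: holding_time_gt0.
- exact: qc.
move=> s s0; pose t' k := if k == m then s else t k.
have t'0 k : (0 <= t' k)%R by rewrite /t'; case: ifP.
have := IH (ltnW mn) t' t'0.
have -> : path_event n m i t' = path_event n m.+1 i t `&` [set omega | s%:E < H m omega].
  apply/seteqP; split => omega /=.
    move=> [h1 h2]; split; last by have := h2 m; rewrite /t' eqxx leqnn mn => /(_ isT).
    split=> // k /andP[mk kn]; have := h2 k; rewrite /t' gtn_eqF// kn (ltnW mk).
    by move=> /(_ isT).
  move=> [[h1 h2] h3]; split => // k /andP[mk kn]; rewrite /t'.
  have [->//|km] := eqVneq k m.
  by apply: h2; rewrite kn andbT ltn_neqAle eq_sym km.
move=> ->; congr (_%:E).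
have E := prodE (fun k => if (k < m)%N then (c (i k) / (c (i k) + q))%R
      else expR (Q (i k) (i k) * t' k))%R.
have tm : t' m = s by rewrite /t' eqxx.
rewrite /= ltnn tm in E; rewrite E ?opprK// => k km.
by rewrite /F /t' (negbTE km).
Qed.

Lemma prod_discount n omega :
  (\prod_(k < n) discount q (H k omega) = discount q (T n omega))%R.
Proof.
elim: n => [|n IH]; first by rewrite big_ord0 discount0.
rewrite big_ord_recr/= IH jump_time_holding// discountD ?jump_time_ge0//.
by apply: ltW; exact: holding_time_gt0.
Qed.

Variable b : pred nat.
Hypothesis b_rate : forall i, b i -> (0 < q \/ 0 < c i)%R.

Definition kernel_step (f : nat -> \bar R) (i : nat) : \bar R :=
  if b i then \sum_(j <oo) (kernel q i j)%:E * f j else 0.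

Lemma kernel_step_ge0 f i : (forall j, 0 <= f j) -> 0 <= kernel_step f i.
Proof.
move=> f0; rewrite /kernel_step; case: ifP => // _.
by apply: nneseries_ge0 => j _ _; rewrite mule_ge0// lee_fin kernel_ge0.
Qed.

Lemma kernel_iter_ge0 f n i : (forall j, 0 <= f j) -> 0 <= iter n kernel_step f i.
Proof. by move=> f0; elim: n i => //= n IH i; apply: kernel_step_ge0. Qed.

Variable f : nat -> R.
Hypothesis f_ge0 : forall j, (0 <= f j)%R.

Definition prefix_event (n m : nat) (i : nat -> nat) : set Omega :=
  [set omega | (forall k, (k <= m)%N -> S k omega = i k) /\
    (forall k, (m <= k < n)%N -> b (S k omega))].

Definition stay_event (n : nat) : set Omega :=
  [set omega | forall k, (k < n)%N -> b (S k omega)].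

Lemma measurable_prefix_event n m i : measurable (prefix_event n m i).
Proof.
rewrite (_ : prefix_event n m i =
  \bigcap_(k in [set k | (k <= m)%N]) [set omega | S k omega = i k] `&`
  \bigcap_(k in [set k | (m <= k < n)%N]) [set omega | b (S k omega)]); last first.
  by apply/seteqP; split => omega /= [h1 h2]; split.
apply: measurableI; apply: bigcap_measurableType => k _.
  exact: (measurable_state_set mX X_path k [set i k]).
exact: (measurable_state_set mX X_path k [set j | b j]).
Qed.

Let g n omega := (discount q (T n omega) * f (S n omega))%:E.

Let g_ge0 n omega : 0 <= g n omega.
Proof. by rewrite lee_fin mulr_ge0// discount_ge0. Qed.

Lemma measurable_discount_state n : measurable_fun setT (g n).
Proof.
apply/measurable_EFinP; apply: measurable_funM.
  apply: measurableT_comp; first exact: measurable_discount.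
  exact: measurable_jump_time mX X_path n.
apply: (@measurableT_comp _ _ _ _ _ _ f); last exact: measurable_state mX X_path n.
by [].
Qed.

(** Backward induction: the path is prescribed up to step [m], and lowering [m]
    sums over the state at step [m.+1]. *)
Lemma prefix_laplace x e m (i : nat -> nat) :
  (forall k, (k < m)%N -> (0 < q \/ 0 < c (i k))%R) ->
  \int[P x]_(omega in prefix_event (m + e) m i) g (m + e) omega =
  ((i 0%N == x)%:R * \prod_(k < m) kernel q (i k) (i k.+1))%:E *
    iter e kernel_step (EFin \o f) (i m).
Proof.
elim: e m i => [|e IH] m i qc.
  rewrite addn0 /=.
  have -> : prefix_event m m i = path_event m m i (fun=> 0%R).
    apply/seteqP; split=> omega /= [h1 h2]; split=> // k /andP[mk km];
    by move: km; rewrite ltnNge mk.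
  transitivity (\int[P x]_(omega in path_event m m i (fun=> 0%R))
      ((\prod_(k < m) discount q (H k omega))%:E * (f (i m))%:E)).
    apply: eq_integral => omega /set_mem [h1 _].
    by rewrite /g prod_discount EFinM h1.
  rewrite ge0_integralZr//; first last.
  - by rewrite lee_fin.
  - by move=> omega _; rewrite lee_fin.
  - by apply/measurable_EFinP; apply: measurable_funS (measurable_prod_discount m).
  - exact: measurable_path_event.
  rewrite path_event_laplace//; congr ((_ * _)%:E * _).
  by apply: eq_bigr => k _; rewrite ltn_ord.
rewrite addnS -addSn /=.
pose up j k := if (k == m.+1)%N then j else i k.
have [bm|bm] := boolP (b (i m)); last first.
  rewrite {1}/kernel_step (negbTE bm) mule0.
  rewrite (_ : prefix_event _ _ _ = set0) ?integral_set0//.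
  apply/seteqP; split => // omega [h1 h2].
  have := h2 m; rewrite leqnn leq_addr => /(_ isT).
  by rewrite h1// (negbTE bm).
have -> : prefix_event (m.+1 + e) m i = \bigcup_j prefix_event (m.+1 + e) m.+1 (up j).
  apply/seteqP; split => omega /=.
    move=> [h1 h2]; exists (S m.+1 omega) => //; split.
      move=> k km; rewrite /up; have [->//|km'] := eqVneq k m.+1.
      by apply: h1; rewrite -ltnS ltn_neqAle km'.
    by move=> k /andP[mk kn]; apply: h2; rewrite kn (ltnW mk).
  move=> [j _ [h1 h2]].
  have h1' k : (k <= m)%N -> S k omega = i k.
    by move=> km; rewrite h1 ?(leqW km)// /up ltn_eqF// ltnS.
  split => // k /andP[mk kn]; move: mk; rewrite leq_eqVlt => /predU1P[<-|mk].
    by rewrite h1'.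
  by apply: h2; rewrite mk.
rewrite ge0_integral_bigcup//; first last.
- move=> j1 j2 _ _ [omega [[h1 _] [h2 _]]].
  have := h1 m.+1 (leqnn _); rewrite h2// /up eqxx.
  by move=> ->.
- by apply: measurable_funS (measurable_discount_state _) => //.
- by move=> j; exact: measurable_prefix_event.
rewrite /kernel_step bm -/kernel_step.
rewrite -nneseriesZl; last first.
  by move=> j _; rewrite mule_ge0 ?kernel_iter_ge0// ?lee_fin ?kernel_ge0.
apply: eq_eseriesr => j _; rewrite IH; last first.
  move=> k km; rewrite /up ltn_eqF//; move: km; rewrite ltnS leq_eqVlt.
  by move=> /predU1P[->|/qc//]; exact: b_rate.
have upm : up j m.+1 = j by rewrite /up eqxx.
have upk k : (k <= m)%N -> up j k = i k by move=> km; rewrite /up ltn_eqF.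
rewrite muleA -EFinM upm; congr (_%:E * _).
rewrite big_ord_recr/= mulrA upm !upk//; congr (_ * _ * _)%R.
by apply: eq_bigr => k _; rewrite !upk// ltnW.
Qed.

Lemma stay_laplace x n :
  \int[P x]_(omega in stay_event n) (discount q (T n omega) * f (S n omega))%:E =
  iter n kernel_step (EFin \o f) x.
Proof.
rewrite -[LHS]/(\int[P x]_(omega in stay_event n) g n omega).
have -> : stay_event n = \bigcup_j prefix_event n 0 (fun=> j).
  apply/seteqP; split => omega /=.
    by move=> h; exists (S 0%N omega) => //; split => // k; rewrite leqn0 => /eqP ->.
  by move=> [j _ [_ h]] k kn; exact: h.
rewrite ge0_integral_bigcup//; first last.
- by move=> j1 j2 _ _ [omega [[h1 _] [h2 _]]]; rewrite -(h1 0%N)// -(h2 0%N).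
- by apply: measurable_funS (measurable_discount_state n) => //.
- by move=> j; exact: measurable_prefix_event.
rewrite (@nneseriesD1 _ _ x)//; last first.
  by move=> j _; apply: integral_ge0 => omega _; exact: g_ge0.
rewrite eseries0 ?adde0; last first.
  move=> j _ jx; have := @prefix_laplace x n 0 (fun=> j); rewrite add0n => ->//.
  by rewrite (negbTE jx) mul0r mul0e.
have := @prefix_laplace x n 0 (fun=> x); rewrite add0n => ->//.
by rewrite eqxx big_ord0 mulr1 mul1e.
Qed.

End MarkovLaw.

(** * The generator of the branching process with immigration *)

Section Generator.
Variables (R : realType) (lam mu : R) (p : nat -> R) (r : int -> R).
Hypotheses (lam_gt0 : 0 < lam) (mu_ge0 : 0 <= mu).
Hypotheses (p_distr : is_distribution p) (p0_gt0 : 0 < p 0%N) (p1_eq0 : p 1%N = 0).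
Hypothesis r_distr : is_immigration_distribution r.
Local Notation rs := (shifted_immigration r).
Local Notation Q := (generator lam mu p r).

Lemma generator_diag0 : Q 0%N 0%N = 0. Proof. by []. Qed.

Lemma generator_diag i : (0 < i)%N -> Q i i = - exit_rate lam mu i.
Proof. by case: i => // i _; rewrite /generator eqxx. Qed.

Lemma generator_diag_le0 i : Q i i <= 0.
Proof.
case: i => // i; rewrite generator_diag// oppr_le0 ltW//.
exact: exit_rate_gt0.
Qed.

Lemma generator_up i k : (0 < i)%N -> (k != 1)%N ->
  Q i (i.-1 + k)%N = jump_rate lam mu p r i k.
Proof.
case: i => // i _ k1; rewrite /generator /=.
rewrite -[in X in if X then _ else _]addn1 eqn_add2l (negbTE k1) ltnS leq_addr.
have -> : ((i + k).+1 - i.+1 = k)%N by rewrite subSS addKn.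
rewrite /jump_rate /shifted_immigration.
have -> : (i + k)%:Z - i.+1%:Z = k%:Z - 1 by rewrite PoszD -addn1 PoszD; ring.
by ring.
Qed.

Lemma generator_down i j : (0 < i)%N -> (j < i.-1)%N -> Q i j = 0.
Proof.
case: i => // i _ /= ji; rewrite /generator.
have -> : (i.+1 == 0)%N = false by [].
have -> : (j == i.+1) = false by apply: ltn_eqF; exact: ltnW.
have -> : (i.+1 <= j.+1)%N = false by apply/negbTE; rewrite -ltnNge.
by [].
Qed.

Lemma jump_rate1 i : jump_rate lam mu p r i 1 = 0.
Proof. by rewrite /jump_rate p1_eq0 shifted1// mulr0 mulr0 addr0. Qed.

Lemma kernel_generator_up q i k : 0 <= q -> (0 < i)%N ->
  kernel Q q i (i.-1 + k)%N = (q + exit_rate lam mu i)^-1 * jump_rate lam mu p r i k.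
Proof.
move=> q0 i0; have c0 : 0 < exit_rate lam mu i by exact: exit_rate_gt0.
have qc : 0 < q + exit_rate lam mu i by rewrite ltr_wpDl.
rewrite /kernel /jump_matrix generator_diag// oppr_eq0 gt_eqF// opprK.
have [->|k1] := eqVneq k 1%N; first by rewrite addn1 prednK// eqxx mul0r jump_rate1 mulr0.
rewrite generator_up//; case: ifPn => [/eqP iE|_].
  by move: k1; rewrite -(eqn_add2l i.-1) addn1 prednK// -iE eqxx.
move: c0 qc; set C := exit_rate lam mu i => c0 qc.
by rewrite (addrC C q); field; rewrite !gt_eqF.
Qed.

Lemma kernel_generator_down q i j : (0 < i)%N -> (j < i.-1)%N -> kernel Q q i j = 0.
Proof.
move=> i0 ji; have c0 : 0 < exit_rate lam mu i by exact: exit_rate_gt0.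
rewrite /kernel /jump_matrix generator_diag// oppr_eq0 gt_eqF//.
rewrite gtn_eqF; last by rewrite (leq_trans ji)// leq_pred.
by rewrite generator_down// mul0r mul0r.
Qed.

Lemma jump_matrix_generator_ge0 i j : 0 <= jump_matrix Q i j.
Proof.
rewrite /jump_matrix; case: ifP => // Qi; case: ifP => // ij.
have i0 : (0 < i)%N by case: i Qi {ij} => //; rewrite generator_diag0 eqxx.
rewrite divr_ge0 ?oppr_ge0 ?generator_diag_le0//.
have [ji|ij'] := ltnP j i.-1; first by rewrite generator_down.
rewrite -(subnKC ij') generator_up//; first exact: jump_rate_ge0.
apply/eqP => E; move: ij; rewrite -(subnKC ij') E addn1 prednK// eqxx.
by [].
Qed.

Local Open Scope ereal_scope.

Lemma kernel_generator_sum q f i : (0 <= q)%R -> (forall j, 0 <= f j) -> (0 < i)%N ->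
  \sum_(j <oo) (kernel Q q i j)%:E * f j =
  ((q + exit_rate lam mu i)^-1)%:E * jump_sum lam mu p r f i.
Proof.
move=> q0 f0 i0.
have k0 j : 0 <= (kernel Q q i j)%:E * f j.
  rewrite mule_ge0// lee_fin kernel_ge0//.
  - exact: generator_diag_le0.
  - exact: jump_matrix_generator_ge0.
rewrite (@nneseries_split _ _ 0%N i.-1)//.
rewrite add0n big_nat_cond big1 ?add0e; last first.
  by move=> j /andP[/andP[_ ji] _]; rewrite kernel_generator_down// mul0e.
rewrite -(@nneseries_addn _ (fun j => (kernel Q q i j)%:E * f j) i.-1)//.
rewrite /jump_sum -nneseriesZl; last by move=> k _; exact: jump_term_ge0.
apply: eq_eseriesr => k _.
by rewrite addnC kernel_generator_up// EFinM muleA.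
Qed.

Lemma kernel_step_generator a q f i : (0 <= q)%R -> (forall j, 0 <= f j) ->
  kernel_step Q q (fun j => a < j)%N f i = killed_step lam mu p r a q f i.
Proof.
move=> q0 f0; rewrite /kernel_step /killed_step; case: ifP => // ai.
by rewrite kernel_generator_sum// (leq_ltn_trans _ ai).
Qed.

Lemma kernel_step_generatorT q f i : (0 <= q)%R -> (forall j, 0 <= f j) ->
  kernel_step Q q predT f i = killed_step lam mu p r 0 q f i.
Proof.
move=> q0 f0; rewrite /kernel_step /killed_step /=; case: ifPn => i0.
  by rewrite kernel_generator_sum.
rewrite eseries0// => j _ _.
have -> : i = 0%N by apply/eqP; rewrite -leqn0 leqNgt.
by rewrite /kernel generator_diag0 oppr0 mul0r mulr0 mul0e.
Qed.

Lemma kernel_iter_generator a q f n i : (0 <= q)%R -> (forall j, 0 <= f j) ->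
  iter n (kernel_step Q q (fun j => a < j)%N) f i = iter n (killed_step lam mu p r a q) f i.
Proof.
move=> q0 f0; elim: n i => [//|n IH] i /=.
rewrite kernel_step_generator//.
  by congr killed_step; apply/funext.
move=> j; apply: kernel_iter_ge0 => //.
- exact: generator_diag_le0.
- exact: jump_matrix_generator_ge0.
Qed.

Lemma kernel_iter_generatorT q f n i : (0 <= q)%R -> (forall j, 0 <= f j) ->
  iter n (kernel_step Q q predT) f i = iter n (killed_step lam mu p r 0 q) f i.
Proof.
move=> q0 f0; elim: n i => [//|n IH] i /=.
rewrite kernel_step_generatorT//.
  by congr killed_step; apply/funext.
move=> j; apply: kernel_iter_ge0 => //.
- exact: generator_diag_le0.
- exact: jump_matrix_generator_ge0.
Qed.

End Generator.

(** * Passage, escape and explosion in terms of the jump operator *)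

Section Events.
Variables (R : realType) (d : measure_display) (Omega : measurableType d).
Variables (P : nat -> probability Omega R) (X : R -> Omega -> option nat).
Variables (lam mu : R) (p : nat -> R) (r : int -> R).
Hypotheses (lam_gt0 : 0 < lam) (mu_ge0 : 0 <= mu).
Hypotheses (p_distr : is_distribution p) (p0_gt0 : 0 < p 0%N) (p1_eq0 : p 1%N = 0).
Hypothesis r_distr : is_immigration_distribution r.
Hypothesis X_chain : minimal_markov_chain (generator lam mu p r) P X.
Local Open Scope ereal_scope.
Local Notation T n omega := (jump_time (X ^~ omega) n).
Local Notation S n omega := (state (X ^~ omega) n).
Local Notation zeta omega := (explosion_time (X ^~ omega)).
Local Notation Tb a omega := (passage_time_below a (X ^~ omega)).

Let mX t s : (0 <= t)%R -> measurable [set omega | X t omega = s].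
Proof. by case: X_chain => h _ _; exact: h. Qed.

Let X_path omega : minimal_cadlag_path (X ^~ omega).
Proof. by case: X_chain. Qed.

Let mT n : measurable_fun setT (fun omega => T n omega).
Proof. exact: measurable_jump_time mX X_path n. Qed.

Let mS n (A : set nat) : measurable [set omega | A (S n omega)].
Proof. exact: (measurable_state_set mX X_path n A). Qed.

Let mD (q : R) n : measurable_fun setT (fun omega => (discount q (T n omega))%:E).
Proof.
apply/measurable_EFinP; apply: measurableT_comp; first exact: measurable_discount.
exact: mT.
Qed.

Lemma measurable_stay (b : pred nat) n : measurable (stay_event X b n).
Proof.
rewrite (_ : stay_event X b n = \bigcap_(k in [set k | (k < n)%N]) [set omega | b (S k omega)]).
  by apply: bigcap_measurableType => k _; exact: (mS k [set j | b j]).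
by apply/seteqP; split.
Qed.

Lemma stay_laplace_generator a q (f : nat -> R) x n : (0 <= q)%R ->
  (forall j, 0 <= f j)%R ->
  \int[P x]_(omega in stay_event X (fun j => a < j)%N n)
     (discount q (T n omega) * f (S n omega))%:E =
  iter n (killed_step lam mu p r a q) (EFin \o f) x.
Proof.
move=> q0 f0; rewrite -(kernel_iter_generator lam_gt0)//.
apply: (stay_laplace X_chain) => //.
- exact: generator_diag_le0.
- exact: jump_matrix_generator_ge0.
- move=> i ai; right; have i0 : (0 < i)%N by exact: leq_ltn_trans ai.
  by rewrite generator_diag// opprK exit_rate_gt0.
Qed.

Definition first_below_event (a n : nat) : set Omega :=
  stay_event X (fun j => a < j)%N n `&` [set omega | (S n omega <= a)%N].

Lemma measurable_first_below a n : measurable (first_below_event a n).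
Proof. by apply: measurableI; [exact: measurable_stay|exact: (mS n [set j | (j <= a)%N])]. Qed.

Lemma passage_event a :
  [set omega | Tb a omega < +oo] = \bigcup_n first_below_event a n.
Proof.
apply/seteqP; split => omega /=.
  by move=> /(passage_finP (X_path omega)) [n fb]; exists n.
by move=> [n _ fb]; apply/(passage_finP (X_path omega)); exists n.
Qed.

Lemma measurable_passage a : measurable [set omega | Tb a omega < +oo].
Proof. by rewrite passage_event; apply: bigcupT_measurable => n; exact: measurable_first_below. Qed.

Lemma passage_laplace a q x : (0 <= q)%R ->
  \int[P x]_(omega in [set omega | Tb a omega < +oo]) (expR (- q * fine (Tb a omega)))%:E
  = hit lam mu p r a q x.
Proof.
move=> q0; rewrite passage_event.
have onF n omega : first_below_event a n omega ->
    (expR (- q * fine (Tb a omega)))%:E = (discount q (T n omega))%:E.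
  move=> fb; rewrite (passage_first_below (X_path omega) fb) discount_fin//.
  - exact: (first_below_fin fb).
  - exact: jump_time_ge0.
rewrite ge0_integral_bigcup//; first last.
- move=> n m _ _ [omega [[sn an] [sm am]]].
  have [nm|mn|//] := ltngtP n m.
    by have := sm n nm; rewrite ltnNge an.
  by have := sn m mn; rewrite ltnNge am.
- apply/measurable_fun_bigcup; first by move=> n; exact: measurable_first_below.
  move=> n; apply: (eq_measurable_fun (fun omega => (discount q (T n omega))%:E)).
    by move=> omega /set_mem /onF.
  exact: measurable_funS (mD q n).
- by move=> n; exact: measurable_first_below.
apply: eq_eseriesr => n _.
rewrite (eq_integral (fun omega => (discount q (T n omega))%:E)); last first.
  by move=> omega /set_mem /onF.
pose f (j : nat) : R := ((j <= a)%N)%:R.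
rewrite -[RHS](_ : iter n (killed_step lam mu p r a q) (EFin \o f) x = _)//.
rewrite -stay_laplace_generator// /first_below_event integral_mkcondr.
apply: eq_integral => omega _; rewrite patchE /f.
have [Sa|Sa] := leqP (S n omega) a; first by rewrite mem_set// mulr1.
by rewrite memNset ?mulr0//=; apply/negP; rewrite -ltnNge.
Qed.

Lemma passage_probability a x :
  P x [set omega | Tb a omega < +oo] = hit lam mu p r a 0 x.
Proof.
rewrite -passage_laplace//.
under eq_integral do rewrite oppr0 mul0r expR0.
by rewrite integral_cst ?mul1e//; exact: measurable_passage.
Qed.

Lemma measurable_explosion (z : R) : measurable [set omega | zeta omega <= z%:E].
Proof.
rewrite (_ : [set _ | _] = \bigcap_n [set omega | T n omega <= z%:E]).
  apply: bigcapT_measurable => n; rewrite -[X in measurable X]setTI.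
  exact: emeasurable_fun_infty_c.
apply/seteqP; split => omega /=.
  by move=> h n _ /=; apply: le_trans h; exact: jump_time_le_explosion.
by move=> h; apply: ge_ereal_sup => _ [n _ <-]; exact: h.
Qed.

Lemma explosion_event :
  [set omega | zeta omega < +oo] = \bigcup_n [set omega | zeta omega <= n%:R%:E].
Proof.
apply/seteqP; split => omega /=; last by move=> [n _] /= /le_lt_trans; apply; exact: ltry.
case E : (zeta omega) => [z| |] //.
  move=> _; exists (Num.bound `|z|) => //=; rewrite E lee_fin.
  by apply: ltW; rewrite (le_lt_trans (ler_norm z))// archi_boundP.
by have := explosion_time_ge0 (X ^~ omega); rewrite E.
Qed.

Lemma escape_event a : [set omega | zeta omega < Tb a omega] =
  [set omega | forall n, (a < S n omega)%N] `&` [set omega | zeta omega < +oo].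
Proof. by apply/seteqP; split => omega /=; move/(escape_beforeP (X_path omega)). Qed.

Lemma measurable_escape a : measurable [set omega | zeta omega < Tb a omega].
Proof.
rewrite escape_event explosion_event; apply: measurableI.
  rewrite (_ : [set _ | _] = \bigcap_n [set omega | (a < S n omega)%N]).
    by apply: bigcapT_measurable => n; exact: (mS n [set j | (a < j)%N]).
  by apply/seteqP; split => omega /= h n => [_|]; exact: h.
by apply: bigcupT_measurable => n; exact: measurable_explosion.
Qed.

Lemma discount_explosion_cvg (q : R) omega : (0 < q)%R ->
  discount q (T n omega) @[n --> \oo] --> discount q (zeta omega).
Proof.
move=> q0.
have Tz : T n omega @[n --> \oo] --> zeta omega.
  by apply: ereal_nondecreasing_cvgn => n m nm; exact: jump_time_homo.
have q0' : q == 0%R = false by rewrite gt_eqF.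
case E : (zeta omega) => [z| |] //.
- have Tfin n : T n omega \is a fin_num.
    rewrite ge0_fin_numE ?jump_time_ge0//.
    by rewrite (le_lt_trans (jump_time_le_explosion _ n))// E ltry.
  have -> : (fun n => discount q (T n omega)) = (fun n => expR (- q * fine (T n omega))).
    apply/funext => n; apply: discount_fin; last exact: jump_time_ge0.
    by have := Tfin n; rewrite ge0_fin_numE ?jump_time_ge0.
  rewrite /discount q0'; apply: continuous_cvg; first exact: continuous_expR.
  apply: cvgM; first exact: cvg_cst.
  by apply: fine_cvg; rewrite -E.
- rewrite [X in _ --> X](_ : _ = 0%R); last by rewrite /discount q0'.
  apply/cvgrPdist_le => e e0.
  move: Tz; rewrite E => /cvgeyPge /(_ (- ln e / q)%R).
  apply: filterS => n; rewrite sub0r normrN /discount q0'.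
  case: (T n omega) => [t| |] //; rewrite ?normr0 ?(ltW e0)//.
  rewrite lee_fin ler_pdivrMr// => h.
  by rewrite ger0_norm ?expR_ge0// -[leRHS]lnK ?posrE// ler_expR; lra.
- by have := explosion_time_ge0 (X ^~ omega); rewrite E.
Qed.

(** [discount q] at the n-th jump time, on the event of staying above [a] so
    far, converges to the discount at the explosion time. *)
Lemma escape_laplace a q x : (0 < q)%R ->
  \int[P x]_(omega in [set omega | zeta omega < Tb a omega])
     (expR (- q * fine (zeta omega)))%:E
  = escape lam mu p r a q x.
Proof.
move=> q_gt0; have q0 := ltW q_gt0.
pose f (j : nat) : R := ((a < j)%N)%:R.
pose h n omega : \bar R := ((fun omega => (discount q (T n omega) * f (S n omega))%:E)
   \_ (stay_event X (fun j => a < j)%N n)) omega.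
have hE n : \int[P x]_omega h n omega = survive lam mu p r a q n x.
  rewrite /h -integral_mkcond stay_laplace_generator//.
pose F omega : \bar R := ((fun omega => (expR (- q * fine (zeta omega)))%:E)
   \_ [set omega | zeta omega < Tb a omega]) omega.
have hF omega : h n omega @[n --> \oo] --> F omega.
  have [H|] := pselect (forall n, (a < S n omega)%N).
    have -> : (fun n => h n omega) = (fun n => (discount q (T n omega))%:E).
      apply/funext => n; rewrite /h patchE mem_set; last by move=> k _; exact: H.
      by rewrite /f H mulr1.
    have -> : F omega = (discount q (zeta omega))%:E.
      rewrite /F patchE; case: ifPn => [/set_mem /=|/negP].
        move=> zT; rewrite discount_fin//; last exact: explosion_time_ge0.
        by apply: lt_le_trans zT _; exact: leey.
      rewrite inE => zT; case E : (zeta omega) => [z| |].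
      - case: zT => /=; apply/(escape_beforeP (X_path omega)); split => //.
        by rewrite E ltry.
      - by rewrite /discount gt_eqF.
      - by have := explosion_time_ge0 (X ^~ omega); rewrite E.
    apply: cvg_EFin; first by apply: nearW.
    exact: discount_explosion_cvg.
  move=> /existsNP [N /negP]; rewrite -leqNgt => SN.
  have -> : F omega = 0.
    rewrite /F patchE memNset//= => /(escape_beforeP (X_path omega)) [/(_ N)].
    by rewrite ltnNge SN.
  apply: cvg_near_cst; exists N.+1 => // n /= Nn.
  rewrite /h patchE memNset// => /(_ N Nn).
  by rewrite ltnNge SN.
have mh n : measurable_fun setT (h n).
  apply: (iffLR (measurable_restrictT _ (measurable_stay _ n))).
  apply: measurable_funS (measurable_discount_state X_chain q f n) => //.
have mF : measurable_fun setT F.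
  apply: (emeasurable_fun_cvg h) => // omega _; exact: hF.
have h1 omega n : `|h n omega| <= cst 1 omega.
  rewrite /h patchE; case: ifP => _ /=; last by rewrite normr0 lee_fin.
  rewrite lee_fin ger0_norm ?mulr_ge0 ?discount_ge0//.
  rewrite mulr_ile1 ?discount_ge0//; last by rewrite /f lern1 leq_b1.
  by apply: discount_le1 => //; exact: jump_time_ge0.
have i1 : (P x).-integrable setT (cst 1 : Omega -> \bar R).
  exact: finite_measure_integrable_cst.
have [_ _] := @dominated_convergence _ _ R (P x) setT measurableT h F (cst 1) mh mF
  (aeW _ (fun omega _ => hF omega)) i1 (aeW _ (fun omega n _ => h1 omega n)).
rewrite (_ : (fun n => _) = (fun n => survive lam mu p r a q n x)); last first.
  by apply/funext => n; exact: hE.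
move=> /(cvg_lim (@ereal_hausdorff R)) E; rewrite [RHS]E.
by rewrite [LHS]integral_mkcond.
Qed.

(** P (zeta <= N) exp (- N) is at most E[exp (- T_n)] for every jump time T_n,
    and as state 0 is absorbing the latter is controlled by [survive] above 0. *)
Lemma can_explode_escape : can_explode P X ->
  exists2 y, (0 < y)%N & 0 < escape lam mu p r 0 1 y.
Proof.
move=> [y y0 zy]; exists y => //; rewrite lt0e escape_ge0// andbT.
apply/eqP => esc0; move: zy; rewrite explosion_event => /gt_eqF/negP; apply.
apply/eqP; apply/negligibleP.
  by apply: bigcupT_measurable => N; exact: measurable_explosion.
apply: negligible_bigcup => N; apply/negligibleP; first exact: measurable_explosion.
pose u n := iter n (killed_step lam mu p r 0 1) (EFin \o (fun=> 1%R)) y.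
have uE n : \int[P y]_omega (discount 1 (T n omega))%:E = u n.
  rewrite /u -(kernel_iter_generatorT lam_gt0)//.
  rewrite -(stay_laplace X_chain)//; last 3 first.
  - exact: generator_diag_le0.
  - exact: jump_matrix_generator_ge0.
  - by move=> i _; left.
  rewrite (_ : stay_event _ _ _ = setT); last by apply/seteqP; split.
  by apply: eq_integral => omega _; rewrite mulr1.
have us n : u n.+1 <= survive lam mu p r 0 1 n y.
  rewrite /u /survive iterSr; elim: n y {y0 esc0 u uE} => [|n IH] y.
    rewrite /= /killed_step /above; case: ifPn => // y0.
    rewrite (jump_sum_cst lam_gt0 mu_ge0 p_distr r_distr ler01 y0) mulr1 -EFinM lee_fin.
    rewrite mulrC ler_pdivrMr ?mul1r ?lerDr//.
    by rewrite ltr_wpDr// exit_rate_ge0.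
  rewrite !iterS; apply: killed_step_le => // j.
  by apply: killed_iter_ge0 => // k; apply: killed_step_ge0 => // l; rewrite lee_fin.
have Pu n : P y [set omega | zeta omega <= N%:R%:E] * (expR (- N%:R))%:E <= u n.
  rewrite -uE muleC -integral_cst; last exact: measurable_explosion.
  apply: (@le_trans _ _ (\int[P y]_(omega in [set omega | zeta omega <= N%:R%:E]) (discount
      1 (T n omega))%:E)).
    apply: ge0_le_integral => //.
    - exact: measurable_explosion.
    - by move=> omega _; rewrite lee_fin expR_ge0.
    - exact: measurable_funS (mD 1 n).
    - move=> omega /= zN; have TN := le_trans (jump_time_le_explosion _ n) zN.
      rewrite discount_fin ?jump_time_ge0//; last by rewrite (le_lt_trans TN)// ltry.
      rewrite lee_fin ler_expR mulN1r lerN2.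
      by rewrite -lee_fin fineK// ge0_fin_numE ?jump_time_ge0// (le_lt_trans TN)// ltry.
  apply: ge0_subset_integral => //; first exact: measurable_explosion.
  by move=> omega _; rewrite lee_fin discount_ge0.
have : P y [set omega | zeta omega <= N%:R%:E] * (expR (- N%:R))%:E <= 0.
  rewrite -esc0; apply: lime_ge; first exact: survive_cvg.
  by apply: nearW => n; apply: le_trans (Pu n.+1) (us n).
rewrite pmule_lle0 ?lte_fin ?expR_gt0// => h.
by apply/eqP; rewrite eq_le h measure_ge0.
Qed.

End Events.

(** * Moments of kernels on (0, 1) *)

Section KernelTools.
Variables (R : realType) (lam mu : R) (p : nat -> R) (r : int -> R).
Hypotheses (lam_gt0 : 0 < lam) (mu_ge0 : 0 <= mu).
Hypotheses (p_distr : is_distribution p) (p0_gt0 : 0 < p 0%N) (p1_eq0 : p 1%N = 0).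
Hypothesis r_distr : is_immigration_distribution r.
Local Notation rs := (shifted_immigration r).
Local Notation N := (killing_balance mu r).
Local Notation c := (exit_rate lam mu).
Local Notation rate := (jump_rate lam mu p r).
Local Notation J := (jump_sum lam mu p r).
Local Notation leb := (@lebesgue_measure R).
Local Notation vp := (varphi p).

(** The generating function of the pure branching process moves along
    dv/dt = branching_drift v. *)
Definition branching_drift (v : R) : R := lam * (ptilde p v - v).
Local Notation D := branching_drift.

Lemma branching_drift_cont : {in `]0, 1[, continuous D}.
Proof.
move=> v; rewrite in_itv/= => v01; apply: cvgM; first exact: cvg_cst.
by apply: cvgB; [apply: (pgf_continuous p_distr)|exact: cvg_id].
Qed.

Lemma killing_balance_cont01 q : {in `]0, 1[, continuous (N q)}.
Proof. by move=> v; rewrite in_itv/= => v01; exact: killing_balance_cont. Qed.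

Lemma varphi_gt0 : 0 < vp. Proof. by have [/andP[]] := varphiP p_distr p0_gt0 p1_eq0. Qed.
Lemma varphi_le1 : vp <= 1. Proof. by have [/andP[]] := varphiP p_distr p0_gt0 p1_eq0. Qed.

Lemma branching_drift_gt0 v : v \in `]0, vp[ -> 0 < D v.
Proof.
rewrite in_itv/= => /andP[v0 vv]; have [_ H _ _] := varphiP p_distr p0_gt0 p1_eq0.
by rewrite mulr_gt0// subr_gt0 H// ltW.
Qed.

(** Thus 1 / [branching_drift] is at least a simple pole at varphi, which makes
    the exponents diverge there. *)
Lemma branching_drift_le v : v \in `]0, vp[ -> D v <= lam * (vp - v).
Proof.
rewrite in_itv/= => /andP[v0 vv]; have [_ _ H _] := varphiP p_distr p0_gt0 p1_eq0.
rewrite ler_pM2l// lerD2r -[leRHS]H (ler_pgf p_distr)//; first exact: ltW.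
  exact: ltW.
exact: varphi_le1.
Qed.

Lemma branching_drift_lt0 v : v \in `]vp, 1[ -> D v < 0.
Proof.
rewrite in_itv/= => vv; have [_ _ _ H] := varphiP p_distr p0_gt0 p1_eq0.
by rewrite pmulr_rlt0// subr_lt0 H.
Qed.

Lemma branching_drift_ge v : v \in `]vp, 1[ -> - D v <= lam * (v - vp).
Proof.
rewrite in_itv/= => /andP[vv v1]; have [_ _ H _] := varphiP p_distr p0_gt0 p1_eq0.
rewrite -mulrN opprB ler_pM2l// lerD2l lerN2 -[leLHS]H (ler_pgf p_distr)//.
- exact: ltW varphi_gt0.
- exact: ltW.
- exact: ltW.
Qed.

Lemma branching_drift_near0 v : 0 <= v <= p 0%N / 2 -> lam * (p 0%N / 2) <= D v.
Proof.
move=> /andP[v0 vp0]; rewrite ler_pM2l//.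
have p01 : p 0%N <= 1.
  by have := distr_sum_le1 p_distr 1; rewrite big_nat1.
have : p 0%N <= ptilde p v by apply: (pgf_ge p_distr); rewrite v0/=; lra.
lra.
Qed.

Lemma varphi_gt_half_p0 : p 0%N / 2 < vp.
Proof.
have [_ _ H _] := varphiP p_distr p0_gt0 p1_eq0.
have : p 0%N <= vp.
  by rewrite -[leRHS]H (pgf_ge p_distr)// ltW ?varphi_gt0 ?varphi_le1.
by move: p0_gt0; lra.
Qed.

Lemma itv_sub01 (l u : R) : 0 <= l -> u <= 1 -> {subset `]l, u[ <= `]0, 1[}.
Proof.
move=> l0 u1 v; rewrite !in_itv/= => /andP[lv vu].
by rewrite (le_lt_trans l0 lv) (lt_le_trans vu u1).
Qed.

(** As a function of [n]: a mixture of the powers [v ^ n] with density [K]. *)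
Definition power_moment (K : R -> R) (l u : R) (n : nat) : \bar R :=
  (\int[leb]_(v in `]l, u[) (K v * v ^+ n)%:E)%E.

Lemma power_kernel_cont (K : R -> R) (l u : R) (n : nat) : {in `]l, u[, continuous K} ->
  {in `]l, u[, continuous (fun v => K v * v ^+ n)}.
Proof. by move=> cK v vlu; apply: cvgM; [exact: cK|exact: exprn_continuous]. Qed.

Lemma power_moment_ge0 (K : R -> R) (l u : R) (n : nat) : 0 <= l -> {in `]l, u[, forall v,
    0 <= K v} ->
  (0 <= power_moment K l u n)%E.
Proof.
move=> l0 K0; apply: integral_ge0 => v /= vlu; rewrite lee_fin mulr_ge0 ?K0//.
by move: vlu; rewrite in_itv/= => /andP[lv _]; rewrite exprn_ge0// ltW// (le_lt_trans l0).
Qed.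

Lemma power_moment_fin (K : R -> R) (l u : R) (n : nat) : 0 <= l -> u <= 1 ->
  {in `]l, u[, continuous K} -> {in `]l, u[, forall v, 0 <= K v} ->
  (\int[leb]_(v in `]l, u[) (K v)%:E < +oo)%E -> power_moment K l u n \is a fin_num.
Proof.
move=> l0 u1 cK K0 Kfin; rewrite ge0_fin_numE ?power_moment_ge0//.
apply: le_lt_trans Kfin; apply: integral_oo_le => //; first exact: power_kernel_cont.
move=> v vlu; have := itv_sub01 l0 u1 vlu; rewrite in_itv/= => /andP[/ltW v0 /ltW v1].
have Kv := K0 v vlu; have vn0 : 0 <= v ^+ n by exact: exprn_ge0.
by apply/andP; split; [exact: mulr_ge0|rewrite ler_piMr// exprn_ile1].
Qed.

Lemma power_moment_eventually0 (K : R -> R) (l u : R) : 0 <= l -> u <= 1 ->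
  {in `]l, u[, continuous K} -> {in `]l, u[, forall v, 0 <= K v} ->
  (\int[leb]_(v in `]l, u[) (K v)%:E < +oo)%E ->
  eventually_le (fun n => fine (power_moment K l u n)) (fun=> 0).
Proof.
move=> l0 u1 cK K0 Kfin; apply: cvg0_eventually_le.
by have /fine_cvg := integral_powers_cvg0 l0 u1 cK K0 Kfin.
Qed.

(** (Q - q) v^n, split into the part due to the branching drift and the part due
    to killing and immigration. *)
Lemma jump_sum_power_balance q (v : R) n : 0 < v <= 1 -> (0 < n)%N ->
  J (fun n => (v ^+ n)%:E) n =
  ((q + c n) * v ^+ n + (n%:R * v ^+ n.-1 * D v - N q v * v ^+ n))%:E.
Proof.
move=> v01 n0; rewrite (jump_sum_power lam_gt0 mu_ge0 p_distr r_distr)//; last first.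
  by case/andP: v01 => /ltW ->.
congr (_%:E); have E := killing_balanceM mu r_distr q v01.
by rewrite -(prednK n0) exprS (mulrA (N q v)) E /D /exit_rate /= prednK//; ring.
Qed.

(** Jumps act on power moments through the generating functions. *)
Lemma jump_sum_power_moment (K : R -> R) (l u : R) i : 0 <= l -> u <= 1 -> (0 < i)%N ->
  {in `]l, u[, continuous K} -> {in `]l, u[, forall v, 0 <= K v} ->
  J (power_moment K l u) i = (\int[leb]_(v in `]l, u[)
    (K v * (lam * i%:R * v ^+ i.-1 * ptilde p v + mu * v ^+ i.-1 * ptilde rs v))%:E)%E.
Proof.
move=> l0 u1 i0 cK K0.
have vge0 v : v \in `]l, u[ -> 0 <= v.
  by rewrite in_itv/= => /andP[lv _]; rewrite ltW// (le_lt_trans l0).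
have vle1 v : v \in `]l, u[ -> v <= 1.
  by rewrite in_itv/= => /andP[_ vu]; rewrite ltW// (lt_le_trans vu).
have rate0 k : 0 <= rate i k by exact: jump_rate_ge0.
transitivity (\sum_(k <oo) \int[leb]_(v in `]l, u[)
    ((rate i k)%:E * (K v * v ^+ (i.-1 + k))%:E))%E.
  apply: eq_eseriesr => k _; rewrite /power_moment ge0_integralZl//.
  - apply/measurable_EFinP; apply: continuous_oo_measurable.
    exact: power_kernel_cont.
  - by move=> v /= vlu; rewrite lee_fin mulr_ge0 ?K0// exprn_ge0// vge0.
  - by rewrite lee_fin.
rewrite -(@integral_nneseries _ _ R leb _ _ (fun k v => (rate i k)%:E * (K v * v ^+ (i.-1 +
    k))%:E)%E)//; last 2 first.
- move=> k; apply: measurable_funeM.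
  apply/measurable_EFinP; apply: continuous_oo_measurable.
  exact: power_kernel_cont.
- by move=> k v /= vlu; rewrite -EFinM lee_fin !mulr_ge0 ?K0// exprn_ge0// vge0.
apply: eq_integral => v /set_mem /= vlu.
rewrite EFinM -(jump_sum_power lam_gt0 mu_ge0 p_distr r_distr)//; last first.
  by rewrite vge0// vle1.
rewrite /jump_sum -nneseriesZl; last first.
  move=> k _; rewrite -EFinM lee_fin mulr_ge0// exprn_ge0// vge0//.
by apply: eq_eseriesr => k _; rewrite -!EFinM; congr (_%:E); ring.
Qed.

(** Integration by parts: integrating (Q - q) v^i against [K] only leaves the
    boundary values of a primitive [B]. Passage and escape use kernels for which
    this primitive is explicit, see [exp_power_derive]. *)
Lemma power_moment_harmonic (K B : R -> R) (l u : R) i (q b0 b1 : R) : 0 <= l -> u <= 1 -> l < u ->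
  (0 < i)%N -> 0 <= q ->
  {in `]l, u[, continuous K} -> {in `]l, u[, forall v, 0 <= K v} ->
  antiderivative B (fun v => K v * (i%:R * v ^+ i.-1 * D v - N q v * v ^+ i)) l u ->
  B x @[x --> l^'+] --> b0 -> B x @[x --> u^'-] --> b1 ->
  (J (power_moment K l u) i + b0%:E =
   (q + c i)%:E * power_moment K l u i + b1%:E)%E.
Proof.
move=> l0 u1 lu i0 q0 cK K0 dB Bl Bu.
have v01 v : v \in `]l, u[ -> v \in `]0, 1[ by exact: itv_sub01.
have vgt0 v : v \in `]l, u[ -> 0 < v by move/v01; rewrite in_itv/= => /andP[].
have vlt1 v : v \in `]l, u[ -> v < 1 by move/v01; rewrite in_itv/= => /andP[].
have qc0 : 0 <= q + c i by rewrite addr_ge0// exit_rate_ge0.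
have p0' v : v \in `]l, u[ -> 0 <= ptilde p v.
  by move=> vlu; rewrite (le_trans _ (pgf_ge p_distr _))// ?p_distr.1// !ltW ?vgt0 ?vlt1.
have rs0' v : v \in `]l, u[ -> 0 <= ptilde rs v.
  by move=> vlu; rewrite (le_trans _ (pgf_ge (shifted_distr r_distr) _))// ?(shifted_distr
      r_distr).1// !ltW ?vgt0 ?vlt1.
rewrite jump_sum_power_moment// /power_moment -ge0_integralZl//; last 2 first.
- by apply/measurable_EFinP; apply: continuous_oo_measurable; exact: power_kernel_cont.
- by move=> v /= vlu; rewrite lee_fin mulr_ge0 ?K0// exprn_ge0// ltW// vgt0.
under [in RHS]eq_integral do rewrite -EFinM.
have cp f : is_distribution f -> {in `]l, u[, continuous (ptilde f)}.
  by move=> fd v /v01; rewrite in_itv/= => /(pgf_continuous fd).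
apply: (improper_FTC lu _ _ _ _ _ Bl Bu).
- move=> v vlu; apply: cvgM; first exact: cK.
  apply: cvgD; apply: cvgM.
  - by apply: cvgM; [exact: cvg_cst|exact: exprn_continuous].
  - exact: (cp _ p_distr).
  - by apply: cvgM; [exact: cvg_cst|exact: exprn_continuous].
  - exact: (cp _ (shifted_distr r_distr)).
- move=> v vlu; apply: cvgM; first exact: cvg_cst.
  exact: (@power_kernel_cont K l u i cK v vlu).
- move=> v vlu; rewrite mulr_ge0 ?K0// addr_ge0// mulr_ge0 ?p0' ?rs0'//.
    by rewrite !mulr_ge0// ?exprn_ge0// ltW// vgt0.
  by rewrite mulr_ge0// exprn_ge0// ltW// vgt0.
- by move=> v vlu; rewrite mulr_ge0// mulr_ge0 ?K0// exprn_ge0// ltW// vgt0.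
move=> v vlu; have -> : K v * (lam * i%:R * v ^+ i.-1 * ptilde p v + mu * v ^+ i.-1 * ptilde rs v)
    - (q + c i) * (K v * v ^+ i) = K v * (i%:R * v ^+ i.-1 * D v - N q v * v ^+ i).
  have E : N q v * v = (q + mu) * v - mu * ptilde rs v.
    by rewrite killing_balanceM// vgt0// ltW// vlt1.
  rewrite -(prednK i0) exprS (mulrA (N q v)) E /D /exit_rate /= prednK//; ring.
exact: dB.
Qed.

(** The integral of [N q * K] is the increment of a primitive, so [K] itself is
    integrable where the balance is bounded below. *)
Lemma balance_kernel_lty (K B : R -> R) (l u k q b0 b1 : R) : 0 <= l -> u <= 1 -> l < u ->
  0 < k -> {in `]l, u[, forall v, k <= N q v} ->
  {in `]l, u[, continuous K} -> {in `]l, u[, forall v, 0 <= K v} ->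
  antiderivative B (fun v => N q v * K v) l u ->
  B x @[x --> l^'+] --> b0 -> B x @[x --> u^'-] --> b1 ->
  (\int[leb]_(v in `]l, u[) (K v)%:E < +oo)%E.
Proof.
move=> l0 u1 lu k0 Nk cK K0 dB Bl Bu.
have cNK : {in `]l, u[, continuous (fun v => N q v * K v)}.
  move=> v vlu; apply: cvgM; last exact: cK.
  exact: (killing_balance_cont01 (itv_sub01 l0 u1 vlu)).
have NK0 : {in `]l, u[, forall v, 0 <= N q v * K v}.
  by move=> v vlu; rewrite mulr_ge0 ?K0// (le_trans (ltW k0))// Nk.
have c0 : {in `]l, u[, continuous (fun=> 0 : R)} by move=> x _; exact: cvg_cst.
have z0 : {in `]l, u[, forall x : R, 0 <= (0 : R)} by [].
have dB0 : antiderivative B (fun v => N q v * K v - 0) l u.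
  by move=> v /dB; rewrite subr0.
have := improper_FTC lu cNK c0 NK0 z0 dB0 Bl Bu.
rewrite integral0 add0e => INK.
have NKfin : (\int[leb]_(v in `]l, u[) (N q v * K v)%:E < +oo)%E.
  by move: INK; case: (\int[leb]_(v in _) _)%E => [x| |] //= _; rewrite ltry.
apply: (@le_lt_trans _ _ (\int[leb]_(v in `]l, u[) (k^-1 * (N q v * K v))%:E)%E).
  apply: integral_oo_le => //.
  - by move=> v vlu; apply: cvgM; [exact: cvg_cst|exact: cNK].
  - move=> v vlu; rewrite K0//= mulrA ler_peMl ?K0//.
    by rewrite mulrC ler_pdivlMr// mul1r Nk.
under eq_integral do rewrite EFinM.
rewrite ge0_integralZl//.
- by rewrite lte_mul_pinfty// lee_fin invr_ge0 ltW.
- by apply/measurable_EFinP; exact: continuous_oo_measurable.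
- by rewrite lee_fin invr_ge0 ltW.
Qed.

End KernelTools.

(** * The exponential kernel below varphi *)

Section ExponentialKernel.
Variables (R : realType) (lam mu : R) (p : nat -> R) (r : int -> R).
Hypotheses (lam_gt0 : 0 < lam) (mu_ge0 : 0 <= mu).
Hypotheses (p_distr : is_distribution p) (p0_gt0 : 0 < p 0%N) (p1_eq0 : p 1%N = 0).
Hypothesis r_distr : is_immigration_distribution r.
Local Notation N := (killing_balance mu r).
Local Notation c := (exit_rate lam mu).
Local Notation J := (jump_sum lam mu p r).
Local Notation leb := (@lebesgue_measure R).
Local Notation vp := (varphi p).
Local Notation D := (branching_drift lam p).
Let vp0 : 0 < vp. Proof. exact: varphi_gt0. Qed.
Let vp1 : vp <= 1. Proof. exact: varphi_le1. Qed.
Let D_gt0 v : v \in `]0, vp[ -> 0 < D v. Proof. exact: branching_drift_gt0. Qed.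

Definition drift_ratio (q v : R) : R := N q v / D v.
Definition exp_kernel (G : R -> R) (v : R) : R := expR (- G v) / D v.
(** Holds for all exponents, see [drift_exponent_bounded]; it makes the kernel
    integrable at 0. *)
Definition bounded_below_near0 (G : R -> R) : Prop :=
  exists M d : R, 0 < d /\ forall v, 0 < v < d -> M <= G v.

Let sub0vp01 (s : R) : s <= vp -> {subset `]0, s[ <= `]0, 1[}.
Proof. by move=> svp; apply: itv_sub01 => //; exact: le_trans vp1. Qed.

Let sub0svp (s : R) : s <= vp -> {subset `]0, s[ <= `]0, vp[}.
Proof.
by move=> svp v; rewrite !in_itv/= => /andP[-> vs]; rewrite (lt_le_trans vs).
Qed.

Lemma drift_ratio_cont q : {in `]0, vp[, continuous (drift_ratio q)}.
Proof.
move=> v v0; have v01 := sub0vp01 (lexx _) v0.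
apply: cvgM; first exact: (killing_balance_cont01 r_distr v01).
by apply: cvgV; [rewrite gt_eqF// D_gt0|exact: branching_drift_cont].
Qed.

Lemma exp_derive (G g : R -> R) (l u : R) : antiderivative G g l u ->
  antiderivative (fun v => expR (- G v)) (fun v => - (g v * expR (- G v))) l u.
Proof.
move=> dG v vlu.
have := @is_derive1_comp R (@expR R) (fun w => - G w) v _ _ (is_derive_expR _) (is_deriveN
    (dG v vlu)).
by rewrite mulrN mulrC.
Qed.

Variables (q s : R) (G : R -> R).
Hypotheses (q_ge0 : 0 <= q) (s_gt0 : 0 < s) (s_le : s <= vp).
Hypothesis dG : antiderivative G (drift_ratio q) 0 s.
Hypothesis G_near0 : bounded_below_near0 G.
Local Notation E v := (expR (- G v)).
Local Notation K := (exp_kernel G).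

Let s1 : s <= 1. Proof. exact: le_trans vp1. Qed.

Lemma exp_cont : {in `]0, s[, continuous (fun v => E v)}.
Proof. exact: antiderivative_continuous (exp_derive dG). Qed.

Lemma exp_kernel_cont : {in `]0, s[, continuous K}.
Proof.
move=> v vs; apply: cvgM; first exact: exp_cont.
apply: cvgV; first by rewrite gt_eqF// D_gt0// (sub0svp s_le).
exact: (branching_drift_cont p_distr (sub0vp01 s_le vs)).
Qed.

Lemma exp_kernel_gt0 : {in `]0, s[, forall v, 0 < K v}.
Proof. by move=> v vs; rewrite divr_gt0 ?expR_gt0// D_gt0// (sub0svp s_le). Qed.

Let K_ge0 : {in `]0, s[, forall v, 0 <= K v}.
Proof. by move=> v /exp_kernel_gt0 /ltW. Qed.

(** With G' = N / D, the kernel exp (- G) / D is an integrating factor: the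
    integrand of [power_moment_harmonic] becomes exact. *)
Lemma exp_power_derive i : (0 < i)%N -> antiderivative (fun v => E v * v ^+ i)
  (fun v => K v * (i%:R * v ^+ i.-1 * D v - N q v * v ^+ i)) 0 s.
Proof.
move=> i0 v vs.
have := is_deriveM (exp_derive dG vs) (is_derive_power i v).
rewrite /GRing.scale/= => h.
have -> : K v * (i%:R * v ^+ i.-1 * D v - N q v * v ^+ i) =
    E v * (i%:R * v ^+ i.-1) + v ^+ i * - (drift_ratio q v * E v).
  have D0 : D v != 0 by rewrite gt_eqF// D_gt0// (sub0svp s_le).
  by rewrite /exp_kernel /drift_ratio; field.
exact: h.
Qed.

Lemma exp_power_cvg0 i : (0 < i)%N -> E x * x ^+ i @[x --> 0^'+] --> (0 : R).
Proof.
move=> i0; have [M [d [d0 Md]]] := G_near0.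
have up : expR (- M) * x @[x --> 0^'+] --> (0 : R).
  rewrite -[X in _ --> X](mulr0 (expR (- M))).
  apply: cvgM; first exact: cvg_cst.
  by apply: cvg_at_right_filter; exact: cvg_id.
apply: (squeeze_cvgr _ (cvg_cst (0 : R)) up).
near=> x.
have x0 : 0 < x by near: x; exact: nbhs_right_gt.
have xd : x < d by near: x; exact: nbhs_right_lt.
have x1 : x <= 1 by near: x; exact: nbhs_right_le.
rewrite mulr_ge0 ?expR_ge0 ?exprn_ge0 ?(ltW x0)//=.
apply: ler_pM; rewrite ?expR_ge0 ?exprn_ge0 ?(ltW x0)//.
  by rewrite ler_expR lerN2 Md// x0.
by rewrite -(prednK i0) exprS ler_piMr ?(ltW x0)// exprn_ile1// ltW.
Unshelve. all: by end_near. Qed.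

(** Harmonic up to a boundary term at [s], which vanishes for s = varphi in the
    transient case and has a favourable sign for truncations. *)
Lemma exp_moment_harmonic (e1 : R) i : (0 < i)%N ->
  E x @[x --> s^'-] --> e1 ->
  (J (power_moment K 0 s) i =
   (q + c i)%:E * power_moment K 0 s i + (e1 * s ^+ i)%:E)%E.
Proof.
move=> i0 Es.
rewrite -[LHS]adde0; apply: (power_moment_harmonic lam_gt0 mu_ge0 p_distr r_distr
    (lexx 0) s1 s_gt0 i0 q_ge0 exp_kernel_cont K_ge0 (exp_power_derive i0)).
  exact: exp_power_cvg0.
apply: cvgM => //; apply: cvg_at_left_filter; exact: exprn_continuous.
Qed.

Lemma exp_kernel_lty_near0 (m : R) : 0 < m < s ->
  (\int[leb]_(v in `]0%R, m[) (K v)%:E < +oo)%E.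
Proof.
move=> /andP[m0 ms]; have [M [d [d0 Md]]] := G_near0.
pose e := Num.min d (Num.min (p 0%N / 2) (m / 2)).
have e0 : 0 < e by rewrite !lt_min d0 !divr_gt0.
have ed : e <= d by rewrite /e ge_min lexx.
have ep : e <= p 0%N / 2 by rewrite /e !ge_min lexx !orbT.
have em : e < m.
  by apply: (@le_lt_trans _ _ (m / 2)); [rewrite /e !ge_min lexx !orbT|lra].
have es : e < s by exact: lt_trans ms.
have K0' : {in `]0, m[, forall v, 0 <= K v}.
  move=> v; rewrite in_itv/= => /andP[v0 vm]; apply: K_ge0.
  by rewrite in_itv/= v0 (lt_trans vm).
rewrite (integral_oo_split e0 em (continuous_oo_sub (lexx 0) (ltW ms) exp_kernel_cont) K0').
rewrite lte_add_pinfty//; last exact: (integral_cc_lty e0 (ltW em) ms exp_kernel_cont K_ge0).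
apply: (@le_lt_trans _ _ (expR (- M) / (lam * (p 0%N / 2)) * (e - 0))%:E); last exact: ltry.
apply: integral_le_cst; first exact: ltW.
  exact: (continuous_oo_sub (lexx 0) (ltW es) exp_kernel_cont).
move=> v; rewrite in_itv/= => /andP[v0 ve].
rewrite K_ge0/=; last by rewrite in_itv/= v0 (lt_trans ve).
have lp : 0 < lam * (p 0%N / 2) by rewrite mulr_gt0// divr_gt0.
apply: ler_pM; rewrite ?expR_ge0//.
- by rewrite invr_ge0 ltW// D_gt0// in_itv/= v0 (lt_le_trans (lt_trans ve es)).
- by rewrite ler_expR lerN2 Md// v0 (lt_le_trans ve).
- rewrite lef_pV2 ?posrE//; last by rewrite D_gt0// in_itv/= v0 (lt_le_trans (lt_trans ve es)).
  by apply: (branching_drift_near0 lam_gt0 p_distr); rewrite (ltW v0) (le_trans (ltW ve)).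
Qed.

Lemma exp_kernel_lty_tail (m k e1 : R) : 0 < m < s -> 0 < k ->
  {in `]m, s[, forall v, k <= N q v} -> E x @[x --> s^'-] --> e1 ->
  (\int[leb]_(v in `]m, s[) (K v)%:E < +oo)%E.
Proof.
move=> /andP[m0 ms] k0 Nk Es.
have sub v : v \in `]m, s[ -> v \in `]0, s[.
  by rewrite !in_itv/= => /andP[mv ->]; rewrite (lt_trans m0).
have dB : antiderivative (fun v => - E v) (fun v => N q v * K v) m s.
  move=> v /sub vs; have := is_deriveN (exp_derive dG vs); rewrite opprK.
  by rewrite /drift_ratio /exp_kernel mulrAC mulrA.
have Em : - E x @[x --> m^'+] --> - E m.
  apply: cvgN; apply: cvg_at_right_filter; apply: exp_cont.
  by rewrite in_itv/= m0.
have EsN : - E x @[x --> s^'-] --> - e1 by exact: cvgN.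
apply: (balance_kernel_lty r_distr (ltW m0) s1 ms k0 Nk _ _ dB Em EsN).
  by move=> v /sub; exact: exp_kernel_cont.
by move=> v /sub; exact: K_ge0.
Qed.

End ExponentialKernel.

(** * Passage probabilities from exponential kernels *)

Section HitFormulas.
Variables (R : realType) (lam mu : R) (p : nat -> R) (r : int -> R).
Hypotheses (lam_gt0 : 0 < lam) (mu_ge0 : 0 <= mu).
Hypotheses (p_distr : is_distribution p) (p0_gt0 : 0 < p 0%N) (p1_eq0 : p 1%N = 0).
Hypothesis r_distr : is_immigration_distribution r.
Local Notation N := (killing_balance mu r).
Local Notation c := (exit_rate lam mu).
Local Notation J := (jump_sum lam mu p r).
Local Notation leb := (@lebesgue_measure R).
Local Notation vp := (varphi p).
Local Notation D := (branching_drift lam p).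
Local Notation ratio := (drift_ratio lam mu p r).
Local Notation K := (exp_kernel lam p).
Local Notation hit := (hit_fine lam mu p r).
Let vp0 : 0 < vp. Proof. exact: varphi_gt0. Qed.
Let vp1 : vp <= 1. Proof. exact: varphi_le1. Qed.
Let D_gt0 v : v \in `]0, vp[ -> 0 < D v. Proof. exact: branching_drift_gt0. Qed.

Lemma exp_cvg0_r (G : R -> R) (m u : R) :
  (forall M, exists2 w, w \in `]m, u[ & forall v, w <= v < u -> M <= G v) ->
  expR (- G x) @[x --> u^'-] --> (0 : R).
Proof.
move=> H; apply/cvgrPdist_le => e e0.
have [w wmu Hw] := H (- ln e); near=> x.
rewrite sub0r normrN ger0_norm ?expR_ge0// -[leRHS]lnK ?posrE// ler_expR.
rewrite lerNl; apply: Hw; apply/andP; split.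
  near: x; apply: nbhs_left_ge; by move: wmu; rewrite in_itv/= => /andP[].
by near: x; exact: nbhs_left_lt.
Unshelve. all: by end_near. Qed.

Lemma exp_kernel_vanish q (G : R -> R) (m k : R) :
  antiderivative G (ratio q) 0 vp -> 0 < m < vp -> 0 < k ->
  {in `]m, vp[, forall v, k <= N q v} ->
  expR (- G x) @[x --> vp^'-] --> (0 : R).
Proof.
move=> dG /andP[m0 mv] k0 Nk; apply: (@exp_cvg0_r _ m).
apply: (antiderivative_unbounded_r mv (divr_gt0 k0 lam_gt0)).
  exact: antiderivative_sub (ltW m0) (lexx _) dG.
move=> v vm; have v0 : v \in `]0, vp[.
  by move: vm; rewrite !in_itv/= => /andP[mv' ->]; rewrite (lt_trans m0).
have vv : 0 < vp - v by move: vm; rewrite in_itv/= subr_gt0 => /andP[].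
rewrite /drift_ratio -mulrA -invfM ler_pM ?(ltW k0)//.
- by rewrite invr_ge0 mulr_ge0// ltW.
- exact: Nk.
- rewrite lef_pV2 ?posrE ?D_gt0 ?(mulr_gt0 lam_gt0 vv)//.
  exact: branching_drift_le.
Qed.

(** An exponent bounded above near 1 leaves a kernel of order 1 / (1 - v). *)
Lemma exp_kernel_pinfty (G : R -> R) (m M : R) : vp = 1 -> 0 < m < 1 ->
  {in `]0, 1[, continuous (K G)} -> {in `]m, 1[, forall v, G v <= M} ->
  (\int[leb]_(v in `]0%R, 1%R[) (K G v)%:E = +oo)%E.
Proof.
move=> vpE /andP[m0 m1] cK GM.
have Dgt0 v : v \in `]0, 1[ -> 0 < D v by rewrite -{1}vpE; exact: D_gt0.
have K0 : {in `]0, 1[, forall v, 0 <= K G v}.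
  by move=> v v01; rewrite divr_ge0 ?expR_ge0// ltW// Dgt0.
have k0 : 0 < expR (- M) / lam by rewrite divr_gt0// expR_gt0.
have cKm := continuous_oo_sub (ltW m0) (lexx 1) cK.
have pole : {in `]m, 1[, forall v, expR (- M) / lam / (1 - v) <= K G v}.
  move=> v vm; have v1 : 0 < 1 - v by move: vm; rewrite in_itv/= subr_gt0 => /andP[].
  have v01 : v \in `]0, 1[.
    by move: vm; rewrite !in_itv/= => /andP[mv ->]; rewrite (lt_trans m0).
  rewrite /exp_kernel -mulrA -invfM ler_pM ?expR_ge0//.
  - by rewrite invr_ge0 mulr_ge0// ltW.
  - by rewrite ler_expR lerN2 GM.
  - rewrite lef_pV2 ?posrE ?Dgt0 ?(mulr_gt0 lam_gt0 v1)//.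
    by rewrite -vpE; apply: branching_drift_le => //; rewrite vpE.
have := integral_oo_subset (ltW m0) (lexx 1) cK K0.
by rewrite (integral_pinfty_pole m1 k0 cKm pole) leye_eq => /eqP.
Qed.

(** When varphi = 1 and q = 0, an integrable kernel forces the exponential to
    vanish at 1. *)
Lemma exp_kernel_vanish_integrable (G : R -> R) (m : R) : vp = 1 ->
  antiderivative G (ratio 0) 0 1 -> 0 < m < 1 ->
  {in `]m, 1[, forall v, 0 <= N 0 v} -> {in `]0, 1[, continuous (K G)} ->
  (\int[leb]_(v in `]0%R, 1%R[) (K G v)%:E < +oo)%E ->
  expR (- G x) @[x --> 1^'-] --> (0 : R).
Proof.
move=> vpE dG m01 N0 cK Kfin; apply: (@exp_cvg0_r _ m) => M.
have /andP[m0 m1] := m01.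
have ratio0 : {in `]m, 1[, forall v, 0 <= ratio 0 v}.
  move=> v vm; rewrite divr_ge0 ?N0// ltW// D_gt0// vpE.
  by move: vm; rewrite !in_itv/= => /andP[mv ->]; rewrite (lt_trans m0).
have ndG := antiderivative_nondecreasing (antiderivative_sub (ltW m0) (lexx 1) dG) ratio0.
have [[w wm Mw]|H] := pselect (exists2 w, w \in `]m, 1[ & M <= G w).
  exists w => // v /andP[wv v1]; apply: (le_trans Mw); apply: ndG => //.
  by move: wm; rewrite !in_itv/= => /andP[mw _]; rewrite v1 (lt_le_trans mw).
have GM : {in `]m, 1[, forall v, G v <= M}.
  by move=> v vm; rewrite leNgt; apply/negP => /ltW GM; apply: H; exists v.
by move: Kfin; rewrite (exp_kernel_pinfty vpE m01 cK GM) ltxx.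
Qed.

Section Positive.
Variables (q : R) (G : R -> R).
Hypothesis q_ge0 : 0 <= q.
Hypothesis dG : antiderivative G (ratio q) 0 vp.
Hypothesis G_near0 : bounded_below_near0 G.
Hypothesis E_vp : expR (- G x) @[x --> vp^'-] --> (0 : R).
Hypothesis K_fin : (\int[leb]_(v in `]0%R, vp[) (K G v)%:E < +oo)%E.
Local Notation I := (power_moment (K G) 0 vp).

Let cK : {in `]0, vp[, continuous (K G)}.
Proof. exact: (exp_kernel_cont lam_gt0 p_distr p0_gt0 p1_eq0 (lexx vp) dG). Qed.

Let K_gt0 : {in `]0, vp[, forall v, 0 < K G v}.
Proof. by move=> v vs; rewrite divr_gt0 ?expR_gt0// D_gt0. Qed.

Let K_ge0 : {in `]0, vp[, forall v, 0 <= K G v}.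
Proof. by move=> v /K_gt0 /ltW. Qed.

Let pow01 v n : v \in `]0, vp[ -> 0 < v ^+ n <= 1.
Proof.
rewrite in_itv/= => /andP[v0 vv]; have v1 : v <= 1 by exact: le_trans (ltW vv) vp1.
by rewrite exprn_gt0//= exprn_ile1// ltW.
Qed.

Lemma exp_moment_fin n : I n \is a fin_num.
Proof. exact: power_moment_fin. Qed.

Lemma exp_moment_gt0 n : 0 < fine (I n).
Proof.
rewrite -lte_fin fineK ?exp_moment_fin//; apply: integral_oo_gt0 => //.
  exact: power_kernel_cont.
by move=> v vs; rewrite mulr_gt0 ?K_gt0//; case/andP: (pow01 n vs).
Qed.

Lemma exp_moment_lt n : (0 < n)%N -> fine (I n) < fine (I 0%N).
Proof.
move=> n0; rewrite -lte_fin !fineK ?exp_moment_fin//.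
have c1 : {in `]0, vp[, continuous (fun v => K G v * (1 - v ^+ n))}.
  move=> v vs; apply: cvgM; first exact: cK.
  by apply: cvgB; [exact: cvg_cst|exact: exprn_continuous].
have p1' : {in `]0, vp[, forall v, 0 < K G v * (1 - v ^+ n)}.
  move=> v vs; rewrite mulr_gt0 ?K_gt0// subr_gt0.
  move: vs; rewrite in_itv/= => /andP[v0 vv].
  by rewrite exprn_ilt1 ?ltW// -?lt0n ?(lt_le_trans vv)// gt_eqF.
have := integral_oo_gt0 vp0 c1 p1'.
have -> : I 0%N = (I n + \int[leb]_(v in `]0%R, vp[) (K G v * (1 - v ^+ n))%:E)%E.
  rewrite /power_moment -ge0_integralD//.
  - by apply: eq_integral => v _; rewrite -EFinD expr0; congr (_%:E); ring.
  - by move=> v /= vs; rewrite lee_fin mulr_ge0 ?K_ge0//; case/andP: (pow01 n vs) => /ltW.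
  - by apply/measurable_EFinP; apply: continuous_oo_measurable; exact: power_kernel_cont.
  - by move=> v /= vs; rewrite lee_fin ltW// p1'.
  - by apply/measurable_EFinP; exact: continuous_oo_measurable.
by rewrite lteDl// exp_moment_fin.
Qed.

Lemma exp_moment_eventually0 : eventually_le (fun n => fine (I n)) (fun=> 0).
Proof. exact: power_moment_eventually0. Qed.

Lemma hit_exp_kernel a x : (a <= x)%N -> hit a q x = fine (I x) / fine (I a).
Proof.
apply: (hit_harmonicE lam_gt0 mu_ge0 p_distr p0_gt0 r_distr (Phi := fun n => fine (I n)) q_ge0).
- by move=> n; apply: ltW; exact: exp_moment_gt0.
- exact: exp_moment_gt0.
- move=> i ai; have i0 : (0 < i)%N by exact: leq_ltn_trans ai.
  have -> : (EFin \o (fun n => fine (I n))) = I.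
    by apply/funext => n /=; rewrite fineK ?exp_moment_fin.
  rewrite (exp_moment_harmonic lam_gt0 mu_ge0 p_distr p0_gt0 p1_eq0 r_distr q_ge0 vp0 (lexx
      vp) dG G_near0 i0 E_vp).
  by rewrite mul0r adde0 EFinM fineK ?exp_moment_fin.
- exact: exp_moment_eventually0.
Qed.

End Positive.

(** Recurrence: the moments over ]0, s[ are subharmonic, hence at most [hit]
    times their value at [a]. As s tends to 1 they diverge because of the mass
    near 1, where v^x and v^a are close: [hit < 1] would keep them bounded. *)
Lemma hit_certain (G : R -> R) a x : vp = 1 -> antiderivative G (ratio 0) 0 1 ->
  bounded_below_near0 G -> (\int[leb]_(v in `]0%R, 1%R[) (K G v)%:E = +oo)%E ->
  (a <= x)%N -> hit a 0 x = 1.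
Proof.
move=> vpE dG G0 Kinf ax.
have dG' : antiderivative G (ratio 0) 0 vp by rewrite vpE.
have cK : {in `]0, 1[, continuous (K G)}.
  rewrite -{1}vpE; exact: (exp_kernel_cont lam_gt0 p_distr p0_gt0 p1_eq0 (lexx vp) dG').
have K0 : {in `]0, 1[, forall v, 0 <= K G v}.
  by rewrite -{1}vpE => v vs; rewrite divr_ge0 ?expR_ge0// ltW// D_gt0.
have hit1 : hit a 0 x <= 1.
  by rewrite -lee_fin hit_fineK// hit_le1.
have hit0 : 0 <= hit a 0 x by exact: hit_fine_ge0.
apply/eqP; rewrite eq_le hit1/=; apply/ler_addgt0Pl => e e0.
rewrite leNgt; apply/negP => lt.
pose I (s : R) := power_moment (K G) 0 s.
have sub (s : R) : s < 1 -> {subset `]0, s[ <= `]0, 1[}.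
  by move=> s1 v; rewrite !in_itv/= => /andP[-> vs]; rewrite (lt_trans vs).
have cKs (s : R) : s < 1 -> {in `]0, s[, continuous (K G)} by move=> s1 v /(sub s s1); exact: cK.
have K0s (s : R) : s < 1 -> {in `]0, s[, forall v, 0 <= K G v} by move=> s1 v /(sub s s1);
    exact: K0.
have Klt (s : R) : 0 < s < 1 -> (\int[leb]_(v in `]0%R, s[) (K G v)%:E < +oo)%E.
  move=> s01; apply: (exp_kernel_lty_near0 lam_gt0 p_distr p0_gt0 p1_eq0 (lexx vp) dG' G0).
  by rewrite vpE.
have Ifin (s : R) n : 0 < s < 1 -> I s n \is a fin_num.
  move=> s01; have /andP[_ s1] := s01.
  by apply: power_moment_fin; [|exact: ltW|exact: cKs|exact: K0s|exact: Klt].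
have sub_bound (s : R) : 0 < s < 1 -> fine (I s x) <= fine (I s a) * hit a 0 x.
  move=> s01; have /andP[s0 s1] := s01.
  apply: (hit_lower lam_gt0 mu_ge0 p_distr p0_gt0 r_distr (lexx 0) (F := fun n => fine (I s
      n))) => //.
  - by move=> n; apply: fine_ge0; apply: power_moment_ge0 => //; exact: K0s.
  - move=> i ai; have i0 : (0 < i)%N by exact: leq_ltn_trans ai.
    have -> : (EFin \o (fun n => fine (I s n))) = I s.
      by apply/funext => n /=; rewrite fineK ?Ifin.
    have svp : s <= vp by rewrite vpE ltW.
    have Es : expR (- G y) @[y --> s^'-] --> expR (- G s).
      apply: cvg_at_left_filter; apply: (antiderivative_continuous (exp_derive dG)).
      by rewrite in_itv/= s0.
    rewrite (exp_moment_harmonic lam_gt0 mu_ge0 p_distr p0_gt0 p1_eq0 r_distr (lexx 0) s0 svp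
      (antiderivative_sub (lexx 0) svp dG') G0 i0 Es).
    by rewrite EFinM fineK ?Ifin// leeDl// lee_fin mulr_ge0 ?expR_ge0// exprn_ge0// ltW.
  - by apply: power_moment_eventually0; [|exact: ltW|exact: cKs|exact: K0s|exact: Klt].
(* above [m] the power [v ^ x] is at least [(1 - e / 2) * v ^ a] *)
have [m /andP[m0 m1] Hm] : exists2 m : R, 0 < m < 1 &
    forall v, m <= v < 1 -> 1 - e / 2 <= v ^+ (x - a).
  have /cvgrPdist_lt /(_ (e / 2)) := @exprn_continuous R (x - a) 1.
  rewrite divr_gt0// => /(_ isT) [d /= d0 Hd].
  exists (Num.max (1 / 2) (1 - d / 2)).
    rewrite lt_max divr_gt0//= gt_max.
    by apply/andP; split; lra.
  move=> v /andP[]; rewrite ge_max => /andP[v2 vd] v1.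
  have := Hd v; rewrite /= expr1n ger0_norm ?subr_ge0 ?(ltW v1)//.
  have -> : 1 - v < d by lra.
  move=> /(_ isT); rewrite ltr_norml => /andP[_]; lra.
(* the bound kept by all moments of order [a] if [hit] were below [1 - e] *)
pose C := fine (I m a) * (1 + 2 / e).
have Cbound (s : R) : m < s < 1 -> fine (I s a) <= C.
  move=> /andP[ms s1]; have s01 : 0 < s < 1 by rewrite (lt_trans m0).
  have m01 : 0 < m < 1 by rewrite m0.
  have splitI n : I s n = (I m n + \int[leb]_(v in `]m, s[) (K G v * v ^+ n)%:E)%E.
    apply: integral_oo_split => //; first by apply: power_kernel_cont; exact: cKs.
    move=> v vs; apply: mulr_ge0; first exact: (K0s s s1).
    rewrite exprn_ge0//.
    by move: vs; rewrite in_itv/= => /andP[/ltW].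
  have tailfin n : (\int[leb]_(v in `]m, s[) (K G v * v ^+ n)%:E)%E \is a fin_num.
    have := Ifin s n s01; rewrite splitI fin_numD => /andP[_].
    by [].
  set t := fun n => fine (\int[leb]_(v in `]m, s[) (K G v * v ^+ n)%:E)%E.
  have IE n : fine (I s n) = fine (I m n) + t n.
    by rewrite splitI fineD ?Ifin ?tailfin.
  have cKms : {in `]m, s[, continuous (K G)} by exact: (continuous_oo_sub (ltW m0) (lexx s)
      (cKs s s1)).
  have vms v : v \in `]m, s[ -> [/\ 0 < v, v < 1, m <= v & 0 <= K G v].
    rewrite in_itv/= => /andP[mv vs]; have v0 : 0 < v by exact: lt_trans mv.
    split=> //; [exact: lt_trans s1|exact: ltW|].
    by apply: (K0s s s1); rewrite in_itv/= v0.
  have t_ge0 n : 0 <= t n.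
    apply: fine_ge0; apply: integral_ge0 => v /= /vms[v0 _ _ Kv].
    by rewrite lee_fin mulr_ge0// exprn_ge0// ltW.
  have e2 : 0 <= 1 - e / 2 by move: lt hit0; lra.
  have tx : (1 - e / 2) * t a <= t x.
    rewrite -lee_fin EFinM !fineK ?tailfin// -ge0_integralZl//; last 2 first.
    - by apply/measurable_EFinP; apply: continuous_oo_measurable; exact: power_kernel_cont.
    - by move=> v /= /vms[v0 _ _ Kv]; rewrite lee_fin mulr_ge0// exprn_ge0// ltW.
    under eq_integral do rewrite -EFinM.
    apply: integral_oo_le.
    - move=> v vs; apply: cvgM; first exact: cvg_cst.
      exact: (@power_kernel_cont _ (K G) m s a cKms v vs).
    - exact: power_kernel_cont.
    - move=> v vs; have [v0 v1 mv Kv] := vms v vs.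
      have va0 : 0 <= v ^+ a by rewrite exprn_ge0// ltW.
      have KV : 0 <= K G v * v ^+ a by exact: mulr_ge0.
      have -> : 0 <= (1 - e / 2) * (K G v * v ^+ a) by exact: mulr_ge0.
      rewrite /= mulrCA; apply: ler_wpM2l => //.
      rewrite -[in leRHS](subnK ax) exprD; apply: ler_wpM2r => //.
      by apply: Hm; rewrite mv.
  have I_ge0 n : 0 <= fine (I m n).
    by apply: fine_ge0; apply: power_moment_ge0 => //; exact: K0s.
  have := sub_bound s s01; rewrite !IE => h2.
  have h3 : fine (I m a) * hit a 0 x <= fine (I m a) by rewrite ler_piMr.
  have h4 : t a * hit a 0 x <= t a * (1 - e) by rewrite ler_wpM2l//; move: lt; lra.
  have h5 : t a * (e / 2) <= fine (I m a).
    by have := I_ge0 x; move: tx h2 h3 h4; lra.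
  rewrite /C mulrDr mulr1 lerD2l.
  by rewrite mulrA ler_pdivlMr// mulrC; move: h5; lra.
have cKa : {in `]0, 1[, continuous (fun v => K G v * v ^+ a)} by exact: power_kernel_cont.
have Ka0 : {in `]0, 1[, forall v, 0 <= K G v * v ^+ a}.
  move=> v v01; rewrite mulr_ge0 ?K0// exprn_ge0//.
  by move: v01; rewrite in_itv/= => /andP[/ltW].
have total : (\int[leb]_(v in `]0%R, 1%R[) (K G v * v ^+ a)%:E <= C%:E)%E.
  have cvI := improper_integral_cvg ltr01 cKa Ka0.
  rewrite -(cvg_lim (@ereal_hausdorff R) cvI); apply: lime_le; first exact: cvgP cvI.
  apply: nearW => n; have [ln lun un] := exhaustP n (@ltr01 R).
  pose s := (Num.max (exhaust_u 0 1 n) m + 1) / 2.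
  have mu1 : Num.max (exhaust_u 0 1 n) m < 1 by rewrite gt_max un.
  have s1 : s < 1 by rewrite /s; lra.
  have us : exhaust_u 0 1 n < s.
    have : exhaust_u 0 1 n <= Num.max (exhaust_u 0 1 n) m by rewrite le_max lexx.
    by rewrite /s; lra.
  have ms : m < s.
    have : m <= Num.max (exhaust_u 0 1 n) m by rewrite le_max lexx orbT.
    by rewrite /s; lra.
  have s01 : 0 < s < 1 by rewrite (lt_trans m0).
  apply: (@le_trans _ _ (I s a)); last first.
    by rewrite -[X in (X <= _)%E]fineK ?Ifin// lee_fin Cbound// ms.
  apply: ge0_subset_integral => //.
  - by apply/measurable_EFinP; apply: continuous_oo_measurable; apply: power_kernel_cont;
      exact: cKs.
  - by move=> v /= /(sub s s1) /Ka0; rewrite lee_fin.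
  - exact: itv_cc_sub_oo.
have near0 : (\int[leb]_(v in `]0%R, m[) (K G v)%:E < +oo)%E by apply: Klt; rewrite m0.
suff far : (\int[leb]_(v in `]m, 1%R[) (K G v)%:E < +oo)%E.
  have := integral_oo_split m0 m1 cK K0; rewrite Kinf => E.
  by have := lte_add_pinfty near0 far; rewrite -E ltxx.
have ma : 0 < m ^+ a by rewrite exprn_gt0.
have cK1 := continuous_oo_sub (ltW m0) (lexx 1) cK.
apply: (@le_lt_trans _ _ (\int[leb]_(v in `]m, 1%R[) ((m ^+ a)^-1 * (K G v * v ^+ a))%:E)%E).
  apply: integral_oo_le => //.
    move=> v v1; apply: cvgM; first exact: cvg_cst.
    exact: (@power_kernel_cont _ (K G) m 1 a cK1 v v1).
  move=> v; rewrite in_itv/= => /andP[mv v1].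
  have v0 : 0 < v by exact: lt_trans mv.
  have Kv : 0 <= K G v by rewrite K0// in_itv/= v0.
  rewrite Kv/= mulrCA ler_peMr// ler_pdivlMl// mulr1.
  by rewrite lerXn2r ?nnegrE ?(ltW m0) ?(ltW v0)// ltW.
under eq_integral do rewrite EFinM.
rewrite ge0_integralZl//.
- rewrite lte_mul_pinfty// ?lee_fin ?invr_ge0 ?(ltW ma)//.
  apply: le_lt_trans (ltry C); apply: le_trans total.
  exact: (integral_oo_subset (ltW m0) (lexx 1) cKa Ka0).
- by apply/measurable_EFinP; apply: continuous_oo_measurable; exact: power_kernel_cont.
- move=> v /=; rewrite in_itv/= => /andP[mv v1].
  by rewrite lee_fin Ka0// in_itv/= v1 (lt_trans m0).
- by rewrite lee_fin invr_ge0 ltW.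
Qed.

(** At a common zero of the drift and the killing balance, the powers of varphi
    are harmonic. *)
Lemma hit_power q a x : 0 <= q -> N q vp = 0 -> vp < 1 -> (a <= x)%N ->
  hit a q x = vp ^+ x / vp ^+ a.
Proof.
move=> q0 Nq v1 ax.
apply: (hit_harmonicE lam_gt0 mu_ge0 p_distr p0_gt0 r_distr (Phi := fun n => vp ^+ n) q0) => //.
- by move=> n; rewrite exprn_ge0// ltW.
- by rewrite exprn_gt0.
- move=> i ai; have i0 : (0 < i)%N by exact: leq_ltn_trans ai.
  rewrite [LHS](jump_sum_power_balance lam_gt0 mu_ge0 p_distr r_distr q) ?vp0//.
  have [_ _ vpE _] := varphiP p_distr p0_gt0 p1_eq0.
  by rewrite Nq /branching_drift vpE subrr !mulr0 mul0r subr0 addr0.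
- apply: cvg0_eventually_le; apply: cvg_expr.
  by rewrite ger0_norm// ltW.
Qed.

End HitFormulas.

(** * Passage transforms in terms of Phi *)

Section HitPotential.
Variables (R : realType) (lam mu : R) (p : nat -> R) (r : int -> R).
Hypotheses (lam_gt0 : 0 < lam) (mu_ge0 : 0 <= mu).
Hypotheses (p_distr : is_distribution p) (p0_gt0 : 0 < p 0%N) (p1_eq0 : p 1%N = 0).
Hypothesis r_distr : is_immigration_distribution r.
Local Notation N := (killing_balance mu r).
Local Notation leb := (@lebesgue_measure R).
Local Notation vp := (varphi p).
Local Notation D := (branching_drift lam p).
Local Notation ratio := (drift_ratio lam mu p r).
Local Notation K := (exp_kernel lam p).
Local Notation hit := (hit_fine lam mu p r).
Let vp0 : 0 < vp. Proof. exact: varphi_gt0. Qed.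
Let vp1 : vp <= 1. Proof. exact: varphi_le1. Qed.
Let D_gt0 v : v \in `]0, vp[ -> 0 < D v. Proof. exact: branching_drift_gt0. Qed.

Lemma eq_oriented_integral (c v l u : R) (f g : R -> R) : l <= c < u -> l < v < u ->
  {in `]l, u[, f =1 g} -> oriented_integral c v f = oriented_integral c v g.
Proof.
move=> /andP[lc cu] /andP[lv vu] fg; rewrite /oriented_integral.
have E (a b : R) : l <= a -> b < u -> (\int[leb]_(w in `]a, b[) (f w)%:E = \int[leb]_(w in
    `]a, b[) (g w)%:E)%E.
  move=> la bu; apply: eq_integral => w /set_mem /=; rewrite in_itv/= => /andP[aw wb].
  by rewrite fg// in_itv/= (le_lt_trans la aw) (lt_trans wb bu).
by rewrite !E// ltW.
Qed.

(** The killing balance is at most q + mu, and the drift stays away from 0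
    near 0, so no exponent can diverge to -oo at 0. *)
Lemma drift_exponent_bounded q (G : R -> R) : 0 <= q ->
  antiderivative G (ratio q) 0 vp -> bounded_below_near0 G.
Proof.
move=> q0 dG; pose d := p 0%N / 2; pose C := (q + mu) / (lam * d).
have d0 : 0 < d by rewrite divr_gt0.
have dv : d < vp by exact: varphi_gt_half_p0.
have qm0 : 0 <= q + mu by rewrite addr_ge0.
have C0 : 0 <= C by rewrite divr_ge0// mulr_ge0// ltW.
pose e := d / 2.
have [e0 ed] : 0 < e /\ e < d by rewrite /e; lra.
exists (G e - C * e), e; split => // v /andP[v0 ve].
have dL : antiderivative (fun v => C * v) (fun=> C) 0 d.
  move=> x _; have := is_deriveZ C (is_derive_id x (1 : R)).
  by rewrite /GRing.scale/= mulr1.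
have le : {in `]0, d[, forall x, ratio q x <= C}.
  move=> x; rewrite in_itv/= => /andP[x0 xd].
  have xv : x < vp by exact: lt_trans dv.
  have Dx : 0 < D x by rewrite D_gt0// in_itv/= x0.
  have x1 : x <= 1 by rewrite (le_trans (ltW xv)).
  apply: (@le_trans _ _ ((q + mu) / D x)).
    by rewrite ler_pM2r ?invr_gt0// killing_balance_le// x0.
  apply: ler_wpM2l => //; rewrite lef_pV2 ?posrE ?(mulr_gt0 lam_gt0 d0)//.
  by apply: (branching_drift_near0 lam_gt0 p_distr); rewrite (ltW x0) ltW.
have := antiderivative_le (antiderivative_sub (lexx 0) (ltW dv) dG) dL le.
move=> /(_ v e); rewrite !in_itv/= v0 (lt_trans ve ed) e0 ed (ltW ve).
move=> /(_ isT isT isT) h.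
have : 0 <= C * v by rewrite mulr_ge0// ltW.
by move: h; lra.
Qed.

(** If [phi = 0], any exponent is nondecreasing and bounded below near 0, so it
    has a limit at 0 and can be based there. *)
Lemma drift_exponent q : 0 <= q -> 0 < q \/ 0 < mu -> phi mu r q < vp ->
  exists2 G, antiderivative G (ratio q) 0 vp
    & forall v, v \in `]0, vp[ -> oriented_integral (phi mu r q) v (ratio q) = (G v)%:E.
Proof.
move=> q0 qmu phiv.
have [/andP[phi0 _] _ _ Npos _] := killing_balance_phi mu_ge0 r_distr q0.
have cr := drift_ratio_cont (mu := mu) lam_gt0 p_distr p0_gt0 p1_eq0 r_distr (q := q).
have [G0 dG0] := antiderivative_exists vp0 cr.
have shift (e : R) : antiderivative (fun v => G0 v - e) (ratio q) 0 vp.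
  by move=> v /dG0 dv; rewrite -[ratio q v]subr0; apply: is_deriveB.
move: phi0; rewrite le_eqVlt => /predU1P[phiE|phi_gt0]; last first.
  exists (fun v => G0 v - G0 (phi mu r q)) => // v vv.
  by rewrite (oriented_antiderivative _ vv cr dG0)// in_itv/= phi_gt0.
have ratio0 : {in `]0, vp[, forall v, 0 <= ratio q v}.
  move=> v vs; rewrite divr_ge0 ?(ltW (D_gt0 vs))//.
  move: vs; rewrite in_itv/= => /andP[v0 vs].
  by rewrite ltW// Npos// -phiE v0 (lt_le_trans vs).
have nd := antiderivative_nondecreasing dG0 ratio0.
have [M [d [d0 Md]]] := drift_exponent_bounded q0 dG0.
have : cvg (G0 x @[x --> 0^'+]).
  apply: nondecreasing_at_right_is_cvgr.
    near=> x => y z; rewrite !in_itv/= => /andP[y0 yx] /andP[z0 zx] yz.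
    have xv : x < vp by near: x; exact: nbhs_right_lt.
    by apply: nd => //; rewrite in_itv/= ?y0 ?z0 (lt_trans _ xv).
  near=> x; have xd : x < d by near: x; exact: nbhs_right_lt.
  exists M => _ /= [y] + <-; rewrite in_itv/= => /andP[y0 yx].
  by apply: Md; rewrite y0 (lt_trans yx).
move=> /cvg_ex[e /= G0e]; exists (fun v => G0 v - e) => // v.
rewrite in_itv/= => vv; rewrite -phiE.
exact: (oriented_antiderivative_l vv cr ratio0 dG0 G0e).
Unshelve. all: by end_near. Qed.

Lemma rho_drift v : v \in `]0, vp[ -> rho lam p v = D v.
Proof.
move=> vv; rewrite /rho /D ger0_norm// ltW//.
by have := D_gt0 vv; rewrite pmulr_rgt0.
Qed.

Lemma gamma_drift q v : v \in `]0, vp[ -> gamma_ lam mu p r q v = ratio q v.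
Proof. by move=> vv; rewrite /gamma_ rho_drift. Qed.

Lemma gamma0_drift v : gamma0 lam mu p r v = ratio 0 v.
Proof. by rewrite /gamma0 /drift_ratio /killing_balance add0r. Qed.

Let in0vp (v : R) : v \in `]0, vp[ -> 0 < v < vp.
Proof. by rewrite in_itv. Qed.

Lemma Phi_pos_moment q G n : 0 <= phi mu r q < vp ->
  (forall v, v \in `]0, vp[ -> oriented_integral (phi mu r q) v (ratio q) = (G v)%:E) ->
  Phi_pos lam mu p r q n = q * fine (power_moment (K G) 0 vp n).
Proof.
move=> phiv GE; rewrite /Phi_pos; case/andP: (phiv) => _ ->; congr (_ * fine _).
apply: eq_integral => v /set_mem vv.
have gE : {in `]0, vp[, gamma_ lam mu p r q =1 ratio q} by move=> w; exact: gamma_drift.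
rewrite (eq_oriented_integral phiv (in0vp vv) gE).
by rewrite GE// rho_drift// -EFinN/= -EFinM /exp_kernel mulrAC mulrA.
Qed.

Lemma kernel0_exp G v : (forall v, v \in `]0, vp[ ->
    oriented_integral (phi mu r 0) v (ratio 0) = (G v)%:E) ->
  v \in `]0, vp[ -> kernel0 lam mu p r v = (K G v)%:E.
Proof.
move=> GE vv; rewrite /kernel0.
have -> : gamma0 lam mu p r = ratio 0 by apply/funext => w; exact: gamma0_drift.
by rewrite GE// -EFinN/= -EFinM.
Qed.

Lemma killing_balance_near_varphi q : 0 <= q -> 0 < N q vp ->
  exists m k, [/\ 0 < m < vp, 0 < k & {in `]m, vp[, forall v, k <= N q v}].
Proof.
move=> q0 Nq; have k0 : 0 < N q vp / 2 by rewrite divr_gt0.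
have vp2 : vp / 2 < vp by rewrite ltr_pdivrMr// ltr_pMr// ltr1n.
have [vplt|] := ltP vp 1; last first.
  move=> h; have vpE : vp = 1 by apply/eqP; rewrite eq_le vp1.
  move: Nq k0; rewrite vpE (killing_balance1 _ r_distr) => Nq k0.
  have [s /andP[s0 s1] Hs] := killing_balance_near1 mu_ge0 r_distr q k0.
  exists s, (q / 2); split; rewrite ?s0// => v.
  rewrite in_itv/= => /andP[sv v1].
  by have := Hs v; rewrite (ltW sv) v1 => /(_ isT); rewrite ler_norml; lra.
have := @killing_balance_cont _ mu r r_distr q vp.
rewrite vp0 vplt => /(_ isT) /cvgrPdist_lt /(_ _ k0) [d /= d0 Hd].
pose m := Num.max (vp / 2) (vp - d).
exists m, (N q vp / 2).
have mv : m < vp by rewrite gt_max vp2/=; lra.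
split=> //.
  by rewrite mv andbT (lt_le_trans (divr_gt0 vp0 (ltr0n _ 2)))// /m le_max lexx.
move=> v; rewrite in_itv/= => /andP[mv' vv].
have dv : vp - d < v by apply: le_lt_trans mv'; rewrite le_max lexx orbT.
have := Hd v; rewrite /= ger0_norm ?subr_ge0 ?(ltW vv)//.
have -> : vp - v < d by lra.
by move=> /(_ isT); rewrite ltr_norml; lra.
Qed.

Lemma exp_kernel_lty q (G : R -> R) : 0 <= q -> 0 < N q vp ->
  antiderivative G (ratio q) 0 vp ->
  (\int[leb]_(v in `]0%R, vp[) (K G v)%:E < +oo)%E /\
  (expR (- G x) @[x --> vp^'-] --> (0 : R)).
Proof.
move=> q0 Nq dG; have [m [k [mv k0 Nk]]] := killing_balance_near_varphi q0 Nq.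
have E0 := exp_kernel_vanish lam_gt0 p_distr p0_gt0 p1_eq0 dG mv k0 Nk.
split=> //; have /andP[m0 mv'] := mv.
have cK := exp_kernel_cont lam_gt0 p_distr p0_gt0 p1_eq0 (lexx vp) dG.
have K0 : {in `]0, vp[, forall v, 0 <= K G v}.
  by move=> v vs; rewrite divr_ge0 ?expR_ge0// ltW// D_gt0.
rewrite (integral_oo_split m0 mv' cK K0) lte_add_pinfty//.
  exact: (exp_kernel_lty_near0 lam_gt0 p_distr p0_gt0 p1_eq0 (lexx vp) dG
      (drift_exponent_bounded q0 dG) mv).
exact: (exp_kernel_lty_tail lam_gt0 p_distr p0_gt0 p1_eq0 r_distr (lexx vp) dG mv k0 Nk E0).
Qed.

Lemma phi_lt_varphi q : 0 <= q -> 0 < N q vp -> phi mu r q < vp.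
Proof.
move=> q0 Nq; have [/andP[phi0 _] Nneg Nphi _ _] := killing_balance_phi mu_ge0 r_distr q0.
rewrite ltNge; apply/negP; rewrite le_eqVlt => /predU1P[E|vphi].
  by move: Nphi Nq; rewrite -E => -> //; rewrite ltxx.
by have := Nneg vp; rewrite vp0 vphi => /(_ isT); rewrite ltNge (ltW Nq).
Qed.

Lemma phi_le_varphi q : 0 <= q -> (0 <= N q vp) = (phi mu r q <= vp).
Proof.
move=> q0; have [/andP[phi0 _] Nneg Nphi Npos _] := killing_balance_phi mu_ge0 r_distr q0.
apply/idP/idP => [Nq|].
  rewrite leNgt; apply/negP => vphi.
  by have := Nneg vp; rewrite vp0 vphi => /(_ isT); rewrite ltNge Nq.
rewrite le_eqVlt => /predU1P[E|phiv].
  by rewrite -E Nphi// E.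
have [vplt|] := ltP vp 1; last first.
  move=> h; have -> : vp = 1 by apply/eqP; rewrite eq_le vp1.
  by rewrite (killing_balance1 _ r_distr).
have [mu0|mu_gt0] : mu = 0 \/ 0 < mu.
- by move: mu_ge0; rewrite le_eqVlt => /predU1P[<-|]; [left|right].
- by rewrite /killing_balance mu0 mul0r addr0.
- by rewrite ltW// Npos ?phiv//; right.
Qed.

Lemma phi_lt_varphiE q : 0 < q -> (0 < N q vp) = (phi mu r q < vp).
Proof.
move=> q0; apply/idP/idP; first by apply: phi_lt_varphi; exact: ltW.
have [_ _ _ Npos _] := killing_balance_phi mu_ge0 r_distr (ltW q0).
move=> phiv; have [vplt|] := ltP vp 1; first by rewrite Npos ?phiv//; left.
move=> h; have -> : vp = 1 by apply/eqP; rewrite eq_le vp1.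
by rewrite (killing_balance1 _ r_distr).
Qed.

Definition passage_potential (q : R) (f : nat -> R) : Prop :=
  [/\ forall n, 0 < f n, forall n, (0 < n)%N -> f n < f 0%N,
      eventually_le f (fun=> 0)
    & forall a x, (a <= x)%N -> hit a q x = f x / f a].

Lemma exp_moment_potential q (G : R -> R) : 0 <= q ->
  antiderivative G (ratio q) 0 vp ->
  (\int[leb]_(v in `]0%R, vp[) (K G v)%:E < +oo)%E ->
  expR (- G x) @[x --> vp^'-] --> (0 : R) ->
  passage_potential q (fun n => fine (power_moment (K G) 0 vp n)).
Proof.
move=> q0 dG Kfin E0; have Gb := drift_exponent_bounded q0 dG.
split=> [n|n n0||a x ax].
- exact: (exp_moment_gt0 lam_gt0 p_distr p0_gt0 p1_eq0 dG Kfin).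
- exact: (exp_moment_lt lam_gt0 p_distr p0_gt0 p1_eq0 dG Kfin).
- exact: (exp_moment_eventually0 lam_gt0 p_distr p0_gt0 p1_eq0 dG Kfin).
- exact: (hit_exp_kernel lam_gt0 mu_ge0 p_distr p0_gt0 p1_eq0 r_distr q0 dG Gb E0 Kfin).
Qed.

Lemma hit_eventually0 q a : 0 < q -> 0 < N q vp -> eventually_le (hit a q) (fun=> 0).
Proof.
move=> q0 Nq e e0; have q0' := ltW q0.
have [|G dG _] := drift_exponent q0' _ (phi_lt_varphi q0' Nq); first by left.
have [Kfin E0] := exp_kernel_lty q0' Nq dG.
have [+ _ + fE] := exp_moment_potential q0' dG Kfin E0.
set f := (fun n => _) => f0 f_oo.
have [M HM] := f_oo (e * f a) (mulr_gt0 e0 (f0 a)).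
exists (maxn a M) => n; rewrite geq_max => /andP[an Mn].
by rewrite fE// ler_pdivrMr// add0r; have := HM n Mn; rewrite add0r.
Qed.

Lemma hit_Phi_pos q a x : 0 < q -> 0 <= N q vp -> (a <= x)%N ->
  hit a q x = Phi_pos lam mu p r q x / Phi_pos lam mu p r q a.
Proof.
move=> q0 Nq ax; have q0' := ltW q0.
have [/andP[phi0 _] _ Nphi _ phi1] := killing_balance_phi mu_ge0 r_distr q0'.
have [phiv|vphi] := ltP (phi mu r q) vp.
  have [|G dG GE] := drift_exponent q0' _ phiv; first by left.
  have [Kfin E0] := exp_kernel_lty q0' (etrans (phi_lt_varphiE q0) phiv) dG.
  have [_ _ _ ->//] := exp_moment_potential q0' dG Kfin E0.
  rewrite !(@Phi_pos_moment q G)// ?phi0//.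
  by rewrite invfM mulrACA divff ?mul1r// gt_eqF.
have phivp : phi mu r q = vp by apply/eqP; rewrite eq_le vphi -phi_le_varphi// Nq.
rewrite /Phi_pos phivp ltxx.
apply: (hit_power lam_gt0 mu_ge0 p_distr p0_gt0 p1_eq0 r_distr) => //.
- by rewrite -phivp Nphi// phivp.
- by rewrite -phivp phi1.
Qed.

(** If the balance is nonpositive up to varphi = 1 then the exponent decreases
    and the kernel is not integrable at 1. *)
Lemma hit_certain_nonpos a x : vp = 1 -> {in `]0, 1[, forall v, N 0 v <= 0} ->
  (a <= x)%N -> hit a 0 x = 1.
Proof.
move=> vpE N0.
have cr := drift_ratio_cont (mu := mu) lam_gt0 p_distr p0_gt0 p1_eq0 r_distr (q := 0).
have [G dG] := antiderivative_exists vp0 cr.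
have cK := exp_kernel_cont lam_gt0 p_distr p0_gt0 p1_eq0 (lexx vp) dG.
have Gb := drift_exponent_bounded (lexx 0) dG.
have Dgt0 v : v \in `]0, 1[ -> 0 < D v by rewrite -{1}vpE; exact: D_gt0.
have dG1 : antiderivative G (ratio 0) 0 1 by rewrite -vpE.
have cK1 : {in `]0, 1[, continuous (K G)} by rewrite -{1}vpE.
have dNG : antiderivative (fun v => - G v) (fun v => - ratio 0 v) 0 1.
  by move=> v /dG1 dv; exact: is_deriveN.
have ratio0 : {in `]0, 1[, forall v, 0 <= - ratio 0 v}.
  by move=> v vv; rewrite oppr_ge0 ler_pdivrMr ?Dgt0// mul0r N0.
have nd := antiderivative_nondecreasing dNG ratio0.
apply: (hit_certain lam_gt0 mu_ge0 p_distr p0_gt0 p1_eq0 r_distr vpE dG1 Gb).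
pose h : R := 1 / 2.
have h01 : 0 < h < 1 by rewrite /h; apply/andP; split; lra.
have /andP[h0 h1] := h01.
apply: (exp_kernel_pinfty lam_gt0 p_distr p0_gt0 p1_eq0 vpE h01 cK1 (M := G h)).
move=> v; rewrite in_itv/= => /andP[hv v1]; rewrite -lerN2.
by apply: nd (ltW hv); rewrite in_itv/= ?h0 ?v1 ?(lt_trans h0).
Qed.

(** The condition under which [Phi_zero] is given by the integral. *)
Definition Phi_zero_integral : bool := (0 < mu * (1 - rtilde r vp))
  || [&& 0 < mu, phi mu r 0 < 1, vp == 1 & (test_integral lam mu p r < +oo)%E].

Let N0E v : N 0 v = mu * (1 - rtilde r v). Proof. by rewrite /killing_balance add0r. Qed.

Lemma test_integral_exp G : vp = 1 -> (forall v, v \in `]0, vp[ ->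
    oriented_integral (phi mu r 0) v (ratio 0) = (G v)%:E) ->
  test_integral lam mu p r = (\int[leb]_(v in `]0%R, 1%R[) (K G v)%:E)%E.
Proof.
move=> vpE GE; apply: eq_integral => v /set_mem vv; apply: kernel0_exp => //.
by rewrite vpE.
Qed.

Lemma Phi_zero_potential : Phi_zero_integral ->
  exists2 f, passage_potential 0 f & forall n, Phi_zero lam mu p r n = mu * f n.
Proof.
move=> b.
have [[mu_gt0 phiv] H] : (0 < mu /\ phi mu r 0 < vp) /\ (0 < N 0 vp \/
    vp = 1 /\ (test_integral lam mu p r < +oo)%E).
  case/orP: b => [N0|/and4P[mu_gt0 phi1 /eqP vpE t]].
    have N0' : 0 < N 0 vp by rewrite N0E.
    split; last by left.
    split; last exact: phi_lt_varphi.
    by move: mu_ge0; rewrite le_eqVlt => /predU1P[mu0|//]; move: N0; rewrite -mu0 mul0r ltxx.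
  by rewrite vpE; split=> //; right.
have [|G dG GE] := drift_exponent (lexx 0) _ phiv; first by right.
have [Kfin E0] : (\int[leb]_(v in `]0%R, vp[) (K G v)%:E < +oo)%E /\
  (expR (- G x) @[x --> vp^'-] --> (0 : R)).
  case: H => [N0|[vpE t]]; first exact: exp_kernel_lty dG.
  move: t; rewrite (test_integral_exp vpE GE) vpE => t; split=> //.
  pose m := (1 + phi mu r 0) / 2.
  have [/andP[phi0 _] _ _ Npos _] := killing_balance_phi mu_ge0 r_distr (lexx 0).
  have [phim m1] : phi mu r 0 < m /\ m < 1 by move: phiv; rewrite vpE /m; lra.
  apply: (exp_kernel_vanish_integrable (mu := mu) (r := r) (m := m) lam_gt0 p_distr p0_gt0
      p1_eq0 vpE _ _ _ _ t).
  - by rewrite -vpE.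
  - by rewrite m1 (le_lt_trans phi0 phim).
  - move=> v; rewrite in_itv/= => /andP[mv v1]; rewrite ltW// Npos//; first by right.
    by rewrite (lt_trans phim).
  - by have := exp_kernel_cont lam_gt0 p_distr p0_gt0 p1_eq0 (lexx vp) dG; rewrite {1}vpE.
exists (fun n => fine (power_moment (K G) 0 vp n)); first exact: exp_moment_potential.
move=> n; rewrite /Phi_zero -/Phi_zero_integral b; congr (_ * fine _).
by apply: eq_integral => v /set_mem vv; rewrite (kernel0_exp GE).
Qed.

Lemma hit_zero_power a x : 0 <= N 0 vp -> ~~ Phi_zero_integral -> vp < 1 -> (a <= x)%N ->
  hit a 0 x = vp ^+ x / vp ^+ a.
Proof.
move=> N0 /norP[nN _] v1 ax.
apply: (hit_power lam_gt0 mu_ge0 p_distr p0_gt0 p1_eq0 r_distr) => //.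
by apply/eqP; rewrite eq_le N0 andbT leNgt N0E.
Qed.

Lemma hit_zero_certain a x : vp = 1 ->
  [\/ mu = 0, phi mu r 0 = 1 | test_integral lam mu p r = +oo%E] -> (a <= x)%N ->
  hit a 0 x = 1.
Proof.
move=> vpE H ax.
have [/andP[phi0 phi1] Nneg _ _ _] := killing_balance_phi mu_ge0 r_distr (lexx 0).
have [mu0|mu_neq0] := eqVneq mu 0.
  apply: hit_certain_nonpos => // v _; by rewrite N0E mu0 mul0r.
have [phiE|phi_neq1] := eqVneq (phi mu r 0) 1.
  apply: hit_certain_nonpos => // v; rewrite in_itv/= => v01.
  by rewrite ltW// Nneg// phiE.
have mu_gt0 : 0 < mu by rewrite lt_neqAle eq_sym mu_neq0.
have phiv : phi mu r 0 < vp by rewrite vpE lt_neqAle phi_neq1.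
have t : test_integral lam mu p r = +oo%E.
  by case: H => // E; move: mu_neq0 phi_neq1; rewrite E eqxx.
have [|G dG GE] := drift_exponent (lexx 0) _ phiv; first by right.
apply: (hit_certain lam_gt0 mu_ge0 p_distr p0_gt0 p1_eq0 r_distr vpE (G := G)) => //.
- by rewrite -vpE.
- exact: drift_exponent_bounded dG.
- by rewrite -(test_integral_exp vpE GE).
Qed.

Lemma Phi_zero_integralPn : ~~ Phi_zero_integral -> vp = 1 ->
  [\/ mu = 0, phi mu r 0 = 1 | test_integral lam mu p r = +oo%E].
Proof.
move=> /norP[_ nb] vpE.
have [/andP[_ phi1] _ _ _ _] := killing_balance_phi mu_ge0 r_distr (lexx 0).
move: nb; rewrite vpE eqxx/= !negb_and -!leNgt => /or3P[h|h|h].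
- by apply: Or31; apply/eqP; rewrite eq_le h.
- by apply: Or32; apply/eqP; rewrite eq_le phi1.
- by apply: Or33; apply/eqP; rewrite -leye_eq.
Qed.

Lemma hit_Phi_zero a x : 0 <= N 0 vp -> (a <= x)%N ->
  hit a 0 x = Phi_zero lam mu p r x / Phi_zero lam mu p r a.
Proof.
move=> N0 ax; have [b|nb] := boolP Phi_zero_integral.
  have [f [f0 _ _ fE] PE] := Phi_zero_potential b.
  have mu0 : mu != 0.
    by case/orP: b => [|/and4P[]]; last by [move=> /gt_eqF ->]; apply: contraTneq => ->;
        rewrite mul0r ltxx.
  by rewrite fE// !PE invfM mulrACA divff// mul1r.
rewrite /Phi_zero -/Phi_zero_integral (negbTE nb).
have [v1|v1] := ltP vp 1; first exact: hit_zero_power.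
have vpE : vp = 1 by apply/eqP; rewrite eq_le vp1.
by rewrite (hit_zero_certain vpE (Phi_zero_integralPn nb vpE) ax) vpE !expr1n divr1.
Qed.

Lemma hit_Phi q a x : 0 <= q -> 0 <= N q vp -> (a <= x)%N ->
  hit a q x = Phi lam mu p r q x / Phi lam mu p r q a.
Proof.
move=> q0 Nq ax; rewrite /Phi; have [q00|qn] := eqVneq q 0.
  by move: Nq; rewrite q00 => Nq; exact: hit_Phi_zero.
by apply: hit_Phi_pos => //; rewrite lt_neqAle eq_sym qn.
Qed.

(** Passage is certain only if neither formula is strictly decreasing: the
    moments are, and so are the powers of varphi < 1. *)
Lemma hit_certainP y : 0 <= N 0 vp -> (0 < y)%N -> hit 0 0 y = 1 <->
  vp = 1 /\ [\/ mu = 0, phi mu r 0 = 1 | test_integral lam mu p r = +oo%E].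
Proof.
move=> N0 y0; split=> [h|[vpE H]]; last exact: hit_zero_certain.
have nb : ~~ Phi_zero_integral.
  apply/negP => b; have [f [f0 fl _ fE] _] := Phi_zero_potential b.
  by move: h; rewrite fE// => h; have := fl y y0; rewrite -[ltLHS](divfK (lt0r_neq0 (f0
      0%N))) h mul1r ltxx.
have vpE : vp = 1.
  apply/eqP; rewrite eq_le vp1 leNgt; apply/negP => v1.
  move: h; rewrite hit_zero_power// expr0 divr1 => h.
  have : vp ^+ y < 1 by rewrite exprn_ilt1 ?(ltW vp0)// -lt0n.
  by rewrite h ltxx.
by split=> //; exact: Phi_zero_integralPn.
Qed.

End HitPotential.

(** * Escape transforms in terms of Psi *)

Section EscapePotential.
Variables (R : realType) (lam mu : R) (p : nat -> R) (r : int -> R).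
Hypotheses (lam_gt0 : 0 < lam) (mu_ge0 : 0 <= mu).
Hypotheses (p_distr : is_distribution p) (p0_gt0 : 0 < p 0%N) (p1_eq0 : p 1%N = 0).
Hypothesis r_distr : is_immigration_distribution r.
Local Notation N := (killing_balance mu r).
Local Notation c := (exit_rate lam mu).
Local Notation J := (jump_sum lam mu p r).
Local Notation leb := (@lebesgue_measure R).
Local Notation vp := (varphi p).
Local Notation D := (branching_drift lam p).
Local Notation ratio := (drift_ratio lam mu p r).
Local Notation K := (exp_kernel lam p).
Local Notation hit := (hit_fine lam mu p r).
Local Notation escape := (escape_fine lam mu p r).
Let vp0 : 0 < vp. Proof. exact: varphi_gt0. Qed.
Let vp1 : vp <= 1. Proof. exact: varphi_le1. Qed.
Let D_lt0 v : v \in `]vp, 1[ -> 0 < - D v.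
Proof. by move=> vv; rewrite oppr_gt0; exact: (branching_drift_lt0 lam_gt0 p_distr p0_gt0
    p1_eq0). Qed.
Let sub01 : {subset `]vp, 1[ <= `]0, 1[}.
Proof. by apply: itv_sub01; [exact: ltW|exact: lexx]. Qed.

Lemma drift_inv_cont : {in `]vp, 1[, continuous (fun v => (- D v)^-1)}.
Proof.
move=> v vv; apply: cvgV; first by rewrite gt_eqF// D_lt0.
by apply: cvgN; apply: (branching_drift_cont p_distr); exact: sub01.
Qed.

(** The flow dv/dt = branching_drift v takes finite time to come down from 1:
    the explosion criterion of the branching process, with [F] in place of the
    integral of 1 / |branching_drift| near 1. *)
Definition finite_drift_time : Prop := vp < 1 /\ exists F M,
  antiderivative F (fun v => (- D v)^-1) vp 1 /\ {in `]vp, 1[, forall v, F v <= M}.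

Section Exponent.
Variable q : R.
Hypotheses (q_gt0 : 0 < q) (Nq : 0 < N q vp) (v1 : vp < 1).
Let q_ge0 : 0 <= q := ltW q_gt0.

Let Npos v : vp <= v < 1 -> 0 < N q v.
Proof.
move=> /andP[vv vlt].
have [_ _ _ H _] := killing_balance_phi mu_ge0 r_distr q_ge0.
apply: H; first by left.
rewrite vlt andbT (lt_le_trans _ vv)//.
exact: (phi_lt_varphi mu_ge0 p_distr p0_gt0 p1_eq0 r_distr).
Qed.

Lemma killing_balance_lower : exists2 k, 0 < k & {in `]vp, 1[, forall v, k <= N q v}.
Proof.
have q20 : 0 < q / 2 by rewrite divr_gt0.
have [s0 /andP[s00 s01] Hs] := killing_balance_near1 mu_ge0 r_distr q q20.
pose s := Num.max s0 ((vp + 1) / 2).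
have vs : vp < s by rewrite lt_max; apply/orP; right; move: v1; lra.
have s1 : s < 1 by rewrite gt_max s01/=; move: v1; lra.
have cN := continuous_oo_within vp0 s1 (killing_balance_cont01 (mu := mu) r_distr (q := q)).
have [c0 c0in Hc] := EVT_min (ltW vs) cN.
have Nc : 0 < N q c0.
  by apply: Npos; move: c0in; rewrite in_itv/= => /andP[-> cs]; rewrite (le_lt_trans cs).
exists (Num.min (N q c0) (q / 2)); first by rewrite lt_min Nc.
move=> v; rewrite in_itv/= => /andP[vv vlt]; rewrite ge_min.
have [vs'|sv] := leP v s; first by rewrite Hc// in_itv/= (ltW vv).
apply/orP; right; have := Hs v; rewrite vlt andbT ltW; last first.
  by apply: le_lt_trans sv; rewrite le_max lexx.
by move=> /(_ isT); rewrite ler_norml; lra.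
Qed.

Let ratio_cont : {in `]vp, 1[, continuous (ratio q)}.
Proof.
move=> v vv; have v01 := sub01 vv.
apply: cvgM; first exact: (killing_balance_cont01 r_distr v01).
apply: cvgV; last exact: branching_drift_cont.
by rewrite -oppr_eq0 gt_eqF// D_lt0.
Qed.

Let ratioN v : - ratio q v = N q v * (- D v)^-1.
Proof. by rewrite /drift_ratio invrN mulrN. Qed.

(** The balance is at most q + mu, so the exponent based at 1 converges as soon
    as the drift time does. *)
Lemma escape_exponent : finite_drift_time -> exists G,
  [/\ antiderivative G (ratio q) vp 1, G x @[x --> 1^'-] --> (0 : R)
    & forall v, v \in `]vp, 1[ ->
        oriented_integral v 1 (gamma_ lam mu p r q) = (G v)%:E].
Proof.
move=> [_ [F [M [dF FM]]]].
have cg : {in `]vp, 1[, continuous (fun v => - ratio q v)}.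
  by move=> v vv; apply: cvgN; exact: ratio_cont.
have [H dH] := antiderivative_exists v1 cg.
have g0 : {in `]vp, 1[, forall v, 0 <= - ratio q v}.
  move=> v vv; rewrite ratioN mulr_ge0 ?invr_ge0 ?ltW ?D_lt0//.
  by apply: Npos; move: vv; rewrite in_itv/= => /andP[/ltW ->].
have ndH := antiderivative_nondecreasing dH g0.
have dqF : antiderivative (fun v => (q + mu) * F v) (fun v => (q + mu) * (- D v)^-1) vp 1.
  by move=> v /dF dv; exact: is_deriveZ.
have le : {in `]vp, 1[, forall v, - ratio q v <= (q + mu) * (- D v)^-1}.
  move=> v vv; rewrite ratioN ler_pM2r ?invr_gt0 ?D_lt0//.
  by apply: (killing_balance_le mu_ge0 r_distr); move: (sub01 vv); rewrite in_itv/= =>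
      /andP[-> /ltW].
pose m := (vp + 1) / 2.
have [vm m1] : vp < m /\ m < 1 by move: v1; rewrite /m; lra.
have mv : m \in `]vp, 1[ by rewrite in_itv/= vm.
have qm0 : 0 <= q + mu by rewrite addr_ge0.
have ub v : v \in `]vp, 1[ -> m <= v -> H v <= H m + (q + mu) * (M - F m).
  move=> vv mv'; have := antiderivative_le dH dqF le mv vv mv'.
  have := ler_wpM2l qm0 (FM v vv); lra.
have : cvg (H x @[x --> 1^'-]).
  apply: nondecreasing_at_left_is_cvgr.
    near=> x => y z; rewrite !in_itv/= => /andP[y0 yx] /andP[z0 zx] yz.
    have xv : vp < x by near: x; exact: nbhs_left_gt.
    by apply: ndH => //; rewrite in_itv/= ?yx ?zx (lt_trans xv).
  near=> x; have xm : m < x by near: x; exact: nbhs_left_gt.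
  exists (H m + (q + mu) * (M - F m)) => _ /= [y] + <-; rewrite in_itv/= => /andP[xy y1].
  have my : m < y by exact: lt_trans xy.
  by apply: ub; [rewrite in_itv/= y1 (lt_trans vm)|exact: ltW].
move=> /cvg_ex[e /= He]; exists (fun v => e - H v); split.
- move=> v /dH dv; rewrite -[ratio q v]opprK -[X in is_derive _ _ _ X]add0r.
  by apply: is_deriveB.
- by rewrite -(subrr e); apply: cvgB => //; exact: cvg_cst.
- move=> v vv; rewrite -(oriented_antiderivative_r _ cg g0 dH He) ?in_itv//.
  rewrite /oriented_integral; move: (vv); rewrite in_itv/= => /andP[vv' vl].
  rewrite (ltW vl); apply: eq_integral => w /set_mem /=; rewrite in_itv/= => /andP[vw w1].
  have ww : w \in `]vp, 1[ by rewrite in_itv/= w1 (lt_trans vv').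
  rewrite /gamma_ ratioN; congr ((_ / _)%:E).
  rewrite /rho ltr0_norm ?mulrN//.
  by have := D_lt0 ww; rewrite oppr_gt0 /D pmulr_rlt0.
Unshelve. all: by end_near. Qed.

(** Above varphi the drift is negative and the kernel carries the opposite sign;
    the exponential is 0 at varphi and 1 at 1, and this boundary value at 1
    gives (q - Q) I = 1 instead of a harmonic function. *)
Section Kernel.
Variable G : R -> R.
Hypotheses (dG : antiderivative G (ratio q) vp 1) (G1 : G x @[x --> 1^'-] --> (0 : R)).
Local Notation E v := (expR (- G v)).
Let Ke (v : R) : R := E v / (- D v).
Local Notation I := (power_moment Ke vp 1).

Let dE := exp_derive dG.
Let cE : {in `]vp, 1[, continuous (fun v => E v)} := antiderivative_continuous dE.

Let cKe : {in `]vp, 1[, continuous Ke}.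
Proof. by move=> v vv; apply: cvgM; [exact: cE|exact: drift_inv_cont]. Qed.

Let Ke_ge0 : {in `]vp, 1[, forall v, 0 <= Ke v}.
Proof. by move=> v vv; rewrite divr_ge0 ?expR_ge0 ?ltW ?D_lt0. Qed.

Let E1 : E x @[x --> 1^'-] --> (1 : R).
Proof.
have GN : - G x @[x --> 1^'-] --> - (0 : R) by exact: cvgN.
have := cvg_comp _ _ GN (@continuous_expR R _).
by rewrite oppr0 expR0.
Qed.

Let E0 : E x @[x --> vp^'+] --> (0 : R).
Proof.
have [k k0 Nk] := killing_balance_lower.
have dNG : antiderivative (fun v => - G v) (fun v => - ratio q v) vp 1.
  by move=> v /dG dv; exact: is_deriveN.
have := antiderivative_unbounded_l v1 (divr_gt0 k0 lam_gt0) dNG.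
move=> H; have {}H M : exists2 w, w \in `]vp, 1[ & forall v, vp < v <= w -> - G v <= M.
  apply: H => v vv; have vv0 : 0 < v - vp by move: vv; rewrite in_itv/= subr_gt0 => /andP[].
  rewrite ratioN -mulrA -invfM ler_pM ?(ltW k0)//.
  - by rewrite invr_ge0 mulr_ge0// ltW.
  - exact: Nk.
  - rewrite lef_pV2 ?posrE ?D_lt0 ?(mulr_gt0 lam_gt0 vv0)//.
    exact: (branching_drift_ge lam_gt0 p_distr p0_gt0 p1_eq0).
apply/cvgrPdist_le => e e0; have [w wv Hw] := H (ln e); near=> x.
rewrite sub0r normrN ger0_norm ?expR_ge0// -[leRHS]lnK ?posrE// ler_expR.
apply: Hw; apply/andP; split.
  by near: x; exact: nbhs_right_gt.
near: x; apply: nbhs_right_le; by move: wv; rewrite in_itv/= => /andP[].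
Unshelve. all: by end_near. Qed.

Let Ke_lty : (\int[leb]_(v in `]vp, 1%R[) (Ke v)%:E < +oo)%E.
Proof.
have [k k0 Nk] := killing_balance_lower.
apply: (balance_kernel_lty r_distr (ltW vp0) (lexx 1) v1 k0 Nk cKe Ke_ge0 _ E0 E1).
by move=> v /dE; rewrite -mulNr ratioN /Ke mulrAC mulrA.
Qed.

Let Ifin n : I n \is a fin_num.
Proof. by apply: power_moment_fin => //; exact: ltW. Qed.

Lemma escape_moment_ge0 n : 0 <= fine (I n).
Proof. by apply: fine_ge0; apply: power_moment_ge0 => //; exact: ltW. Qed.

Lemma escape_moment_eventually0 : eventually_le (fun n => fine (I n)) (fun=> 0).
Proof. by apply: power_moment_eventually0 => //; exact: ltW. Qed.

Lemma escape_moment_harmonic i : (0 < i)%N ->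
  (J (EFin \o (fun n => fine (I n))) i + 1 = ((q + c i) * fine (I i))%:E)%E.
Proof.
move=> i0; have -> : (EFin \o (fun n => fine (I n))) = I.
  by apply/funext => n /=; rewrite fineK.
have dB : antiderivative (fun v => - (E v * v ^+ i))
    (fun v => Ke v * (i%:R * v ^+ i.-1 * D v - N q v * v ^+ i)) vp 1.
  move=> v vv.
  have := is_deriveN (is_deriveM (dE vv) (is_derive_power i v)).
  rewrite /GRing.scale/=; congr (is_derive _ _ _ _).
  have D0 : D v != 0 by rewrite -oppr_eq0 gt_eqF// D_lt0.
  by rewrite /Ke /drift_ratio; field.
have B0 : - (E x * x ^+ i) @[x --> vp^'+] --> (0 : R).
  rewrite -oppr0 -(mul0r (vp ^+ i)); apply: cvgN; apply: cvgM => //.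
  by apply: cvg_at_right_filter; exact: exprn_continuous.
have B1 : - (E x * x ^+ i) @[x --> 1^'-] --> (- (1 * 1 ^+ i) : R).
  apply: cvgN; apply: cvgM => //.
  by apply: cvg_at_left_filter; exact: exprn_continuous.
have := power_moment_harmonic lam_gt0 mu_ge0 p_distr r_distr (ltW vp0) (lexx 1) v1 i0 q_ge0
    cKe Ke_ge0 dB B0 B1.
rewrite adde0 expr1n mulr1 => ->; rewrite -{1}(fineK (Ifin i)) -EFinM -!EFinD; congr (_%:E).
by ring.
Qed.

Lemma Psi_moment n : (forall v, v \in `]vp, 1[ ->
    oriented_integral v 1 (gamma_ lam mu p r q) = (G v)%:E) ->
  Psi lam mu p r q n = 1 - q * fine (I n).
Proof.
move=> GE; congr (_ - _ * fine _); apply: eq_integral => v /set_mem vv.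
rewrite GE// -EFinN/= -EFinM /Ke /rho ltr0_norm -?mulrN; last first.
  by have := D_lt0 vv; rewrite oppr_gt0 /D pmulr_rlt0.
by rewrite mulrN mulrAC mulrA.
Qed.

End Kernel.

Lemma escape_Psi a x : finite_drift_time -> (a <= x)%N ->
  escape a q x = Psi lam mu p r q x - Psi lam mu p r q a * hit a q x.
Proof.
move=> fd ax; have [G [dG G1 GE]] := escape_exponent fd.
rewrite !(Psi_moment _ GE).
have := escape_identity lam_gt0 mu_ge0 p_distr p0_gt0 r_distr q_gt0
  (escape_moment_ge0 G) (escape_moment_eventually0 dG G1) (escape_moment_harmonic dG G1)
  (hit_eventually0 lam_gt0 mu_ge0 p_distr p0_gt0 p1_eq0 r_distr a q_gt0 Nq) ax.
by lra.
Qed.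

Lemma escape_eventually1 a : finite_drift_time -> eventually_le (fun=> 1) (escape a q).
Proof.
move=> fd; have [G [dG G1 GE]] := escape_exponent fd.
move=> e e0.
have h_oo := hit_eventually0 lam_gt0 mu_ge0 p_distr p0_gt0 p1_eq0 r_distr a q_gt0 Nq.
have id := escape_identity lam_gt0 mu_ge0 p_distr p0_gt0 r_distr q_gt0
  (escape_moment_ge0 G) (escape_moment_eventually0 dG G1) (escape_moment_harmonic dG G1) h_oo.
have e20 : 0 < e / 2 by rewrite divr_gt0.
have eq0 : 0 < e / 2 / q by rewrite divr_gt0.
have [M1 H1] := h_oo _ e20.
have [M2 H2] := escape_moment_eventually0 dG G1 eq0.
exists (maxn a (maxn M1 M2)) => n; rewrite !geq_max => /and3P[an /H1 h1 /H2 h2].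
have := id n an; move: h1 h2; rewrite !add0r => h1; rewrite ler_pdivlMr// => h2.
have := mulr_ge0 (mulr_ge0 q_ge0 (escape_moment_ge0 G a))
  (hit_fine_ge0 lam_gt0 mu_ge0 p_distr r_distr a q_ge0 n).
by move: h1 h2; lra.
Qed.

End Exponent.

End EscapePotential.

(** * Slow drift excludes explosion *)

Section ExplosionCriterion.
Variables (R : realType) (lam mu : R) (p : nat -> R) (r : int -> R).
Hypotheses (lam_gt0 : 0 < lam) (mu_ge0 : 0 <= mu).
Hypotheses (p_distr : is_distribution p) (p0_gt0 : 0 < p 0%N) (p1_eq0 : p 1%N = 0).
Hypothesis r_distr : is_immigration_distribution r.
Local Notation N := (killing_balance mu r).
Local Notation c := (exit_rate lam mu).
Local Notation J := (jump_sum lam mu p r).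
Local Notation leb := (@lebesgue_measure R).
Local Notation vp := (varphi p).
Local Notation D := (branching_drift lam p).
Local Notation escape := (escape_fine lam mu p r).
Let vp0 : 0 < vp. Proof. exact: varphi_gt0. Qed.
Let vp1 : vp <= 1. Proof. exact: varphi_le1. Qed.
Let D_lt0 v : v \in `]vp, 1[ -> 0 < - D v.
Proof. by move=> vv; rewrite oppr_gt0; exact: (branching_drift_lt0 lam_gt0 p_distr p0_gt0
    p1_eq0). Qed.

Lemma balance_power_near1 (q e : R) (i : nat) : 0 < e -> 0 < q ->
  exists2 s, 0 < s < 1 & forall v, s <= v < 1 -> 1 - e <= v ^+ i /\ N q v <= q + e / 2.
Proof.
move=> e0 q0; have e20 : 0 < e / 2 by rewrite divr_gt0.
have [s1 /andP[s10 s11] H1] := killing_balance_near1 mu_ge0 r_distr q e20.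
have /cvgrPdist_lt /(_ e e0) [d /= d0 Hd] := @exprn_continuous R i 1.
exists (Num.max s1 (1 - d / 2)).
  by rewrite lt_max s10/= gt_max s11/=; lra.
move=> v /andP[]; rewrite ge_max => /andP[sv vd] v1; split.
  have := Hd v; rewrite /= expr1n ger0_norm ?subr_ge0 ?(ltW v1)//.
  have -> : 1 - v < d by lra.
  move=> /(_ isT); rewrite ltr_norml => /andP[_]; lra.
by have := H1 v; rewrite sv v1 => /(_ isT); rewrite ler_norml; lra.
Qed.

(** Below varphi the drift pushes powers up. *)
Lemma power_probe (v q e : R) (n : nat) : 0 < v < 1 -> 0 <= D v -> 0 <= q + e -> N q v <= q + e ->
  (0 < n)%N ->
  (((q + c n) * v ^+ n)%:E <= J (EFin \o (fun n => (v ^+ n)%R)) n + (q + e)%:E)%E.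
Proof.
move=> /andP[v0 v1] Dv qe Nv n0.
rewrite [J _ n](jump_sum_power_balance lam_gt0 mu_ge0 p_distr r_distr q) ?v0 ?(ltW v1)//.
have vn1 : v ^+ n <= 1 by rewrite exprn_ile1 ?ltW.
have vn0 : 0 <= v ^+ n by rewrite exprn_ge0 ?ltW.
have le1 : N q v * v ^+ n <= q + e.
  apply: (@le_trans _ _ ((q + e) * v ^+ n)); first exact: ler_wpM2r.
  by rewrite ler_piMr.
have le2 : 0 <= n%:R * v ^+ n.-1 * D v by apply: mulr_ge0 => //; apply: mulr_ge0 => //;
    rewrite exprn_ge0// ltW.
rewrite -EFinD lee_fin.
by lra.
Qed.

Let powers_cvg0 (s : R) : 0 < s < 1 -> eventually_le (fun n => s ^+ n) (fun=> 0).
Proof.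
move=> /andP[s0 s1]; apply: cvg0_eventually_le; apply: cvg_expr.
by rewrite ger0_norm// ltW.
Qed.

Definition drift_time_kernel (L v : R) : R := L^-1 * (- D v)^-1.

(** [F] is the time scale of the drift, on which the interval from [s0] to [s] has
    length [L]. For the uniform mixture of the powers over this interval the
    drift only leaves a boundary term, of size 1 / L. *)
Lemma mixture_probe (F : R -> R) (s0 s q e L : R) (n : nat) :
  vp < s0 -> s0 < s -> s < 1 -> 0 < L -> (0 < n)%N -> 0 <= q -> 0 <= q + e / 2 ->
  F s - F s0 = L -> L^-1 <= e / 2 ->
  antiderivative F (fun v => (- D v)^-1) vp 1 ->
  (forall v, s0 <= v < 1 -> N q v <= q + e / 2) ->
  ((q + c n)%:E * power_moment (drift_time_kernel L) s0 s n <=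
   J (power_moment (drift_time_kernel L) s0 s) n + (q + e)%:E)%E.
Proof.
move=> vs0 s0s s1 L0 n0 q0 qe FL Le dF Nle; set K := drift_time_kernel L.
have sub : {subset `]s0, s[ <= `]vp, 1[}.
  by move=> v; rewrite !in_itv/= => /andP[sv vs]; rewrite (lt_trans vs0) ?(lt_trans vs).
have s00 : 0 < s0 by exact: lt_trans vs0.
have cr := drift_inv_cont lam_gt0 p_distr p0_gt0 p1_eq0.
have cK : {in `]s0, s[, continuous K}.
  by move=> v /sub vv; apply: cvgM; [exact: cvg_cst|exact: cr].
have K0 : {in `]s0, s[, forall v, 0 <= K v}.
  by move=> v /sub vv; rewrite mulr_ge0 ?invr_ge0 ?ltW ?D_lt0.
have sub01 v : v \in `]vp, 1[ -> v \in `]0, 1[ by apply: itv_sub01; [exact: ltW|exact: lexx].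
pose g v := N q v * v ^+ n * (- D v)^-1.
have cg : {in `]vp, 1[, continuous g}.
  move=> v vv; apply: cvgM; last exact: cr.
  apply: cvgM; last exact: exprn_continuous.
  exact: (killing_balance_cont01 r_distr (sub01 v vv)).
have vlt1 : vp < 1 by rewrite (lt_trans vs0)// (lt_trans s0s).
have [H' dH] := antiderivative_exists vlt1 cg.
pose B v := - L^-1 * (v ^+ n + H' v).
have dB : antiderivative B (fun v => K v * (n%:R * v ^+ n.-1 * D v - N q v * v ^+ n)) vp 1.
  move=> v vv.
  have := is_deriveZ (- L^-1) (is_deriveD (is_derive_power n v) (dH v vv)).
  rewrite /GRing.scale/=; congr (is_derive _ _ _ _).
  have D0 : D v != 0 by rewrite -oppr_eq0 gt_eqF// D_lt0.
  by rewrite /K /drift_time_kernel /g; field; rewrite D0 gt_eqF.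
have cB := antiderivative_continuous dB.
have s0in : s0 \in `]vp, 1[ by rewrite in_itv/= vs0 (lt_trans s0s).
have sin : s \in `]vp, 1[ by rewrite in_itv/= s1 (lt_trans vs0).
have Bl : B x @[x --> s0^'+] --> B s0 by apply: cvg_at_right_filter; exact: cB.
have Bu : B x @[x --> s^'-] --> B s by apply: cvg_at_left_filter; exact: cB.
have harm := power_moment_harmonic lam_gt0 mu_ge0 p_distr r_distr (ltW s00) (ltW s1) s0s n0 q0
  cK K0 (antiderivative_sub (ltW vs0) (ltW s1) dB) Bl Bu.
have Hle : H' s - H' s0 <= (q + e / 2) * L.
  have dqF : antiderivative (fun v => (q + e / 2) * F v) (fun v => (q + e / 2) * (- D v)^-1) vp 1.
    by move=> v /dF dv; exact: is_deriveZ.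
  have dmax : antiderivative (fun v => (q + e / 2) * F v - H' v)
      (fun v => (q + e / 2) * (- D v)^-1 - g v) vp 1.
    by move=> v vv; apply: is_deriveB; [exact: dqF|exact: dH].
  have cmax := antiderivative_continuous dmax.
  have [|z zin E] := MVT s0s (fun z zin => dmax z (sub z zin)).
    exact: (continuous_oo_within vs0 s1 cmax).
  have : 0 <= (q + e / 2) * (- D z)^-1 - g z.
    have zv := sub z zin; have := sub01 z zv; rewrite in_itv/= => /andP[z0 z1].
    rewrite subr_ge0 ler_pM2r ?invr_gt0 ?D_lt0//.
    have zn1 : z ^+ n <= 1 by rewrite exprn_ile1 ?ltW.
    have zn0 : 0 <= z ^+ n by rewrite exprn_ge0 ?ltW.
    apply: (@le_trans _ _ ((q + e / 2) * z ^+ n)); last by rewrite ler_piMr.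
    apply: ler_wpM2r => //; apply: Nle; rewrite z1 andbT.
    by move: zin; rewrite in_itv/= => /andP[/ltW].
  move=> h; have : 0 <= ((q + e / 2) * (- D z)^-1 - g z) * (s - s0).
    by rewrite mulr_ge0// subr_ge0 ltW.
  rewrite -E -FL; lra.
have sn1 : s ^+ n <= 1.
  by rewrite exprn_ile1 ?ltW//; exact: lt_trans s0s.
have s0n0 : 0 <= s0 ^+ n by rewrite exprn_ge0 ?ltW.
have key : B s0 - B s <= q + e.
  have -> : B s0 - B s = L^-1 * (s ^+ n - s0 ^+ n) + L^-1 * (H' s - H' s0) by rewrite /B; ring.
  have h1 : L^-1 * (s ^+ n - s0 ^+ n) <= L^-1 * 1.
    by apply: ler_wpM2l; [rewrite invr_ge0 ltW|lra].
  have h2 : L^-1 * (H' s - H' s0) <= q + e / 2.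
    by rewrite mulrC ler_pdivrMr.
  by move: h1 h2 Le; lra.
have -> : ((q + c n)%:E * power_moment K s0 s n =
  J (power_moment K s0 s) n + (B s0 - B s)%:E)%E.
  by rewrite EFinB addeA harm addeK.
by rewrite leeD2l// lee_fin.
Qed.

(** Probes for [escape_vanish]: for varphi = 1 a single power of a number close
    to 1; otherwise a mixture over an interval close to 1 on which the drift
    spends a long time. *)
Lemma escape_slow_drift a q i : ~ finite_drift_time lam p -> 0 < q -> (a <= i)%N ->
  escape a q i = 0.
Proof.
move=> slow q0 ai.
apply: (escape_vanish lam_gt0 mu_ge0 p_distr p0_gt0 r_distr q0 ai) => e e0.
have [s0' /andP[s0'0 s0'1] Hs0] := balance_power_near1 i e0 q0.
have [v1|vge] := ltP vp 1; last first.
  have vpE : vp = 1 by apply/eqP; rewrite eq_le vp1.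
  have [vi Nv] : 1 - e <= s0' ^+ i /\ N q s0' <= q + e / 2 by apply: Hs0; rewrite lexx.
  exists (fun n => s0' ^+ n); split.
  - by move=> n; rewrite exprn_ge0 ?exprn_ile1 ?ltW.
  - by apply: powers_cvg0; rewrite s0'0.
  - move=> n an; apply: power_probe.
    + by rewrite s0'0.
    + by rewrite ltW// (branching_drift_gt0 lam_gt0 p_distr p0_gt0 p1_eq0)// vpE in_itv/= s0'0.
    + by rewrite addr_ge0 ?ltW.
    + by move: Nv e0; lra.
    + exact: leq_ltn_trans an.
  - exact: vi.
pose s0 := Num.max s0' ((vp + 1) / 2).
have vs0 : vp < s0 by rewrite lt_max; apply/orP; right; move: v1; lra.
have s01 : s0 < 1 by rewrite gt_max s0'1/=; move: v1; lra.
have s0le : s0' <= s0 by rewrite le_max lexx.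
have s00 : 0 < s0 by exact: lt_le_trans s0le.
have cr := drift_inv_cont lam_gt0 p_distr p0_gt0 p1_eq0.
have [F dF] := antiderivative_exists v1 cr.
have nd := antiderivative_nondecreasing dF (fun v vv => ltW (etrans (invr_gt0 _) (D_lt0 vv))).
have s0in : s0 \in `]vp, 1[ by rewrite in_itv/= vs0.
have [s [/andP[ss0 s1] Fs]] : exists s, s0 < s < 1 /\ F s0 + 2 / e + 1 <= F s.
  apply: contrapT => no; apply: slow; split=> //; exists F, (F s0 + 2 / e + 1).
  split=> // v vv; rewrite leNgt; apply/negP => lt; apply: no; exists v.
  split; last exact: ltW.
  move: (vv); rewrite in_itv/= => /andP[_ ->]; rewrite andbT ltNge; apply/negP => vs.
  have := nd _ _ vv s0in vs; have : 0 < 2 / e by rewrite divr_gt0.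
  by move: lt; lra.
pose L := F s - F s0.
have e2 : 0 < 2 / e by rewrite divr_gt0.
have Lge : 2 / e <= L by move: Fs; rewrite /L; lra.
have L0 : 0 < L by exact: lt_le_trans Lge.
have Le : L^-1 <= e / 2 by rewrite -invf_div lef_pV2 ?posrE.
have sin : s \in `]vp, 1[ by rewrite in_itv/= s1 (lt_trans vs0).
set K := drift_time_kernel L.
have cK : {in `]vp, 1[, continuous K}.
  by move=> v vv; apply: cvgM; [exact: cvg_cst|exact: cr].
have cKs := continuous_oo_sub (ltW vs0) (ltW s1) cK.
have sub : {subset `]s0, s[ <= `]vp, 1[}.
  by move=> v; rewrite !in_itv/= => /andP[sv vs]; rewrite (lt_trans vs0) ?(lt_trans vs).
have K0 : {in `]s0, s[, forall v, 0 <= K v}.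
  by move=> v /sub vv; rewrite mulr_ge0 ?invr_ge0 ?ltW ?D_lt0.
have IK : (\int[leb]_(v in `]s0, s[) (K v)%:E = 1)%E.
  have dK : antiderivative (fun v => L^-1 * F v) K vp 1.
    by move=> v /dF dv; exact: is_deriveZ.
  have := oriented_antiderivative s0in sin cK dK.
  rewrite /oriented_integral ltW// => ->.
  by rewrite -mulrBr mulVf// gt_eqF.
have IKC (C : R) : 0 <= C -> (\int[leb]_(v in `]s0, s[) (C * K v)%:E = C%:E)%E.
  move=> C0; under eq_integral do rewrite EFinM.
  rewrite ge0_integralZl// ?IK ?mule1//.
  by apply/measurable_EFinP; exact: continuous_oo_measurable.
have cC (C : R) : {in `]s0, s[, continuous (fun v => C * K v)}.
  by move=> v vv; apply: cvgM; [exact: cvg_cst|exact: cKs].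
have pow v n : v \in `]s0, s[ -> 0 <= s0 ^+ n <= v ^+ n /\ v ^+ n <= s ^+ n.
  rewrite in_itv/= => /andP[sv vs]; have v0 : 0 < v by exact: lt_trans sv.
  have s_gt0 : 0 < s by exact: lt_trans vs.
  have pw (y z : R) : 0 < y -> y < z -> y ^+ n <= z ^+ n.
    move=> y0 yz; have z0 := lt_trans y0 yz.
    by rewrite lerXn2r// ?nnegrE ltW.
  by rewrite !pw// exprn_ge0// ltW.
have s_gt0 : 0 < s by exact: lt_trans ss0.
have low n : ((s0 ^+ n)%:E <= power_moment K s0 s n)%E.
  rewrite -[leLHS]IKC; last by rewrite exprn_ge0// ltW.
  apply: integral_oo_le => //; first exact: power_kernel_cont.
  move=> v vv; have [/andP[p0 p1] _] := pow v n vv; have Kv := K0 v vv.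
  by apply/andP; split; [exact: mulr_ge0|rewrite mulrC; exact: ler_wpM2l].
have upp n : (power_moment K s0 s n <= (s ^+ n)%:E)%E.
  rewrite -[leRHS]IKC; last by rewrite exprn_ge0// ltW.
  apply: integral_oo_le => //; first exact: power_kernel_cont.
  move=> v vv; have [/andP[p0 p1] p2] := pow v n vv; have Kv := K0 v vv.
  apply/andP; split; last by rewrite [leRHS]mulrC; exact: ler_wpM2l.
  by apply: mulr_ge0 => //; exact: le_trans p1.
have mfin n : power_moment K s0 s n \is a fin_num.
  rewrite ge0_fin_numE ?(le_lt_trans (upp n)) ?ltry//.
  by apply: le_trans (low n); rewrite lee_fin exprn_ge0// ltW.
pose m n := fine (power_moment K s0 s n).
have mlow n : s0 ^+ n <= m n by rewrite -lee_fin fineK.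
have mupp n : m n <= s ^+ n by rewrite -lee_fin fineK.
exists m; split.
- move=> n; rewrite (le_trans _ (mlow n)) ?exprn_ge0 ?(ltW s00)//=.
  by apply: le_trans (mupp n) _; rewrite exprn_ile1 ?ltW.
- move=> d d0; have [|M HM] := @powers_cvg0 s _ d d0; first by rewrite s_gt0.
  by exists M => n Mn; apply: le_trans (mupp n) _; exact: HM.
- move=> n an; have n0 : (0 < n)%N by exact: leq_ltn_trans an.
  have -> : EFin \o m = power_moment K s0 s by apply/funext => k /=; rewrite fineK.
  rewrite EFinM fineK//.
  apply: (mixture_probe (F := F) vs0 ss0 s1 L0 n0 (ltW q0)) => //.
    by rewrite addr_ge0 ?ltW// divr_gt0.
  move=> v /andP[sv v1']; apply: (Hs0 v _).2; rewrite v1' andbT.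
  exact: le_trans sv.
- apply: le_trans (mlow i); apply: (Hs0 s0 _).1; rewrite s01 andbT//.
Qed.

End ExplosionCriterion.

(** * Explosion, passage and the theorem *)

Section Assembly.
Variables (R : realType) (d : measure_display) (Omega : measurableType d).
Variables (P : nat -> probability Omega R) (X : R -> Omega -> option nat).
Variables (lam mu : R) (p : nat -> R) (r : int -> R).
Hypotheses (lam_gt0 : 0 < lam) (mu_ge0 : 0 <= mu).
Hypotheses (p_distr : is_distribution p) (p0_gt0 : 0 < p 0%N) (p1_eq0 : p 1%N = 0).
Hypothesis r_distr : is_immigration_distribution r.
Hypothesis X_chain : minimal_markov_chain (generator lam mu p r) P X.
Local Notation N := (killing_balance mu r).
Local Notation vp := (varphi p).
Local Notation zeta omega := (explosion_time (X ^~ omega)).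
Local Notation Tb a omega := (passage_time_below a (X ^~ omega)).

Lemma killing_balance_sign q : N q vp = q - mu * (rtilde r vp - 1).
Proof. by rewrite /killing_balance; ring. Qed.

Lemma can_explode_finite_drift : can_explode P X -> finite_drift_time lam p.
Proof.
move=> /(can_explode_escape lam_gt0 mu_ge0 p_distr p1_eq0 r_distr X_chain)[y y0 e0].
apply: contrapT => slow; move: e0.
rewrite -escape_fineK// (escape_slow_drift lam_gt0 mu_ge0 p_distr p0_gt0 p1_eq0 r_distr slow)//.
by rewrite ltxx.
Qed.

Lemma escape_passage_disjoint a :
  [set omega | zeta omega < Tb a omega]%E `&` [set omega | Tb a omega < +oo]%E = set0.
Proof.
rewrite (escape_event X_chain) (passage_event X_chain) -subset0.
by move=> omega /= [[Sa _] [n _ [_ /=]]]; rewrite leqNgt Sa.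
Qed.

Lemma measurable_explosion_time : measurable_fun setT (fun omega => zeta omega).
Proof.
have [mX X_path _] := X_chain.
apply: (emeasurable_fun_cvg (fun n omega => jump_time (X ^~ omega) n)) => [n|omega _].
  exact: measurable_jump_time mX X_path n.
by apply: ereal_nondecreasing_cvgn => n m nm; exact: jump_time_homo.
Qed.

Lemma escape_le_probability a q x : 0 < q ->
  (escape_fine lam mu p r a q x <= fine (P x [set omega | zeta omega < Tb a omega]%E)).
Proof.
move=> q0; have q0' := ltW q0.
have mE := measurable_escape X_chain a.
rewrite -lee_fin escape_fineK// fineK; last exact: fin_num_measure.
rewrite -(escape_laplace lam_gt0 mu_ge0 p_distr p1_eq0 r_distr X_chain)//.
rewrite -[leRHS]mul1e -integral_cst//.
apply: (@le_trans _ _ (\int[P x]_(omega in [set omega | zeta omega < Tb a omega]%E)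
    (discount q (zeta omega))%:E)%E).
  rewrite le_eqVlt; apply/orP; left; apply/eqP; apply: eq_integral => omega /set_mem /= h.
  rewrite discount_fin//; last exact: explosion_time_ge0.
  by apply: lt_le_trans h _; exact: leey.
apply: ge0_le_integral => //.
- by move=> omega _; rewrite lee_fin discount_ge0.
- apply/measurable_EFinP; apply: measurableT_comp; first exact: measurable_discount.
  exact: measurable_funS measurable_explosion_time.
- by move=> omega _; rewrite lee_fin discount_le1// explosion_time_ge0.
Qed.

(** By [escape_eventually1] a chain started high explodes soon rather than coming
    down, which is the hypothesis at infinity of [hit_or_escape]. *)
Lemma escape_or_passage a x : 0 <= N 0 vp -> can_explode P X -> (a <= x)%N ->
  (P x [set omega | zeta omega < Tb a omega]%E +
   P x [set omega | Tb a omega < +oo]%E = 1)%E.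
Proof.
move=> N0 expl ax; have fd := can_explode_finite_drift expl.
have mE := measurable_escape X_chain a; have mT := measurable_passage X_chain a.
apply/eqP; rewrite eq_le; apply/andP; split.
  rewrite -measureU//; last exact: escape_passage_disjoint.
  by apply: probability_le1; exact: measurableU.
rewrite (passage_probability lam_gt0 mu_ge0 p_distr p1_eq0 r_distr X_chain) -hit_fineK//.
rewrite -[X in (_ <= X + _)%E]fineK ?fin_num_measure// -EFinD lee_fin.
have N1 : 0 < N 1 vp by move: N0; rewrite !killing_balance_sign; lra.
apply: (hit_or_escape lam_gt0 mu_ge0 p_distr p0_gt0 r_distr (q := 1)) => //.
  by move=> q' q'0; exact: escape_le_probability.
exact: (escape_eventually1 lam_gt0 mu_ge0 p_distr p0_gt0 p1_eq0 r_distr ltr01 N1 fd.1 a fd).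
Qed.

End Assembly.

Theorem theorem4p2 (R : realType) (d : measure_display)
    (Omega : measurableType d) (P : nat -> probability Omega R)
    (X : R -> Omega -> option nat)
    (lam mu : R) (p : nat -> R) (r : int -> R)
    (lam_gt0 : 0 < lam) (mu_ge0 : 0 <= mu)
    (p_distr : is_distribution p) (p0_gt0 : 0 < p 0%N) (p1_eq0 : p 1%N = 0)
    (r_distr : is_immigration_distribution r)
    (nondegenerate : (exists2 k : nat, (0 < k)%N & 0 < mu * r k%:Z) \/ p 0%N < 1)
    (X_chain : minimal_markov_chain (generator lam mu p r) P X)
    (a x : nat) (a_le_x : (a <= x)%N) (q : R) (q_ge0 : 0 <= q) :
  let zeta := fun omega => explosion_time (X ^~ omega) in
  let T := fun b omega => passage_time_below b (X ^~ omega) in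
  [/\ (mu * (rtilde r (varphi p) - 1) <= q <-> phi mu r q <= varphi p) /\
      (mu * (rtilde r (varphi p) - 1) <= q ->
       (\int[P x]_(omega in [set omega | T a omega < +oo])
          (expR (- q * fine (T a omega)))%:E)%E
       = (Phi lam mu p r q x / Phi lam mu p r q a)%:E),
      phi mu r 0 <= varphi p ->
      [/\ P x [set omega | (T a omega < +oo)%E]
          = (Phi lam mu p r 0 x / Phi lam mu p r 0 a)%:E,
          (exists2 y : nat, (0 < y)%N &
             P y [set omega | (T 0%N omega < +oo)%E] = 1%E) <->
          (forall y : nat, (0 < y)%N ->
             P y [set omega | (T 0%N omega < +oo)%E] = 1%E)
        & (exists2 y : nat, (0 < y)%N &
             P y [set omega | (T 0%N omega < +oo)%E] = 1%E) <->
          varphi p = 1 /\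
          [\/ mu = 0, phi mu r 0 = 1 | test_integral lam mu p r = +oo%E]],
      can_explode P X -> 0 < q ->
      (mu * (rtilde r (varphi p) - 1) < q <-> phi mu r q < varphi p) /\
      (mu * (rtilde r (varphi p) - 1) < q ->
       (\int[P x]_(omega in [set omega | zeta omega < T a omega])
          (expR (- q * fine (zeta omega)))%:E)%E
       = (Psi lam mu p r q x
          - Psi lam mu p r q a * (Phi lam mu p r q x / Phi lam mu p r q a))%:E)
    & phi mu r 0 <= varphi p -> can_explode P X ->
      (P x [set omega | (zeta omega < T a omega)%E]
       + P x [set omega | (T a omega < +oo)%E])%E = 1%E].
Proof.
move=> zeta T.
have le_q : (mu * (rtilde r (varphi p) - 1) <= q) = (phi mu r q <= varphi p).
  rewrite -(phi_le_varphi mu_ge0 p_distr p0_gt0 p1_eq0 r_distr q_ge0).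
  by rewrite killing_balance_sign subr_ge0.
have passage b y : P y [set omega | (T b omega < +oo)%E] = (hit_fine lam mu p r b 0 y)%:E.
  by rewrite hit_fineK//; exact: passage_probability.
split.
- split; first by rewrite le_q.
  rewrite le_q => phiv.
  rewrite /T (passage_laplace lam_gt0 mu_ge0 p_distr p1_eq0 r_distr X_chain)// -hit_fineK//.
  rewrite (hit_Phi lam_gt0 mu_ge0 p_distr p0_gt0 p1_eq0 r_distr)//.
  by rewrite (phi_le_varphi mu_ge0 p_distr p0_gt0 p1_eq0 r_distr q_ge0).
- move=> phiv; have N0 : 0 <= killing_balance mu r 0 (varphi p).
    by rewrite (phi_le_varphi mu_ge0 p_distr p0_gt0 p1_eq0 r_distr (lexx 0)).
  have certain y : (0 < y)%N -> P y [set omega | (T 0%N omega < +oo)%E] = 1%E <->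
      varphi p = 1 /\ [\/ mu = 0, phi mu r 0 = 1 | test_integral lam mu p r = +oo%E].
    move=> y0; rewrite passage.
    rewrite -(hit_certainP lam_gt0 mu_ge0 p_distr p0_gt0 p1_eq0 r_distr N0 y0).
    by split=> [[]|->].
  split.
  + by rewrite passage (hit_Phi lam_gt0 mu_ge0 p_distr p0_gt0 p1_eq0 r_distr).
  + split; last by move=> /(_ 1%N isT) h; exists 1%N.
    by move=> [y y0 /certain h] z z0; apply/certain => //; exact: h.
  + split; first by move=> [y y0 /certain]; apply.
    by move=> h; exists 1%N => //; apply/certain.
- move=> expl q_gt0.
  have lt_q : (mu * (rtilde r (varphi p) - 1) < q) = (0 < killing_balance mu r q (varphi p)).
    by rewrite killing_balance_sign subr_gt0.
  rewrite lt_q; split; first by rewrite (phi_lt_varphiE mu_ge0 p_distr p0_gt0 p1_eq0 r_distr q_gt0).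
  move=> Nq; have fd := can_explode_finite_drift lam_gt0 mu_ge0 p_distr p0_gt0 p1_eq0
      r_distr X_chain expl.
  rewrite /T /zeta (escape_laplace lam_gt0 mu_ge0 p_distr p1_eq0 r_distr X_chain)// -escape_fineK//.
  rewrite (escape_Psi lam_gt0 mu_ge0 p_distr p0_gt0 p1_eq0 r_distr q_gt0 Nq fd.1 fd a_le_x).
  by rewrite (hit_Phi lam_gt0 mu_ge0 p_distr p0_gt0 p1_eq0 r_distr q_ge0 (ltW Nq) a_le_x).
- move=> phiv expl; apply: (escape_or_passage lam_gt0 mu_ge0 p_distr p0_gt0 p1_eq0 r_distr
    X_chain) => //.
  by rewrite (phi_le_varphi mu_ge0 p_distr p0_gt0 p1_eq0 r_distr (lexx 0)).
Qed.
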